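(* Let $\phi:\mathbb{D}^2\to\mathbb{D}$ be holomorphic with model $(\mathcal{M},u)$, let $\tau=(\tau^1,\tau^2)\in\mathbb{T}^2$, $K>0$, and assume $\phi\neq\pi^1$. The following assertions are equivalent: (i) $\tau$ is a left Type II DW point for $\phi$ with constant $K$; (ii) $\phi$ is a left Type II function and, letting $\xi:\mathbb{D}\to\mathbb{D}$ denote the holomorphic function such that $\phi(\xi(\mu),\mu)=\xi(\mu)$ for all $\mu\in\mathbb{D}$, the point $\tau^2$ is a B-point for $\xi$, $\xi(\tau^2)=\tau^1$ and $$\liminf_{z\to\tau^2}\frac{1-|\xi(z)|}{1-|z|}\le\frac1K;$$ (iii) $\tau$ is a B-point for $\phi$, $\phi(\tau)=\tau^1$, the quantity $D_{-(\tau^1,\tau^2M)}\phi(\tau)$ is not constant with respect to $M>0$, and there exists $A\ge K$ such that $$\frac{D_{-(\tau^1,\tau^2A)}\phi(\tau)}{-\tau^1}=1.$$ Moreover, if any of these assertions holds, then $$A=\Big[\liminf_{z\to\tau^2}\frac{1-|\xi(z)|}{1-|z|}\Big]^{-1}$$ is the maximum among all constants $K>0$ such that $\tau$ is a left Type II DW point for $\phi$ with constant $K$, and it is also the unique positive number such that $D_{-(\tau^1,\tau^2A)}\phi(\tau)/(-\tau^1)=1$. The analogous statement holds for right Type II DW points: if $\phi\neq\pi^2$ (instead of $\phi\ne\pi^1$), the following are equivalent: (i') $\tau$ is a right Type II DW point for $\phi$ with constant $K$; (ii') $\phi$ is a right Type II function and, letting $\eta:\mathbb{D}\to\mathbb{D}$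 be the holomorphic function with $\phi(\lambda,\eta(\lambda))=\eta(\lambda)$ for all $\lambda\in\mathbb{D}$, $\tau^1$ is a B-point for $\eta$, $\eta(\tau^1)=\tau^2$ and $\liminf_{z\to\tau^1}\frac{1-|\eta(z)|}{1-|z|}\le\frac1K$; (iii') $\tau$ is a B-point for $\phi$, $\phi(\tau)=\tau^2$, $D_{-(\tau^1M,\tau^2)}\phi(\tau)$ is not constant in $M>0$ and there exists $A\ge K$ with $D_{-(\tau^1A,\tau^2)}\phi(\tau)/(-\tau^2)=1$. If any of these holds, $A=\big[\liminf_{z\to\tau^1}\frac{1-|\eta(z)|}{1-|z|}\big]^{-1}$ is the maximum among all $K>0$ such that $\tau$ is a right Type II DW point for $\phi$ with constant $K$, and the unique positive number such that $D_{-(\tau^1A,\tau^2)}\phi(\tau)/(-\tau^2)=1$.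
   Context: Notation. $\mathbb{D}$ is the open unit disk, $\mathbb{T}=\partial\mathbb{D}$, $\mathbb{H}=\{z\in\mathbb{C}:\Re z>0\}$, $\mathrm{cl}$ denotes closure. Superscripts $1,2$ are coordinate indices: $\lambda=(\lambda^1,\lambda^2)$. $\|(\lambda^1,\lambda^2)\|=\max\{|\lambda^1|,|\lambda^2|\}$. $\pi^i(\lambda)=\lambda^i$ are the coordinate projections on $\mathbb{D}^2$. $\mathcal{S}_2$ is the set of holomorphic functions on $\mathbb{D}^2$ bounded by $1$ in modulus. For $\phi\in\mathcal{S}_2$, $\phi_\mu(\lambda)=\phi(\lambda,\mu)$ and $\widetilde\phi(\lambda^1,\lambda^2)=\phi(\lambda^2,\lambda^1)$. Models. A model $(\mathcal{M},u)$ for $\phi\in\mathcal{S}_2$ consists of a separable Hilbert space with orthogonal decomposition $\mathcal{M}=\mathcal{M}^1\oplus\mathcal{M}^2$ and a holomorphic map $u:\mathbb{D}^2\to\mathcal{M}$, $\lambda\mapsto u_\lambda$, such that for all $\lambda,\mu\in\mathbb{D}^2$, $1-\phi(\lambda)\overline{\phi(\mu)}=(1-\lambda^1\overline{\mu^1})\langle u^1_\lambda,u^1_\mu\rangle+(1-\lambda^2\overline{\mu^2})\langle u^2_\lambda,u^2_\mu\rangle$, where $v^j$ is the orthogonal projection of $v\in\mathcal{M}$ onto $\mathcal{M}^j$. Every $\phi\in\mathcal{S}_2$ has a model. Boundary points. A set $S\subset\mathbb{D}^2$ approaches $\tau\in\partial\mathbb{D}^2$ nontangentially if $\tau\in\mathrm{cl}(S)$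 and there is $c>0$ with $\|\tau-\lambda\|\le c(1-\|\lambda\|)$ for all $\lambda\in S$. $\tau\in\partial\mathbb{D}^2$ is a B-point for $\phi$ if $\liminf_{\lambda\to\tau}\frac{1-|\phi(\lambda)|}{1-\|\lambda\|}<\infty$; then the nontangential limit of $\phi$ at $\tau$ exists and is denoted $\phi(\tau)$. Likewise, $t\in\mathbb{T}$ is a B-point for a holomorphic $f:\mathbb{D}\to\mathbb{D}$ if $\liminf_{z\to t}\frac{1-|f(z)|}{1-|z|}<\infty$, and $f(t)$ is then the nontangential limit. For a B-point $\tau$ of $\phi$, $Y_\tau$ is the set of weak limits in $\mathcal{M}$ of weakly convergent sequences $\{u_{\lambda_n}\}$, over sequences $\lambda_n\to\tau$ in $\mathbb{D}^2$ for which $\frac{1-|\phi(\lambda_n)|}{1-\|\lambda_n\|}$ stays bounded. For a B-point $\tau\in\mathbb{T}^2$ and $\delta\in\tau^1\mathbb{H}\times\tau^2\mathbb{H}$ the directional derivative $D_{-\delta}\phi(\tau)=\lim_{t\to0+}\frac{\phi(\tau-t\delta)-\phi(\tau)}{t}$ exists. Types of functions. $\phi$ is a left Type II function if $\phi\ne\pi^1$ and there is a holomorphic $\xi:\mathbb{D}\to\mathbb{D}$ such that for all $\lambda,\mu\in\mathbb{D}$: $\phi_\mu(\lambda)=\lambda$ if and only if $\xi(\mu)=\lambda$. $\phi$ is a right Type II function if $\widetilde\phi$ is a left Type II function. DW points. Let $\phi\in\mathcal{S}_2$, $\phi\ne\pi^1$, with model $(\mathcal{M},u)$. A point $(\tau^1,\sigma)\in\mathbb{T}\times\mathrm{cl}(\mathbb{D})$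 is a left Type I DW point for $\phi$ if it is a B-point, $\phi(\tau^1,\sigma)=\tau^1$, and there exists $v\in Y_{(\tau^1,\sigma)}$ with $\|v^1\|\le1$ and $v^2=0$. A point $\tau=(\tau^1,\tau^2)\in\mathbb{T}^2$ is a left Type II DW point for $\phi$ if it is a B-point, $\phi(\tau)=\tau^1$, there exists $u_\tau\in Y_\tau$ with $\|u^1_\tau\|<1$, and $\tau$ is not a left Type I DW point for $\phi$; if moreover $K>0$ is such that $\|u^1_\tau\|^2+K\|u^2_\tau\|^2\le1$ for such a $u_\tau$, then $\tau$ is a left Type II DW point with constant $K$. If $\phi\ne\pi^2$, $\tau=(\tau^1,\tau^2)\in\mathbb{T}^2$ is a right Type II DW point for $\phi$ (with constant $K$) if $(\tau^2,\tau^1)$ is a left Type II DW point for $\widetilde\phi$ (with constant $K$). *)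

(* Defs.v *)
From HB Require Import structures.
From mathcomp Require Import all_boot all_order all_algebra.
From mathcomp Require Import all_classical all_reals all_analysis.
From mathcomp Require Import complex.

Set Implicit Arguments.
Unset Strict Implicit.
Unset Printing Implicit Defensive.

Import Order.TTheory GRing.Theory Num.Theory.
Import numFieldNormedType.Exports.

Local Open Scope classical_set_scope.
Local Open Scope ring_scope.

(* The alias lets inference find the normed-module structure on R[i], which is
   declared for the sort of an arbitrary numClosedFieldType. *)
Definition Cplx (R : realType) : numClosedFieldType := R[i].

Definition toC (R : realType) (x : R) : Cplx R := (x%:C)%C.

Section Discs.
Context {R : realType}.
Local Notation C := (Cplx R).

(* Norms in a normed module over C take values in C; this is the same norm as
   an element of R. *)
Definition rnorm {V : normedModType C} (x : V) : R := complex.Re `|x|.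

(* For V := C this is the unit disc.  The library norm on C * C is the maximum
   of the two moduli, so for V := C * C this is the bidisc. *)
Definition unit_ball (V : normedModType C) : set V := [set x | rnorm x < 1].
Definition unit_sphere (V : normedModType C) : set V := [set x | rnorm x = 1].

Definition disc : set C := @unit_ball C.
Definition circle : set C := @unit_sphere C.
Definition bidisc : set (C * C) := @unit_ball (C * C)%type.

(* Complex Frechet differentiability at every point of the open ball. *)
Definition holomorphic {V W : normedModType C} (f : V -> W) : Prop :=
  forall x, unit_ball x -> differentiable f x.

Definition holo_into_disc {V : normedModType C} (f : V -> C) : Prop :=
  holomorphic f /\ forall x, unit_ball x -> disc (f x).

Definition nt_approaches {V : normedModType C} (S : set V) (t : V) : Prop :=
  [/\ S `<=` @unit_ball V, closure S t
    & exists2 c : R, 0 < c &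
        forall x, S x -> rnorm (t - x) <= c * (1 - rnorm x)].

(* "f(t) = w" at a boundary point t, in the sense of nontangential limits. *)
Definition nt_limit {V : normedModType C} (f : V -> C) (t : V) (w : C) : Prop :=
  forall S : set V, nt_approaches S t -> f @ within S (nbhs t) --> w.

Definition julia_quotient {V : normedModType C} (f : V -> C) (x : V) : R :=
  (1 - rnorm (f x)) / (1 - rnorm x).

Definition julia_liminf {V : normedModType C} (f : V -> C) (t : V) : \bar R :=
  limf_einf (fun x => (julia_quotient f x)%:E) (within (@unit_ball V) (nbhs t)).

Definition B_point {V : normedModType C} (f : V -> C) (t : V) : Prop :=
  unit_sphere t /\ (julia_liminf f t < +oo)%E.

(* "D_{-delta} phi(tau) exists and equals d"; phi(tau) is the nontangential
   limit w. *)
Definition dirderN (phi : C * C -> C) (tau delta : C * C) (d : C) : Prop :=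
  exists2 w : C, nt_limit phi tau w &
    (phi (tau - toC t *: delta) - w) / toC t @[t --> 0^'+] --> d.

Definition swap (l : C * C) : C * C := (l.2, l.1).

Definition left_typeII (phi : C * C -> C) : Prop :=
  ~ (forall l, bidisc l -> phi l = l.1) /\
  exists2 xi : C -> C, holo_into_disc xi &
    forall l m, disc l -> disc m -> (phi (l, m) = l <-> xi m = l).

Definition right_typeII (phi : C * C -> C) : Prop := left_typeII (phi \o swap).

End Discs.

Section Models.
Context {R : realType} {H : completeNormedModType (Cplx R)}.
Local Notation C := (Cplx R).

Definition closed_subspace (M : set H) : Prop :=
  [/\ closed M, M 0 & forall (a : C) x y, M x -> M y -> M (a *: x + y)].

(* [ip] is linear in its first argument and conjugate linear in the second.
   H is a separable Hilbert space for it and the orthogonal direct sum of M1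
   and M2, with orthogonal projections p1 and p2. *)
Record hilbert_decomposition (ip : {dot H for Num.conj}) (M1 M2 : set H)
    (p1 p2 : H -> H) : Prop := {
  norm_ip : forall x : H, ip x x = `|x| ^+ 2;
  separable : exists2 S : set H, countable S & dense S;
  closed1 : closed_subspace M1;
  closed2 : closed_subspace M2;
  orthogonal12 : forall x y, M1 x -> M2 y -> ip x y = 0;
  proj1_in : forall x, M1 (p1 x);
  proj2_in : forall x, M2 (p2 x);
  proj_sum : forall x, x = p1 x + p2 x }.

Record is_model (phi : C * C -> C) (ip : {dot H for Num.conj}) (M1 M2 : set H)
    (p1 p2 : H -> H) (u : C * C -> H) : Prop := {
  model_space : hilbert_decomposition ip M1 M2 p1 p2;
  model_holo : holomorphic u;
  model_eq : forall l m, bidisc l -> bidisc m ->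
    1 - phi l * (phi m)^* =
      (1 - l.1 * (m.1)^*) * ip (p1 (u l)) (p1 (u m))
    + (1 - l.2 * (m.2)^*) * ip (p2 (u l)) (p2 (u m)) }.

Definition weak_limit (ip : {dot H for Num.conj}) (v : nat -> H) (x : H) : Prop :=
  forall y : H, ip (v n) y @[n --> \oo] --> ip x y.

Definition Yset (phi : C * C -> C) (ip : {dot H for Num.conj}) (u : C * C -> H)
    (tau : C * C) : set H :=
  [set v | exists l : nat -> C * C,
    [/\ forall n, bidisc (l n),
        l n @[n --> \oo] --> tau,
        exists B : R, forall n, julia_quotient phi (l n) <= B
      & weak_limit ip (u \o l) v]].

Definition left_typeI_DW (phi : C * C -> C) (ip : {dot H for Num.conj})
    (p1 p2 : H -> H) (u : C * C -> H) (tau : C * C) : Prop :=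
  [/\ circle tau.1 /\ closure disc tau.2,
      B_point phi tau,
      nt_limit phi tau tau.1
    & exists v, [/\ Yset phi ip u tau v, rnorm (p1 v) <= 1 & p2 v = 0]].

Definition left_typeII_DW (phi : C * C -> C) (ip : {dot H for Num.conj})
    (p1 p2 : H -> H) (u : C * C -> H) (tau : C * C) : Prop :=
  [/\ circle tau.1 /\ circle tau.2,
      B_point phi tau,
      nt_limit phi tau tau.1,
      exists v, Yset phi ip u tau v /\ rnorm (p1 v) < 1
    & ~ left_typeI_DW phi ip p1 p2 u tau].

Definition left_typeII_DW_const (phi : C * C -> C) (ip : {dot H for Num.conj})
    (p1 p2 : H -> H) (u : C * C -> H) (tau : C * C) (K : R) : Prop :=
  [/\ left_typeII_DW phi ip p1 p2 u tau,
      0 < K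
    & exists v, [/\ Yset phi ip u tau v, rnorm (p1 v) < 1
                  & rnorm (p1 v) ^+ 2 + K * rnorm (p2 v) ^+ 2 <= 1]].

(* If (M1 (+) M2, u) is a model of phi, then (M2 (+) M1, u \o swap) is a model
   of phi \o swap; the right notion is taken with respect to that model. *)
Definition right_typeII_DW_const (phi : C * C -> C) (ip : {dot H for Num.conj})
    (p1 p2 : H -> H) (u : C * C -> H) (tau : C * C) (K : R) : Prop :=
  left_typeII_DW_const (phi \o swap) ip p2 p1 (u \o swap) (swap tau) K.

End Models.

(* Main.v *)
Require Import Defs.
From HB Require Import structures.
From mathcomp Require Import all_boot all_order all_algebra.
From mathcomp Require Import all_classical all_reals all_analysis.
From mathcomp Require Import complex ring lra.

Set Implicit Arguments.
Unset Strict Implicit.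
Unset Printing Implicit Defensive.

Import Order.TTheory GRing.Theory Num.Theory.
Import numFieldNormedType.Exports.

Local Open Scope classical_set_scope.
Local Open Scope ring_scope.

(** Everything is read off the model.  Its identity writes 1 - phi(l) conj(phi(m)) as a
    sum of two inner products, so that the Cauchy-Schwarz inequality in the model space
    takes the place of the function theory of the disc; information at tau is obtained by
    letting one of the arguments tend to tau ([julia_at], [boundary_vector]).

    Let w = phi(tau).  Along the segment (tau1 (1 - t), tau2 (1 - M t)) the vectors of the
    model converge in norm to a vector X M as t -> 0, and the derivative of phi at tau in
    the direction -(tau1, M tau2) is -w al(M), where al(M) = |p1 (X M)|^2 + M |p2 (X M)|^2
    ([radial_limit], [line_limit]).  Each v in Y_tau pairs with the vectors X M like the
    model with itself, and expanding |v - X M|^2 gives al(M) <= |v1|^2 + M |v2|^2.  Thus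
    al is a lower envelope of nondecreasing affine functions, hence nondecreasing and
    concave ([slope_tangent]).  If it takes a value twice then p2 (X M) = 0 for some M,
    and the pairing of this X M with the others shows that al is constant
    ([slope_eq_const]).

    Let now w = tau1.  If al <= 1 everywhere, the vectors X M converge as M tends to
    infinity, to a vector of Y_tau without second component, so that tau is of Type I; the
    converse holds too ([typeI_slope]).  Hence tau is of Type II with constant K if and
    only if al(A) = 1 for some A >= K and al is not constant ([typeII_slope]), which is
    the condition on the directional derivatives, and A is unique.

    For the function xi, the slices phi(., m) satisfy the Schwarz-Pick inequality, and a
    vector v in Y_tau with |v1| < 1 gives horodiscs at tau1 that they map into themselves.
    By Wolff's argument a slice has a fixed point, or else |phi(l) - tau1| is at most
    |l1 - tau1| |u1(l)| on the whole bidisc, which happens only at Type I points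
    ([fixed_or_dominated]).  At the fixed points the second component of the model does
    not vanish.  This makes the slices strictly contracting there, so that the fixed point
    xi(m) is unique and holomorphic in m ([fixed_branch_holomorphic]), and the horodisc
    inequality at the fixed points becomes Julia's inequality for xi at tau2 with constant
    1/K ([branch_horo]).  Conversely, let b be the lower limit belonging to xi.  By
    Julia's lemma xi has the radial derivative b at tau2, up to the factors tau1 and tau2
    ([radial_derivative]), so that the points (xi(n), n) with n = (1 - r) tau2 are
    hyperbolically close to the segment with M = 1/b.  The Schwarz-Pick inequality in the
    slice of n then turns phi(xi(n), n) = xi(n) into al(1/b) = 1 ([slope_of_branch]); in
    particular A = 1/b.

    The statement for right Type II points is the one for left Type II points of the
    function phi \o swap at swap tau. *)

(** * Moduli as real numbers *)

Section Modulus.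
Context {R : realType}.
Local Notation C := (Cplx R).
Implicit Types (z : C) (x y : R).

Lemma toC_re z : 0 <= z -> toC (complex.Re z) = z.
Proof. by move=> z0; exact: (RRe_real (ger0_real z0)). Qed.

Lemma toC_le x y : (toC x <= toC y) = (x <= y). Proof. exact: lecR. Qed.
Lemma toC_lt x y : (toC x < toC y) = (x < y). Proof. exact: ltcR. Qed.
Lemma toCD x y : toC (x + y) = toC x + toC y. Proof. exact: rmorphD. Qed.
Lemma toCB x y : toC (x - y) = toC x - toC y. Proof. exact: rmorphB. Qed.
Lemma toCN x : toC (- x) = - toC x. Proof. exact: rmorphN. Qed.
Lemma toCM x y : toC (x * y) = toC x * toC y. Proof. exact: rmorphM. Qed.
Lemma toCX x n : toC (x ^+ n) = toC x ^+ n. Proof. exact: rmorphXn. Qed.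
Lemma toCV x : toC x^-1 = (toC x)^-1. Proof. exact: fmorphV. Qed.
Lemma toC0 : toC 0 = 0 :> C. Proof. by []. Qed.
Lemma toC1 : toC 1 = 1 :> C. Proof. by []. Qed.
Lemma toC_inj : injective (@toC R). Proof. exact: complexI. Qed.
Lemma conj_toC x : (toC x : C)^* = toC x.
Proof. exact: (conjc_real x). Qed.
Lemma toC_conj z : toC (complex.Re z) = (z + z^*) / 2.
Proof. by rewrite [LHS]complexRe /= ReE. Qed.

Section NormedModule.
Context {V : normedModType C}.
Implicit Types v : V.

Lemma norm_toC v : `|v| = toC (rnorm v).
Proof. by rewrite toC_re. Qed.
Lemma rnorm_ge0 v : 0 <= rnorm v.
Proof. by rewrite -toC_le -norm_toC; exact: normr_ge0. Qed.
Lemma rnorm0 : rnorm (0 : V) = 0.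
Proof. by apply: toC_inj; rewrite -norm_toC normr0. Qed.
Lemma rnorm_eq0 v : rnorm v = 0 -> v = 0.
Proof. by move=> h; apply/eqP; rewrite -normr_eq0 norm_toC h. Qed.
Lemma rnormD v (w : V) : rnorm (v + w) <= rnorm v + rnorm w.
Proof. by rewrite -toC_le toCD -!norm_toC ler_normD. Qed.
Lemma rnormN v : rnorm (- v) = rnorm v.
Proof. by rewrite /rnorm normrN. Qed.
Lemma rnormB v (w : V) : rnorm (v - w) <= rnorm v + rnorm w.
Proof. by rewrite -(rnormN w) rnormD. Qed.
Lemma rnorm_subC v (w : V) : rnorm (v - w) = rnorm (w - v).
Proof. by rewrite -rnormN opprB. Qed.
Lemma rnormZ (a : C) v : rnorm (a *: v) = rnorm a * rnorm v.
Proof. by apply: toC_inj; rewrite toCM -!norm_toC normrZ. Qed.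
Lemma rnorm_lerB v (w : V) : rnorm v - rnorm w <= rnorm (v - w).
Proof. by rewrite lerBlDr; have := rnormD (v - w) w; rewrite subrK. Qed.
Lemma rnorm_tri (w v1 v2 : V) : rnorm (v1 - v2) <= rnorm (v1 - w) + rnorm (w - v2).
Proof. by have := rnormD (v1 - w) (w - v2); rewrite addrA subrK. Qed.

Lemma nbhs_rnorm v (P : set V) :
  nbhs v P <-> exists2 d : R, 0 < d & forall w, rnorm (w - v) < d -> P w.
Proof.
split.
  move=> /nbhs_ballP [e /= e0 eP]; exists (complex.Re e).
    by rewrite -toC_lt toC_re // ltW.
  move=> w; rewrite -toC_lt -norm_toC toC_re ?ltW // => h; apply: eP.
  by rewrite -ball_normE /= distrC.
move=> [d d0 dP]; apply/nbhs_ballP; exists (toC d); first by rewrite /= -toC0 toC_lt.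
by move=> w; rewrite -ball_normE /= distrC norm_toC toC_lt; apply: dP.
Qed.

Lemma cvg_rnorm {T : Type} (F : set_system T) {FF : Filter F} (f : T -> V) v :
  f @ F --> v <-> forall e : R, 0 < e -> \forall t \near F, rnorm (f t - v) < e.
Proof.
split.
  move=> fv e e0; have : nbhs v [set w | rnorm (w - v) < e] by apply/nbhs_rnorm; exists e.
  by move=> /fv.
move=> h P /nbhs_rnorm [d d0 dP]; apply: filterS (h d d0) => t; exact: dP.
Qed.

Lemma cvgn_rnorm (f : nat -> V) v :
  f n @[n --> \oo] --> v <->
  forall e : R, 0 < e -> exists N, forall n, (N <= n)%N -> rnorm (f n - v) < e.
Proof.
rewrite cvg_rnorm; split=> h e /h.
  by move=> [N _ NP]; exists N => n nN; exact: NP.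
by move=> [N NP]; exists N.
Qed.
End NormedModule.

Lemma rnormM (z w : C) : rnorm (z * w) = rnorm z * rnorm w.
Proof. by apply: toC_inj; rewrite toCM -!norm_toC normrM. Qed.
Lemma rnorm1 : rnorm (1 : C) = 1.
Proof. by apply: toC_inj; rewrite -norm_toC normr1. Qed.
Lemma rnormV z : rnorm z^-1 = (rnorm z)^-1.
Proof. by apply: toC_inj; rewrite toCV -!norm_toC normfV. Qed.
Lemma rnorm_conj z : rnorm z^* = rnorm z.
Proof. by apply: toC_inj; rewrite -!norm_toC norm_conjC. Qed.
Lemma rnorm_toC x : rnorm (toC x) = `|x|.
Proof.
apply: toC_inj; rewrite -norm_toC; have [x0|x0] := leP 0 x.
  by rewrite [X in _ = toC X]ger0_norm // ger0_norm // -toC0 toC_le.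
by rewrite [X in _ = toC X]ltr0_norm // toCN ltr0_norm // -toC0 toC_lt.
Qed.
Lemma rnorm_sqr z : rnorm z ^+ 2 = complex.Re z ^+ 2 + complex.Im z ^+ 2.
Proof. by apply: toC_inj; rewrite toCX -norm_toC -add_Re2_Im2. Qed.
Lemma conjM_rnorm z : z * z^* = toC (rnorm z ^+ 2).
Proof. by rewrite -normCK norm_toC toCX. Qed.
Lemma Re_le_rnorm z : `|complex.Re z| <= rnorm z.
Proof.
rewrite -(@ler_pXn2r _ 2) ?nnegrE ?rnorm_ge0 // rnorm_sqr real_normK ?num_real //.
by rewrite lerDl sqr_ge0.
Qed.
Lemma Im_le_rnorm z : `|complex.Im z| <= rnorm z.
Proof.
rewrite -(@ler_pXn2r _ 2) ?nnegrE ?rnorm_ge0 // rnorm_sqr real_normK ?num_real //.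
by rewrite lerDr sqr_ge0.
Qed.
Lemma rnorm_le_ReIm z : rnorm z <= `|complex.Re z| + `|complex.Im z|.
Proof.
rewrite -(@ler_pXn2r _ 2) ?nnegrE ?rnorm_ge0 ?addr_ge0 // rnorm_sqr.
rewrite sqrrD !real_normK ?num_real // lerD2r lerDl mulrn_wge0 // mulr_ge0 //.
Qed.

Lemma cRe_conj z : complex.Re z^* = complex.Re z. Proof. by case: z. Qed.
Lemma cIm_conj z : complex.Im z^* = - complex.Im z. Proof. by case: z. Qed.
Lemma cReD (z w : C) : complex.Re (z + w) = complex.Re z + complex.Re w.
Proof. by case: z; case: w. Qed.
Lemma cImD (z w : C) : complex.Im (z + w) = complex.Im z + complex.Im w.
Proof. by case: z; case: w. Qed.
Lemma cReN z : complex.Re (- z) = - complex.Re z. Proof. by case: z. Qed.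
Lemma cImN z : complex.Im (- z) = - complex.Im z. Proof. by case: z. Qed.
Lemma cReM (z w : C) : complex.Re (z * w) =
  complex.Re z * complex.Re w - complex.Im z * complex.Im w.
Proof. by case: z; case: w. Qed.
Lemma cImM (z w : C) : complex.Im (z * w) =
  complex.Re z * complex.Im w + complex.Im z * complex.Re w.
Proof. by case: z; case: w. Qed.

Lemma Re_toC x : complex.Re (toC x) = x. Proof. by []. Qed.
Lemma Re_toCM x z : complex.Re (toC x * z) = x * complex.Re z.
Proof. by case: z => a b; rewrite /toC /= mul0r subr0. Qed.

Lemma rnorm_pair (V W : normedModType C) (p : V * W) :
  rnorm p = Num.max (rnorm p.1) (rnorm p.2).
Proof.
apply: toC_inj; rewrite -norm_toC prod_normE !norm_toC !maxEle toC_le.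
by case: ifP.
Qed.

Lemma bidiscP (l : C * C) : bidisc l <-> rnorm l.1 < 1 /\ rnorm l.2 < 1.
Proof. by rewrite /bidisc /unit_ball /= rnorm_pair gt_max; split => [/andP|[-> ->]]. Qed.

End Modulus.

(** * Inner products and orthogonal decompositions *)

Section Hilbert.
Context {R : realType} {H : completeNormedModType (Cplx R)}.
Local Notation C := (Cplx R).
Variable ip : {dot H for Num.conj}.
Implicit Types (x y z : H) (a : C).

Lemma ipDl x y z : ip (x + y) z = ip x z + ip y z. Proof. exact: linearDl. Qed.

Lemma ipDr x y z : ip x (y + z) = ip x y + ip x z. Proof. exact: linearDr. Qed.

Lemma ipZl a x y : ip (a *: x) y = a * ip x y. Proof. exact: linearZl_LR. Qed.

Lemma ipZr a x y : ip x (a *: y) = a^* * ip x y. Proof. exact: linearZr_LR. Qed.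

Lemma ipNl x y : ip (- x) y = - ip x y. Proof. by rewrite -scaleN1r ipZl mulN1r. Qed.

Lemma ipNr x y : ip x (- y) = - ip x y.
Proof. by rewrite -scaleN1r ipZr rmorphN rmorph1 mulN1r. Qed.

Lemma ipC x y : ip x y = (ip y x)^*. Proof. by rewrite hermC /= mul1r. Qed.

Lemma Re_ipC x y : complex.Re (ip x y) = complex.Re (ip y x).
Proof. by rewrite ipC; exact: cRe_conj. Qed.

Hypothesis norm_ip : forall x : H, ip x x = `|x| ^+ 2.

Lemma ip_diag x : ip x x = toC (rnorm x ^+ 2).
Proof. by rewrite norm_ip norm_toC toCX. Qed.

Lemma rnorm_sqrB x y :
  rnorm (x - y) ^+ 2 = rnorm x ^+ 2 + rnorm y ^+ 2 - 2 * complex.Re (ip x y).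
Proof.
apply: toC_inj; rewrite -ip_diag toCB toCD -!ip_diag !ipDl !ipDr !ipNl !ipNr.
rewrite toCM toC_conj -[(ip x y)^*]ipC (_ : toC 2 = 2); last exact: rmorph_nat.
by field.
Qed.

Lemma cauchy_schwarz x y : rnorm (ip x y) <= rnorm x * rnorm y.
Proof.
have [/eqP N0|N0] := boolP (rnorm y == 0).
  by rewrite (rnorm_eq0 N0) linear0r !rnorm0 mulr0.
have Npos : 0 < rnorm y by rewrite lt_def N0 rnorm_ge0.
pose a := toC (rnorm y ^- 2) * ip x y.
have := sqr_ge0 (rnorm (x - a *: y)); rewrite rnorm_sqrB ipZr.
have -> : a^* * ip x y = toC (rnorm y ^- 2 * rnorm (ip x y) ^+ 2).
  by rewrite /a rmorphM /= conj_toC toCM -conjM_rnorm; ring.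
rewrite [complex.Re _]/= rnormZ /a rnormM rnorm_toC ger0_norm; last first.
  by rewrite invr_ge0 sqr_ge0.
have -> : (rnorm y ^- 2 * rnorm (ip x y) * rnorm y) ^+ 2 =
   rnorm y ^- 2 * rnorm (ip x y) ^+ 2 by field.
rewrite -addrA (_ : _ - _ = - (rnorm y ^- 2 * rnorm (ip x y) ^+ 2)); last by ring.
rewrite subr_ge0 mulrC ler_pdivrMr ?exprn_gt0 // -exprMn.
by rewrite ler_pXn2r ?nnegrE ?mulr_ge0 ?rnorm_ge0.
Qed.

End Hilbert.

Section Decomposition.
Context {R : realType} {H : completeNormedModType (Cplx R)}.
Local Notation C := (Cplx R).
Context {ip : {dot H for Num.conj}} {M1 M2 : set H} {p1 p2 : H -> H}.
Hypothesis hd : hilbert_decomposition ip M1 M2 p1 p2.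
Implicit Types (x y z : H) (a : C).

Let nip := norm_ip hd.

Lemma orthogonal21 x y : M2 x -> M1 y -> ip x y = 0.
Proof. by move=> hx hy; rewrite ipC (orthogonal12 hd) // rmorph0. Qed.

Lemma decomposition_unique x y1 y2 : M1 y1 -> M2 y2 -> x = y1 + y2 ->
  p1 x = y1 /\ p2 x = y2.
Proof.
move=> h1 h2 xE; have [_ M10 lin1] := closed1 hd; have [_ M20 lin2] := closed2 hd.
have d1 : M1 (p1 x - y1).
  by rewrite addrC -scaleN1r; apply: lin1 => //; exact: proj1_in hd x.
have d2 : M2 (p2 x - y2).
  by rewrite addrC -scaleN1r; apply: lin2 => //; exact: proj2_in hd x.
have d0 : (p1 x - y1) + (p2 x - y2) = 0.
  by rewrite addrACA -(proj_sum hd x) -opprD -xE subrr.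
have E : p1 x - y1 = - (p2 x - y2) by apply/eqP; rewrite -addr_eq0 d0.
have z1 : p1 x - y1 = 0.
  apply: rnorm_eq0; apply/eqP; rewrite -sqrf_eq0; apply/eqP; apply: toC_inj.
  by rewrite -(ip_diag nip) {2}E ipNr (orthogonal12 hd) // oppr0.
split; apply/eqP; rewrite -subr_eq0; first by rewrite z1.
by rewrite -oppr_eq0 -E z1.
Qed.

Lemma proj1D x y : p1 (x + y) = p1 x + p1 y.
Proof.
have [_ _ lin1] := closed1 hd; have [_ _ lin2] := closed2 hd.
have [] // := @decomposition_unique (x + y) (p1 x + p1 y) (p2 x + p2 y).
- by rewrite -[p1 x]scale1r; apply: lin1; exact: proj1_in hd _.
- by rewrite -[p2 x]scale1r; apply: lin2; exact: proj2_in hd _.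
by rewrite {1}(proj_sum hd x) {1}(proj_sum hd y) addrACA.
Qed.

Lemma proj1Z a x : p1 (a *: x) = a *: p1 x.
Proof.
have [_ M10 lin1] := closed1 hd; have [_ M20 lin2] := closed2 hd.
have [] // := @decomposition_unique (a *: x) (a *: p1 x) (a *: p2 x).
- by rewrite -[a *: p1 x]addr0; apply: lin1 => //; exact: proj1_in hd _.
- by rewrite -[a *: p2 x]addr0; apply: lin2 => //; exact: proj2_in hd _.
by rewrite {1}(proj_sum hd x) scalerDr.
Qed.

Lemma proj1B x y : p1 (x - y) = p1 x - p1 y.
Proof. by rewrite -scaleN1r proj1D proj1Z scaleN1r. Qed.

Lemma ip_proj x y : ip x y = ip (p1 x) (p1 y) + ip (p2 x) (p2 y).
Proof.
rewrite {1}(proj_sum hd x) {1}(proj_sum hd y) !ipDl !ipDr.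
rewrite (orthogonal12 hd (proj1_in hd x) (proj2_in hd y)).
by rewrite (orthogonal21 (proj2_in hd x) (proj1_in hd y)) add0r addr0.
Qed.

Lemma ip_proj1 x y : ip x (p1 y) = ip (p1 x) (p1 y).
Proof.
rewrite {1}(proj_sum hd x) ipDl (orthogonal21 (proj2_in hd x) (proj1_in hd y)).
by rewrite addr0.
Qed.

Lemma pythagoras x : rnorm x ^+ 2 = rnorm (p1 x) ^+ 2 + rnorm (p2 x) ^+ 2.
Proof. by apply: toC_inj; rewrite toCD -!(ip_diag nip) ip_proj. Qed.

Lemma rnorm_proj1_le x : rnorm (p1 x) <= rnorm x.
Proof.
by rewrite -(@ler_pXn2r _ 2) ?nnegrE ?rnorm_ge0 // (pythagoras x) lerDl sqr_ge0.
Qed.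

End Decomposition.

Section DecompositionSwap.
Context {R : realType} {H : completeNormedModType (Cplx R)}.
Context {ip : {dot H for Num.conj}} {M1 M2 : set H} {p1 p2 : H -> H}.

Lemma hilbert_decomposition_swap :
  hilbert_decomposition ip M1 M2 p1 p2 -> hilbert_decomposition ip M2 M1 p2 p1.
Proof.
move=> hd; case: (hd) => *; split => //.
- by move=> x y hx hy; exact: (orthogonal21 hd).
- by move=> x; rewrite addrC.
Qed.
End DecompositionSwap.

(** * Limits at boundary points *)

Section Bridges.
Context {R : realType}.
Local Notation C := (Cplx R).

Lemma cvg_at_right_rnorm {V : normedModType C} (f : R -> V) (v : V) :
  f t @[t --> 0^'+] --> v <->
  forall e : R, 0 < e -> exists2 d : R, 0 < d &
    forall t : R, 0 < t -> t < d -> rnorm (f t - v) < e.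
Proof.
rewrite cvg_rnorm; split => h e /h.
  rewrite /at_right /= => /nbhs_ballP [d /= d0 dP]; exists d => // t t0 td.
  by apply: dP => //; rewrite -ball_normE /= sub0r normrN gtr0_norm.
move=> [d d0 dP]; apply/nbhs_ballP; exists d => //= t.
by rewrite -ball_normE /= sub0r normrN => td t0; apply: dP => //; rewrite -(gtr0_norm t0).
Qed.

Lemma bounded_cluster (z : nat -> C) (B : R) : (forall n, rnorm (z n) <= B) ->
  exists w, forall e : R, 0 < e -> forall N, exists2 n, (N <= n)%N & rnorm (z n - w) < e.
Proof.
move=> zB.
have bnd (f : nat -> R) : (forall n, `|f n| <= B) -> bounded_fun f.
  move=> fB; exists B; split; first exact: num_real.
  by move=> M BM n _; exact: le_trans (fB n) (ltW BM).
have [f fi /cvg_ex [/= a fa]] := bolzano_weierstrass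
  (bnd (fun n => complex.Re (z n)) (fun n => le_trans (Re_le_rnorm _) (zB n))).
have [g gi /cvg_ex [/= b gb]] := bolzano_weierstrass
  (bnd (fun n => complex.Im (z (f n))) (fun n => le_trans (Im_le_rnorm _) (zB _))).
have ge_incr (h : nat -> nat) : increasing_seq h -> forall n, (n <= h n)%N.
  move=> hi; elim=> [|n IH] //; apply: leq_ltn_trans IH _.
  by have := leW_mono hi; move=> /(_ n n.+1); rewrite ltEnat /= => ->.
exists (Complex a b) => e e0 N.
have e2 : 0 < e / 2 by lra.
move/cvgrPdist_lt : fa => /(_ _ e2) [N1 _ H1].
move/cvgrPdist_lt : gb => /(_ _ e2) [N2 _ H2].
pose n := maxn N (maxn N1 N2).
have nN : (N <= n)%N by exact: leq_maxl.
have nN1 : (N1 <= n)%N by rewrite (leq_trans (leq_maxl N1 N2)) ?leq_maxr.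
have nN2 : (N2 <= n)%N by rewrite (leq_trans (leq_maxr N1 N2)) ?leq_maxr.
exists (f (g n)).
  by apply: leq_trans nN (leq_trans (ge_incr g gi n) (ge_incr f fi _)).
apply: le_lt_trans (rnorm_le_ReIm _) _.
rewrite cReD cReN cImD cImN /= (distrC (complex.Re _)) (distrC (complex.Im _)).
have h1 := H1 _ (leq_trans nN1 (ge_incr g gi n)); have h2 := H2 _ nN2.
by rewrite /= in h1 h2; lra.
Qed.

Section Boundary.
Context {V : normedModType C}.
Implicit Types (f : V -> C) (t : V) (w : C).

Lemma radius_dist t (s : R) : unit_sphere t -> 0 < s -> s < 1 ->
  [/\ rnorm (toC (1 - s) *: t) = 1 - s, rnorm (t - toC (1 - s) *: t) = s
    & unit_ball (toC (1 - s) *: t)].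
Proof.
move=> t1 s0 s1.
have E : rnorm (toC (1 - s) *: t) = 1 - s.
  by rewrite rnormZ t1 mulr1 rnorm_toC ger0_norm // subr_ge0 ltW.
split => //; last by rewrite /unit_ball /= E ltrBlDr ltrDl.
rewrite -{1}[t]scale1r -scalerBl -toC1 -toCB rnormZ t1 mulr1 rnorm_toC.
by rewrite opprB addrC subrK gtr0_norm.
Qed.

(** The full approach regions with c >= 1 contain the radius, hence approach t; so they
    decide the limit. *)
Lemma nt_limitP f t w : unit_sphere t ->
  nt_limit f t w <->
  forall c e : R, 0 < c -> 0 < e -> exists2 d : R, 0 < d &
    forall x, unit_ball x -> rnorm (t - x) <= c * (1 - rnorm x) ->
      rnorm (x - t) < d -> rnorm (f x - w) < e.
Proof.
move=> t1; split.
  move=> H c e c0 e0; pose c' := Num.max c 1.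
  pose S := [set x | @unit_ball R V x /\ rnorm (t - x) <= c' * (1 - rnorm x)].
  have c'1 : 1 <= c' by rewrite le_max lexx orbT.
  have St : nt_approaches S t.
    split; first by move=> x [].
    - move=> P /nbhs_rnorm [d d0 dP].
      pose s := Num.min (d / 2) (1 / 2).
      have s0 : 0 < s by rewrite lt_min; apply/andP; split; lra.
      have s1 : s < 1 by rewrite gt_min; apply/orP; right; lra.
      have sd : s < d by rewrite gt_min; apply/orP; left; lra.
      have [a b cc] := radius_dist t1 s0 s1.
      exists (toC (1 - s) *: t); split; last by apply: dP; rewrite rnorm_subC b.
      split => //; rewrite a b; have -> : 1 - (1 - s) = s by lra.
      by rewrite ler_peMl // ltW.
    by exists c'; [exact: lt_le_trans ltr01 c'1|move=> x []].
  have /cvg_rnorm /(_ e e0) := H S St.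
  rewrite /within /= => /nbhs_rnorm [d d0 dP]; exists d => // x xb xc xd.
  apply: dP => //; split => //; apply: le_trans xc _.
  by rewrite ler_wpM2r ?le_max ?lexx // subr_ge0; exact: ltW.
move=> H S [Sb _ [c c0 Sc]]; apply/cvg_rnorm => e e0.
have [d d0 dP] := H c e c0 e0.
apply/nbhs_rnorm; exists d => // x xd Sx.
by apply: dP => //; [exact: Sb|exact: Sc].
Qed.

Lemma nt_limit_radius f t w : unit_sphere t -> nt_limit f t w ->
  forall e : R, 0 < e -> exists2 d : R, 0 < d &
    forall s : R, 0 < s -> s < d -> s < 1 -> rnorm (f (toC (1 - s) *: t) - w) < e.
Proof.
move=> t1 /(nt_limitP _ _ t1) H e e0; have [d d0 dP] := H 1 e ltr01 e0.
exists d => // s s0 sd s1; have [a b c] := radius_dist t1 s0 s1.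
apply: dP => //; last by rewrite rnorm_subC b.
by rewrite a b; lra.
Qed.

Lemma rnorm_small0 (z : C) : (forall e : R, 0 < e -> rnorm z < e) -> z = 0.
Proof.
move=> h; apply: rnorm_eq0; apply/eqP; rewrite eq_le rnorm_ge0 andbT leNgt.
by apply/negP => /h; rewrite ltxx.
Qed.

Lemma nt_limit_unique f t w w' :
  unit_sphere t -> nt_limit f t w -> nt_limit f t w' -> w = w'.
Proof.
move=> t1 /(nt_limit_radius t1) h /(nt_limit_radius t1) h'.
apply/eqP; rewrite -subr_eq0; apply/eqP; apply: rnorm_small0 => e e0.
have e2 : 0 < e / 2 by lra.
have [d d0 dP] := h _ e2; have [d' d'0 d'P] := h' _ e2.
pose s := Num.min (Num.min d d') 1 / 2.
have s0 : 0 < s by rewrite divr_gt0 // !lt_min d0 d'0 ltr01.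
have sm : s < Num.min (Num.min d d') 1 by rewrite /s in s0 *; lra.
move: sm; rewrite !lt_min => /andP[/andP[sd sd'] s1].
have := dP _ s0 sd s1; have := d'P _ s0 sd' s1.
have := rnorm_tri (f (toC (1 - s) *: t)) w w'.
by rewrite (rnorm_subC w (f _)); lra.
Qed.

Lemma julia_liminf_le f t (b : R) :
  (julia_liminf f t <= b%:E)%E <->
  forall e d : R, 0 < e -> 0 < d ->
    exists x, [/\ unit_ball x, rnorm (x - t) < d & julia_quotient f x < b + e].
Proof.
rewrite /julia_liminf limf_einfE; split.
  move=> H e d e0 d0.
  pose W := [set x : V | unit_ball x /\ rnorm (x - t) < d].
  have FW : within (@unit_ball R V) (nbhs t) W.
    by apply/nbhs_rnorm; exists d => // w wd wb.
  have : (ereal_inf [set (julia_quotient f x)%:E | x in W] < (b + e)%:E)%E.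
    apply: (@le_lt_trans _ _ b%:E); last by rewrite lte_fin ltrDl.
    by apply: le_trans H; apply: ereal_sup_ubound; exists W.
  by move=> /ereal_inf_lt [_ [x [xb xd] <-]]; rewrite lte_fin => h; exists x.
move=> H; apply: ge_ereal_sup => _ [W /nbhs_rnorm [d d0 dW] <-].
apply/lee_addgt0Pr => e e0; have [x [xb xd /ltW xq]] := H e d e0 d0.
apply: ge_ereal_inf; exists (julia_quotient f x)%:E; last by rewrite -EFinD lee_fin.
by exists x => //; exact: dW.
Qed.

Lemma julia_liminf_ge f t (b : R) :
  (forall e : R, 0 < e -> exists2 d : R, 0 < d & forall x, unit_ball x ->
    rnorm (x - t) < d -> b - e <= julia_quotient f x) ->
  (b%:E <= julia_liminf f t)%E.
Proof.
rewrite /julia_liminf limf_einfE => H.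
apply/lee_subgt0Pr => e e0; have [d d0 dP] := H e e0.
apply: le_ereal_sup_tmp.
exists (ereal_inf [set (julia_quotient f x)%:E |
  x in [set x : V | unit_ball x /\ rnorm (x - t) < d]]).
  exists [set x : V | unit_ball x /\ rnorm (x - t) < d] => //.
  by apply/nbhs_rnorm; exists d => // w wd wb; split.
by apply: le_ereal_inf_tmp => _ [x [xb xd] <-]; rewrite -EFinB lee_fin; exact: dP.
Qed.

Lemma julia_liminf_gt f t (b e : R) : (b%:E <= julia_liminf f t)%E -> 0 < e ->
  exists2 d : R, 0 < d & forall x, unit_ball x ->
    rnorm (x - t) < d -> b - e < julia_quotient f x.
Proof.
move=> lb e0; apply: contrapT => nex.
have : (julia_liminf f t <= (b - e)%:E)%E.
  apply/julia_liminf_le => e' d e'0 d0; apply: contrapT => nex'; apply: nex.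
  exists d => // x xb xd; rewrite ltNge; apply/negP => q; apply: nex'.
  by exists x; split => //; apply: le_lt_trans q _; rewrite ltrDl.
by move=> /(le_trans lb); rewrite lee_fin; lra.
Qed.

Lemma B_pointP f t :
  B_point f t <-> unit_sphere t /\ exists B : R, forall d : R, 0 < d ->
    exists x, [/\ unit_ball x, rnorm (x - t) < d & julia_quotient f x <= B].
Proof.
split=> [[t1 lt]|[t1 [B H]]]; split => //.
  have [B /julia_liminf_le HB] : exists B, (julia_liminf f t <= B%:E)%E.
    case: (julia_liminf f t) lt => [r _| |_] //; last by exists 0; exact: leNye.
    by exists r.
  exists (B + 1) => d d0; have [x [h1 h2 h3]] := HB 1 d ltr01 d0.
  by exists x; split => //; exact: ltW.
apply: (@le_lt_trans _ _ B%:E); last exact: ltry.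
apply/julia_liminf_le => e d e0 d0; have [x [h1 h2 h3]] := H d d0.
by exists x; split => //; apply: le_lt_trans h3 _; rewrite ltrDl.
Qed.

End Boundary.

Lemma differentiable_eps (V W : normedModType C) (f : V -> W) (x : V) :
  differentiable f x -> forall e : R, 0 < e -> exists2 d : R, 0 < d & forall h,
    rnorm h < d -> rnorm (f (h + x) - (f x + 'd f x h)) <= e * rnorm h.
Proof.
move=> /diff_locallyP [_ /eqaddoP df] e e0.
have e0' : 0 < toC e :> C by rewrite -toC0 toC_lt.
have /nbhs_rnorm [d d0 dP] := df _ e0'; exists d => // k kd.
have kd' : rnorm (k - 0) < d by rewrite subr0.
by rewrite -toC_le toCM -!norm_toC; exact: dP k kd'.
Qed.

Lemma differentiable_continuous_eps (V W : normedModType C) (f : V -> W) (x : V) :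
  differentiable f x -> forall e : R, 0 < e -> exists2 d : R, 0 < d & forall y,
    rnorm (y - x) < d -> rnorm (f y - f x) < e.
Proof.
move=> /differentiable_continuous fx e e0.
have /nbhs_rnorm [d d0 dP] : nbhs x [set y | rnorm (f y - f x) < e].
  by have /cvg_rnorm := fx; move=> /(_ e e0).
by exists d.
Qed.

End Bridges.

(** * Real arithmetic on moduli *)

(** Instances at C, C * C and H.  They make the norms of all later statements be built
    along the same structures, so that equal moduli coincide syntactically. *)
Section Specialised.
Context {R : realType} {H : completeNormedModType (Cplx R)}.
Local Notation C := (Cplx R).
Implicit Types (z w : C) (l m : C * C) (x y : H).

Lemma modD z w : rnorm (z + w) <= rnorm z + rnorm w. Proof. exact: rnormD. Qed.

Lemma modB z w : rnorm (z - w) <= rnorm z + rnorm w. Proof. exact: rnormB. Qed.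

Lemma mod_subC z w : rnorm (z - w) = rnorm (w - z). Proof. exact: rnorm_subC. Qed.

Lemma mod_lerB z w : rnorm z - rnorm w <= rnorm (z - w). Proof. exact: rnorm_lerB. Qed.

Lemma mod_tri w z1 z2 : rnorm (z1 - z2) <= rnorm (z1 - w) + rnorm (w - z2).
Proof. exact: rnorm_tri. Qed.

Lemma modN z : rnorm (- z) = rnorm z. Proof. exact: rnormN. Qed.

Lemma mod0 : rnorm (0 : C) = 0. Proof. exact: rnorm0. Qed.

Lemma mod_eq z w : rnorm (z - w) = 0 -> z = w.
Proof. by move=> h; apply/eqP; rewrite -subr_eq0; apply/eqP; apply: rnorm_eq0. Qed.

Lemma pair_subC l m : rnorm (l - m) = rnorm (m - l). Proof. exact: rnorm_subC. Qed.

Lemma pair_lerB l m : rnorm l - rnorm m <= rnorm (l - m). Proof. exact: rnorm_lerB. Qed.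

Lemma pair_fst l : rnorm l.1 <= rnorm l.
Proof. by rewrite rnorm_pair le_max lexx. Qed.

Lemma pair_snd l : rnorm l.2 <= rnorm l.
Proof. by rewrite rnorm_pair le_max lexx orbT. Qed.

Lemma pair_fstB l m : rnorm (l.1 - m.1) <= rnorm (l - m).
Proof. exact: pair_fst (l - m). Qed.

Lemma pair_sndB l m : rnorm (l.2 - m.2) <= rnorm (l - m).
Proof. exact: pair_snd (l - m). Qed.

Lemma pair_max l : rnorm l = Num.max (rnorm l.1) (rnorm l.2).
Proof. exact: rnorm_pair. Qed.

Lemma pair_maxB l m : rnorm (l - m) = Num.max (rnorm (l.1 - m.1)) (rnorm (l.2 - m.2)).
Proof. exact: pair_max (l - m). Qed.

Lemma vecD x y : rnorm (x + y) <= rnorm x + rnorm y. Proof. exact: rnormD. Qed.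

Lemma vec_subC x y : rnorm (x - y) = rnorm (y - x). Proof. exact: rnorm_subC. Qed.

Lemma vec_lerB x y : rnorm x - rnorm y <= rnorm (x - y). Proof. exact: rnorm_lerB. Qed.

Lemma vec_tri y x1 x2 : rnorm (x1 - x2) <= rnorm (x1 - y) + rnorm (y - x2).
Proof. exact: rnorm_tri. Qed.

End Specialised.

(** Moduli and real parts are replaced by variables before the arithmetic tactics are
    called, since these compare atoms up to conversion, which is costly for norms of
    product spaces. *)
Ltac real_atoms := repeat match goal with
  | h : context [@rnorm ?R ?V ?x] |- _ =>
    let n := fresh "n" in set (n := @rnorm R V x) in *; clearbody n
  | |- context [@rnorm ?R ?V ?x] =>
    let n := fresh "n" in set (n := @rnorm R V x) in *; clearbody n
  | h : context [@complex.Re ?R ?x] |- _ =>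
    let n := fresh "n" in set (n := @complex.Re R x) in *; clearbody n
  | |- context [@complex.Re ?R ?x] =>
    let n := fresh "n" in set (n := @complex.Re R x) in *; clearbody n
  end.

(** The same difference can be typed through different algebraic structures. *)
Ltac unify_differences := repeat match goal with
  | h : context [@rnorm _ _ (@Algebra.add ?S ?a (@Algebra.opp ?T ?b))] |- _ =>
    let s := constr:((a - b)%R) in
    tryif constr_eq s (@Algebra.add S a (@Algebra.opp T b)) then fail
    else change (@Algebra.add S a (@Algebra.opp T b)) with s in h
  | |- context [@rnorm _ _ (@Algebra.add ?S ?a (@Algebra.opp ?T ?b))] =>
    let s := constr:((a - b)%R) in
    tryif constr_eq s (@Algebra.add S a (@Algebra.opp T b)) then fail
    else change (@Algebra.add S a (@Algebra.opp T b)) with s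
  end.

Ltac rlra := intros; unify_differences; real_atoms; lra.

Ltac rnra := intros; unify_differences; real_atoms; nra.

Section RealHelpers.
Context {R : realFieldType}.
Implicit Types (x y e K : R).

(** The form in which limits are taken below: all errors are collected in one multiple
    of e. *)
Lemma ler_eps x y K : 0 <= K -> (forall e : R, 0 < e -> x <= y + K * e) -> x <= y.
Proof.
move=> K0 h; apply/ler_addgt0Pr => e e0.
have K1 : 0 < K + 1 by lra.
apply: le_trans (h (e / (K + 1)) _) _; first exact: divr_gt0.
rewrite lerD2l mulrCA -[leRHS]mulr1; apply: ler_wpM2l; first exact: ltW.
by rewrite ler_pdivrMr // mul1r lerDl.
Qed.

Lemma sqr_sum_le (p q g h s r : R) : 0 <= p -> 0 <= q -> 0 <= g -> 0 <= h ->
  0 <= s -> 0 <= r -> p ^+ 2 <= g * s -> q ^+ 2 <= h * r -> (p + q) ^+ 2 <= (g + h) * (s + r).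
Proof.
move=> p0 q0 g0 h0 s0 r0 ps qr.
have pq : 2 * (p * q) <= g * r + h * s.
  rewrite -(@ler_pXn2r _ 2) ?nnegrE ?addr_ge0 ?mulr_ge0 //.
  have := ler_pM (sqr_ge0 p) (sqr_ge0 q) ps qr; have := sqr_ge0 (g * r - h * s); lra.
lra.
Qed.

Lemma ler_of_sqr_le x y : 0 <= y -> x ^+ 2 <= y * x -> x <= y.
Proof. by move=> y0 h; rewrite leNgt; apply/negP => yx; nra. Qed.

Lemma sqr_sub_le x y e : 0 <= x -> x <= 1 -> 0 <= y -> y <= 1 -> 0 <= e ->
  x - y <= e -> x ^+ 2 - y ^+ 2 <= 2 * e.
Proof.
move=> x0 x1 y0 y1 e0 xy; rewrite subr_sqr.
have [le|gt] := lerP (x - y) 0.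
  by apply: (@le_trans _ _ 0); [rewrite mulr_le0_ge0 // addr_ge0|rewrite mulr_ge0].
by rewrite mulrC; apply: ler_pM; lra.
Qed.

Lemma exists_small (P : seq R) : all (fun d => 0 < d) P ->
  exists2 s : R, 0 < s & all (fun d => s < d) P.
Proof.
elim: P => [|d P IH] /=; first by exists 1.
move=> /andP[d0 /IH [s s0 sP]]; exists (Num.min s d / 2).
  by rewrite divr_gt0 // lt_min s0.
have m0 : 0 < Num.min s d by rewrite lt_min s0.
have ms : Num.min s d / 2 < Num.min s d by lra.
rewrite (lt_le_trans ms) ?ge_min ?lexx ?orbT //=.
apply: sub_all sP => y; apply: lt_trans; apply: lt_le_trans ms _.
by rewrite ge_min lexx.
Qed.
End RealHelpers.

(** Cauchy-Schwarz for the two terms of the model kernel, of weights A, A' and c on the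
    diagonal and p, c off it; the excess p^2 - A A' leaves a multiple of (y y')^2. *)
Lemma kernel_two_point {R : rcfType} (x y x' y' A A' c p : R) :
  0 <= x -> 0 <= y -> 0 <= x' -> 0 <= y' -> 0 <= A -> 0 <= A' -> 0 <= c -> 0 <= p ->
  A * A' <= p ^+ 2 ->
  (p * (x * x') + c * (y * y')) ^+ 2 * (A * A') +
    (p ^+ 2 - A * A') * (c ^+ 2 * (y ^+ 2 * y' ^+ 2)) <=
  p ^+ 2 * ((A * x ^+ 2 + c * y ^+ 2) * (A' * x' ^+ 2 + c * y' ^+ 2)).
Proof.
move=> x0 y0 x'0 y'0 A0 A'0 c0 p0.
rewrite -(sqr_sqrtr A0) -(sqr_sqrtr A'0).
move: (Num.sqrt A) (Num.sqrt A') (sqrtr_ge0 A) (sqrtr_ge0 A') => s s' s0 s'0 ss.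
have ssp : s * s' <= p by rewrite -(@ler_pXn2r _ 2) ?nnegrE ?mulr_ge0 // exprMn.
have h0 : 0 <= x * x' * (y * y') by rewrite !mulr_ge0.
have h1 : 2 * (s * s') * (x * x' * (y * y')) <=
    s ^+ 2 * x ^+ 2 * y' ^+ 2 + s' ^+ 2 * x' ^+ 2 * y ^+ 2.
  by have := sqr_ge0 (s * x * y' - s' * x' * y); lra.
have h2 : 2 * (s * s') * (s * s') * (x * x' * (y * y')) <=
    p * (s ^+ 2 * x ^+ 2 * y' ^+ 2 + s' ^+ 2 * x' ^+ 2 * y ^+ 2).
  have g : 0 <= 2 * (s * s') * (x * x' * (y * y')) by rewrite !mulr_ge0.
  by have := ler_wpM2r g ssp; have := ler_wpM2l p0 h1; lra.
have := ler_wpM2l (mulr_ge0 p0 c0) h2; lra.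
Qed.

Section DiscHelpers.
Context {R : realType}.
Local Notation C := (Cplx R).

Lemma rnorm_1sub_conj (w z : C) : rnorm w = 1 -> rnorm (1 - w * z^*) = rnorm (z - w).
Proof.
move=> w1; have -> : 1 - w * z^* = w * (w - z)^*.
  by rewrite rmorphB mulrBr conjM_rnorm w1 expr1n.
by rewrite rnormM w1 mul1r rnorm_conj mod_subC.
Qed.

Lemma torus_sphere (tau : C * C) : circle tau.1 -> circle tau.2 -> unit_sphere tau.
Proof.
by rewrite /circle /unit_sphere /= => h1 h2; rewrite rnorm_pair h1 h2 maxxx.
Qed.

End DiscHelpers.

(** * Radial limits in Hilbert space *)

Section RadialLimit.
Context {R : realType} {H : completeNormedModType (Cplx R)}.
Local Notation C := (Cplx R).

Lemma complete_cvg {T : Type} (F : set_system T) {FF : ProperFilter F} (x : T -> H) :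
  (forall e : R, 0 < e -> exists a : H, \forall t \near F, rnorm (x t - a) < e) ->
  exists y : H, x @ F --> y.
Proof.
move=> h; apply/cvg_ex; apply: cauchy_cvg; apply: cauchy_exP => e e0.
have re0 : 0 < complex.Re e by rewrite -toC_lt toC_re // ltW.
have [a aP] := h _ re0; exists a; apply: filterS aP => t /= ta.
by rewrite -ball_normE /= distrC norm_toC -(toC_re (ltW e0)) toC_lt.
Qed.

Variables (ip : {dot H for Num.conj}).
Hypothesis nip : forall x : H, ip x x = `|x| ^+ 2.

Variables (x : R -> H) (f : R -> C) (w : C) (d0 K : R).
Hypotheses (d00 : 0 < d0) (K0 : 0 < K) (w1 : rnorm w = 1).
Hypothesis f1 : forall t, 0 < t -> t < d0 -> rnorm (f t) <= 1.
Hypothesis xK : forall t, 0 < t -> t < d0 -> rnorm (x t) <= K.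
Hypothesis fw : forall t, 0 < t -> t < d0 -> rnorm (f t - w) <= K * t.
Hypothesis ker : forall s t, 0 < s -> s < d0 -> 0 < t -> t < d0 ->
  rnorm (1 - f t * (f s)^* - toC (t + s) * ip (x t) (x s)) <= K * t * s.

Let lower_bounds := [set y : R | exists2 d, 0 < d &
  forall t, 0 < t -> t < d -> y <= rnorm (x t)].

Let L := sup lower_bounds.

Let lb_sup : has_sup lower_bounds.
Proof.
split; first by exists 0; exists 1 => // t _ _; exact: rnorm_ge0.
exists K => y [d dp dP].
have : all (fun r => 0 < r) [:: d; d0] by rewrite /= dp d00.
move=> /exists_small [s s0 /= /andP[sd /andP[sd0 _]]].
exact: le_trans (dP s s0 sd) (xK s0 sd0).
Qed.

Let L_ge0 : 0 <= L.
Proof. by apply: ub_le_sup; [exact: lb_sup.2|exists 1 => // t _ _; exact: rnorm_ge0]. Qed.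

Let L_lower (e : R) : 0 < e -> exists2 d, 0 < d &
  forall t, 0 < t -> t < d -> L - e < rnorm (x t).
Proof.
move=> e0; have [y [d dp dP] ye] := sup_adherent e0 lb_sup.
by exists d => // t t0 td; apply: lt_le_trans ye (dP t t0 td).
Qed.

Let L_upper (e d : R) : 0 < e -> 0 < d ->
  exists s, [/\ 0 < s, s < d & rnorm (x s) < L + e].
Proof.
move=> e0 dp; apply: contrapT => nex.
suff : L + e <= L by lra.
apply: ub_le_sup; first exact: lb_sup.2.
exists d => // t t0 td; rewrite leNgt; apply/negP => h; apply: nex.
by exists t.
Qed.

Let ker_le s t : 0 < s -> s < d0 -> 0 < t -> t < d0 ->
  rnorm (1 - f t * (f s)^*) <= (t + s) * (rnorm (x t) * rnorm (x s)) + K * t * s.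
Proof.
move=> s0 sd t0 td.
have -> : 1 - f t * (f s)^* = toC (t + s) * ip (x t) (x s) +
   (1 - f t * (f s)^* - toC (t + s) * ip (x t) (x s)) by ring.
apply: le_trans (modD _ _) _; apply: lerD; last exact: ker.
rewrite rnormM rnorm_toC gtr0_norm ?addr_gt0 //.
by apply: ler_wpM2l; [rewrite ltW // addr_gt0|exact: cauchy_schwarz].
Qed.

(* Let s tend to 0 in the kernel estimate, along points where the norm is
   close to its lower limit. *)
Let boundary_distance t : 0 < t -> t < d0 -> rnorm (f t - w) <= t * (rnorm (x t) * L).
Proof.
move=> t0 td.
have L0 : 0 <= L := L_ge0.
have X0 : 0 <= rnorm (x t) := rnorm_ge0 _.
have XK := xK t0 td.
apply: (@ler_eps _ _ _ (K * (L + 1) + K * t + K + t * rnorm (x t))).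
  by rewrite !addr_ge0 ?mulr_ge0 ?addr_ge0 // ltW.
move=> e e0.
have [e' [e'0 e'e e'1]] : exists e', [/\ 0 < e', e' <= e & e' <= 1].
  by exists (Num.min e 1); rewrite lt_min e0 ltr01 !ge_min !lexx orbT.
have dm : 0 < Num.min d0 e' by rewrite lt_min d00.
have [s [s0]] := L_upper e'0 dm; rewrite lt_min => /andP[sd se'] sL.
have -> : rnorm (f t - w) = rnorm (1 - f t * w^*).
  by rewrite -(rnorm_1sub_conj _ w1) -rnorm_conj rmorphB rmorph1 rmorphM /= conjCK mulrC.
have -> : 1 - f t * w^* = (1 - f t * (f s)^*) + f t * (f s - w)^* by rewrite rmorphB; ring.
apply: le_trans (modD _ _) _; rewrite rnormM rnorm_conj.
have P : rnorm (f t) * rnorm (f s - w) <= K * s.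
  by apply: le_trans (fw s0 sd); rewrite ler_piMl ?rnorm_ge0 ?f1.
have Q := ker_le s0 sd t0 td.
have S1 : (t + s) * (rnorm (x t) * rnorm (x s)) <= (t + s) * (rnorm (x t) * (L + e')).
  by apply: ler_wpM2l; [rlra|apply: ler_wpM2l => //; exact: ltW].
have S2 : s * (rnorm (x t) * (L + e')) <= e * (K * (L + 1)).
  apply: ler_pM; [rlra| |rlra|]; first by rewrite mulr_ge0 // addr_ge0 // ltW.
  by apply: ler_pM => //; rlra.
have S3 : t * (rnorm (x t) * e') <= t * (rnorm (x t) * e).
  by apply: ler_wpM2l; [rlra|apply: ler_wpM2l].
have S4 : K * s <= K * e by apply: ler_wpM2l; rlra.
have S5 : K * t * s <= K * t * e by apply: ler_wpM2l; [rewrite mulr_ge0 // ltW|rlra].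
rlra.
Qed.

Let diag t : 0 < t -> t < d0 ->
  `|1 - rnorm (f t) ^+ 2 - 2 * t * rnorm (x t) ^+ 2| <= K * t ^+ 2.
Proof.
move=> t0 td; have := ker t0 td t0 td.
rewrite conjM_rnorm (ip_diag nip) -toC1 -!toCB -toCM -toCB rnorm_toC.
by rewrite -mulrA -expr2 (_ : (t + t) * _ = 2 * t * rnorm (x t) ^+ 2) //; ring.
Qed.

Let defect t : 0 < t -> t < d0 ->
  t * rnorm (x t) ^+ 2 - K * t ^+ 2 / 2 <= 1 - rnorm (f t).
Proof.
move=> t0 td; have := diag t0 td; have := f1 t0 td; have := rnorm_ge0 (f t).
rewrite ler_norml => F0 F1 /andP[D1 D2].
have : rnorm (f t) * (1 - rnorm (f t)) <= 1 - rnorm (f t) by rewrite ler_piMl //; rlra.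
rlra.
Qed.

Let norm_upper t : 0 < t -> t < d0 ->
  rnorm (x t) ^+ 2 <= rnorm (x t) * L + K * t / 2.
Proof.
move=> t0 td; have D := defect t0 td; have B := boundary_distance t0 td.
have E : 1 - rnorm (f t) <= rnorm (f t - w) by rewrite mod_subC -{1}w1 mod_lerB.
suff : t * rnorm (x t) ^+ 2 <= t * (rnorm (x t) * L + K * t / 2) by rewrite ler_pM2l.
rlra.
Qed.

Let norm_cvg (e : R) : 0 < e -> exists2 d, 0 < d &
  forall t, 0 < t -> t < d -> [/\ t < d0, L - e < rnorm (x t) & rnorm (x t) < L + e].
Proof.
move=> e0; have [d1 d10 d1P] := L_lower e0.
have q0 : 0 < e ^+ 2 / K by rewrite divr_gt0 // exprn_gt0.
have : all (fun r => 0 < r) [:: d0; d1; e ^+ 2 / K] by rewrite /= d00 d10 q0.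
move=> /exists_small [d dp /= /and4P[h1 h2 h3 _]]; exists d => // t t0 td.
have td0 : t < d0 := lt_trans td h1.
split => //; first exact: d1P t0 (lt_trans td h2).
have L0 : 0 <= L := L_ge0.
have N := norm_upper t0 td0; rewrite ltNge; apply/negP => XL.
have KT : K * t < e ^+ 2 by rewrite mulrC -ltr_pdivlMr //; exact: lt_trans td h3.
have : e * e <= rnorm (x t) * (rnorm (x t) - L) by apply: ler_pM; rlra.
have := exprn_gt0 2 e0; rlra.
Qed.

Let expansion (e : R) : 0 < e -> exists2 d, 0 < d & forall t, 0 < t -> t < d ->
  rnorm (1 - w^* * f t - toC (t * L ^+ 2)) <= e * t.
Proof.
move=> e0; have L0 : 0 <= L := L_ge0; pose Q := L ^+ 2 * (2 * L + 1 + K) + 1.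
have Q0 : 0 < Q by rewrite ltr_wpDl // mulr_ge0 ?exprn_ge0 // !addr_ge0 ?mulr_ge0 // ltW.
have q0 : 0 < e ^+ 2 / Q by rewrite divr_gt0 // exprn_gt0.
have K0' : 0 < K := K0.
pose h := Num.min (e ^+ 2 / Q) 1.
have h0 : 0 < h by rewrite lt_min q0 ltr01.
have [d1 d10 d1P] := norm_cvg h0.
have : all (fun r => 0 < r) [:: d1; h] by rewrite /= d10 h0.
move=> /exists_small [d dp /= /and3P[k1 k2 _]]; exists d => // t t0 td.
have [td0 lo up] := d1P t t0 (lt_trans td k1).
have th : t < h := lt_trans td k2.
have hQ : h * Q <= e ^+ 2 by rewrite -ler_pdivlMr // ge_min lexx.
have h1 : h <= 1 by rewrite ge_min lexx orbT.
rewrite -(@ler_pXn2r _ 2) ?nnegrE ?rnorm_ge0 ?mulr_ge0 ?(ltW e0) ?(ltW t0) //.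
have zN : rnorm (1 - w^* * f t) = rnorm (f t - w).
  by rewrite -(rnorm_1sub_conj _ w1) -rnorm_conj rmorphB rmorph1 rmorphM /= conjCK.
have zR : 1 - rnorm (f t) <= complex.Re (1 - w^* * f t).
  rewrite cReD cReN [complex.Re 1]/= lerD2l lerN2.
  apply: le_trans (ler_norm _) (le_trans (Re_le_rnorm _) _).
  by rewrite rnormM rnorm_conj w1 mul1r.
have E : rnorm (1 - w^* * f t - toC (t * L ^+ 2)) ^+ 2 =
   rnorm (f t - w) ^+ 2 - 2 * (t * L ^+ 2) * complex.Re (1 - w^* * f t) + (t * L ^+ 2) ^+ 2.
  rewrite -zN; set z := 1 - _; rewrite !rnorm_sqr !cReD !cImD !cReN !cImN [complex.Re (toC _)]/=.
  by rewrite [complex.Im (toC _)]/=; ring.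
rewrite E; have D := defect t0 td0; have B := boundary_distance t0 td0.
have X0 : 0 <= rnorm (x t) := rnorm_ge0 _.
have B2 : rnorm (f t - w) ^+ 2 <= (t * (rnorm (x t) * L)) ^+ 2.
  by rewrite ler_pXn2r ?nnegrE ?rnorm_ge0 // !mulr_ge0 // ltW.
have L20 : 0 <= L ^+ 2 by exact: sqr_ge0.
have D2 : 2 * (t * L ^+ 2) * (t * rnorm (x t) ^+ 2 - K * t ^+ 2 / 2) <=
   2 * (t * L ^+ 2) * complex.Re (1 - w^* * f t).
  by apply: ler_wpM2l; [rewrite !mulr_ge0 // ltW|exact: le_trans D zR].
apply: (@le_trans _ _ (t ^+ 2 * (L ^+ 2 * (L ^+ 2 - rnorm (x t) ^+ 2 + K * t)))); first rlra.
rewrite exprMn mulrC; apply: ler_wpM2r; first exact: sqr_ge0.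
apply: le_trans hQ.
have G1 : L ^+ 2 - rnorm (x t) ^+ 2 <= h * (2 * L + 1).
  rewrite subr_sqr; have [le|/ltW ge] := lerP L (rnorm (x t)).
    apply: (@le_trans _ _ 0); last by rewrite mulr_ge0 ?addr_ge0 ?mulr_ge0 // ltW.
    by rewrite mulr_le0_ge0 ?addr_ge0 // subr_le0.
  by apply: ler_pM; rlra.
have G2 : K * t <= h * K by rewrite mulrC; apply: ler_wpM2r; exact: ltW.
have G3 : L ^+ 2 * (L ^+ 2 - rnorm (x t) ^+ 2 + K * t) <= L ^+ 2 * (h * (2 * L + 1 + K)).
  by apply: ler_wpM2l => //; rlra.
rewrite /Q; rlra.
Qed.

Let cauchy_sq (e : R) : 0 < e -> exists2 d, 0 < d & forall s t, 0 < s -> s < d ->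
  0 < t -> t < d -> rnorm (x t - x s) ^+ 2 <= e.
Proof.
move=> e0; have e8 : 0 < e / 8 by lra.
have L0 : 0 <= L := L_ge0.
have [d1 d10 d1P] := expansion e8.
have q0 : 0 < e / 8 / (K + K ^+ 2) by rewrite divr_gt0 // addr_gt0 // exprn_gt0.
pose h := Num.min (e / 8 / (2 * L + 1)) 1.
have L21 : 0 < 2 * L + 1 by rewrite ltr_wpDl // mulr_ge0.
have h0 : 0 < h by rewrite lt_min ltr01 divr_gt0.
have hL : h * (2 * L + 1) <= e / 8 by rewrite -ler_pdivlMr // ge_min lexx.
have h1 : h <= 1 by rewrite ge_min lexx orbT.
have [d2 d20 d2P] := norm_cvg h0.
have : all (fun r => 0 < r) [:: d1; d2; e / 8 / (K + K ^+ 2)] by rewrite /= d10 d20 q0.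
move=> /exists_small [d dp /= /and4P[k1 k2 k3 _]]; exists d => // s t s0 sd t0 td.
have [sd0 slo sup] := d2P s s0 (lt_trans sd k2).
have [td0 tlo tup] := d2P t t0 (lt_trans td k2).
have zs := d1P s s0 (lt_trans sd k1); have zt := d1P t t0 (lt_trans td k1).
have SQ r : r < d0 -> 0 < r -> rnorm (x r) < L + h -> rnorm (x r) ^+ 2 <= L ^+ 2 + e / 8.
  move=> rd r0 up; apply: (@le_trans _ _ ((L + h) ^+ 2)).
    by rewrite ler_pXn2r ?nnegrE ?rnorm_ge0 ?addr_ge0 // ltW.
  have : h * h <= h * 1 by apply: ler_wpM2l => //; exact: ltW.
  rlra.
have ipE : rnorm (ip (x t) (x s) - toC (L ^+ 2)) <= e / 4.
  have ts0 : 0 < t + s by exact: addr_gt0.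
  suff : rnorm (toC (t + s) * (ip (x t) (x s) - toC (L ^+ 2))) <= (t + s) * (e / 4).
    by rewrite rnormM rnorm_toC gtr0_norm // ler_pM2l.
  have ww : w * w^* = 1 by rewrite conjM_rnorm w1 expr1n.
  have -> : toC (t + s) * (ip (x t) (x s) - toC (L ^+ 2)) =
     - (1 - f t * (f s)^* - toC (t + s) * ip (x t) (x s)) +
     ((1 - w^* * f t - toC (t * L ^+ 2)) + (1 - w^* * f s - toC (s * L ^+ 2))^*
      - (1 - w^* * f t) * (1 - w^* * f s)^*).
    rewrite !rmorphB !rmorphM !rmorph1 /= conjCK conj_toC !toCM !toCD.
    transitivity (toC t * ip (x t) (x s) + toC s * ip (x t) (x s) - toC t * toC (L ^+ 2)
      - toC s * toC (L ^+ 2) + f t * (f s)^* - (w * w^*) * (f t * (f s)^*)).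
      by rewrite ww; ring.
    by ring.
  apply: le_trans (modD _ _) _; rewrite modN.
  have zK r : 0 < r -> r < d0 -> rnorm (1 - w^* * f r) <= K * r.
    move=> r0 rd; apply: le_trans (fw r0 rd).
    by rewrite -(rnorm_1sub_conj _ w1) -rnorm_conj rmorphB rmorph1 rmorphM /= conjCK.
  have T1 := ker s0 sd0 t0 td0.
  have T2 : rnorm ((1 - w^* * f t - toC (t * L ^+ 2)) + (1 - w^* * f s - toC (s * L ^+ 2))^*
      - (1 - w^* * f t) * (1 - w^* * f s)^*) <= e / 8 * t + e / 8 * s + (K * t) * (K * s).
    apply: le_trans (modB _ _) _; apply: lerD.
      by apply: le_trans (modD _ _) _; rewrite rnorm_conj; apply: lerD.
    by rewrite rnormM rnorm_conj; apply: ler_pM; rewrite ?rnorm_ge0 // zK.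
  have T3 : (K + K ^+ 2) * s <= e / 8.
    by rewrite mulrC -ler_pdivlMr ?addr_gt0 ?exprn_gt0 // ltW // (lt_trans sd).
  have T4 : t * ((K + K ^+ 2) * s) <= t * (e / 8) by apply: ler_wpM2l => //; exact: ltW.
  have T5 := mulr_gt0 s0 e0.
  apply: le_trans (lerD T1 T2) _; rlra.
have := rnorm_sqrB nip (x t) (x s).
have := SQ s sd0 s0 sup; have := SQ t td0 t0 tup.
have : L ^+ 2 - complex.Re (ip (x t) (x s)) <= e / 4.
  apply: le_trans ipE; apply: le_trans (Re_le_rnorm _).
  rewrite cReD cReN [complex.Re (toC _)]/= distrC; exact: ler_norm.
rlra.
Qed.

(** Radial Julia-Caratheodory in Hilbert form.  With L the lower limit of the norms,
    the kernel estimate at pairs (t, s), s -> 0, bounds |f t - w| by t |x t| L, while at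
    (t, t) it bounds it from below by t |x t|^2, up to o(t).  Hence |x t| -> L and
    f t = w (1 - t L^2 + o(t)); inserted in the kernel estimate at general pairs, this
    expansion gives <x t, x s> -> L^2, so that the vectors converge in norm. *)
Lemma radial_limit : exists2 y : H, x t @[t --> 0^'+] --> y &
  forall e : R, 0 < e -> exists2 d, 0 < d & forall t, 0 < t -> t < d ->
  rnorm (1 - w^* * f t - toC (t * rnorm y ^+ 2)) <= e * t.
Proof.
have [y xy] : exists y : H, x t @[t --> 0^'+] --> y.
  apply: complete_cvg => e e0.
  have e20 : 0 < e ^+ 2 / 4 by rewrite divr_gt0 // exprn_gt0.
  have [d dp dP] := cauchy_sq e20; exists (x (d / 2)).
  apply/nbhs_ballP; exists d => //= t.
  rewrite -ball_normE /= sub0r normrN => td t0; rewrite gtr0_norm // in td.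
  have d2 : 0 < d / 2 by lra.
  have d2' : d / 2 < d by lra.
  have := dP _ _ d2 d2' t0 td.
  have N0 := rnorm_ge0 (x t - x (d / 2)).
  rewrite ltNge => h; apply/negP => h'.
  have : e ^+ 2 <= rnorm (x t - x (d / 2)) ^+ 2.
    by rewrite ler_pXn2r ?nnegrE // ltW.
  by have := exprn_gt0 2 e0; rlra.
exists y => //; suff -> : rnorm y = L by exact: expansion.
apply/eqP; rewrite -subr_eq0 -normr_eq0 eq_le normr_ge0 andbT.
apply: (@ler_eps _ _ _ 2) => // e e0; rewrite add0r.
have [d1 d10 d1P] := norm_cvg e0.
have [d2 d20 d2P] := (cvg_at_right_rnorm _ _).1 xy e e0.
have : all (fun r => 0 < r) [:: d1; d2] by rewrite /= d10 d20.
move=> /exists_small [t t0 /= /and3P[k1 k2 _]].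
have [_ lo up] := d1P t t0 k1; have xe : rnorm (x t - y) < e := d2P t t0 k2.
have := vec_lerB (x t) y; have := vec_lerB y (x t); rewrite (vec_subC y (x t)).
by rewrite ler_norml => ? ?; apply/andP; split; rlra.
Qed.

End RadialLimit.

(** * Schwarz-Pick maps and Wolff's alternative *)

Section DiscContractions.
Context {R : realType}.
Local Notation C := (Cplx R).

Lemma one_sub_sqr (a b : C) : rnorm (1 - a * b^*) ^+ 2 =
  rnorm (a - b) ^+ 2 + (1 - rnorm a ^+ 2) * (1 - rnorm b ^+ 2).
Proof.
rewrite !rnorm_sqr !(cReD, cImD, cReN, cImN, cReM, cImM, cRe_conj, cIm_conj).
by rewrite [complex.Re 1]/= [complex.Im 1]/=; ring.
Qed.

(** The Schwarz-Pick inequality in terms of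
    |a - b|^2 / ((1 - |a|^2) (1 - |b|^2)), an increasing function of the
    pseudo-hyperbolic distance. *)
Definition schwarz_pick (f : C -> C) := forall z z', disc z -> disc z' ->
  rnorm (f z - f z') ^+ 2 * ((1 - rnorm z ^+ 2) * (1 - rnorm z' ^+ 2)) <=
  rnorm (z - z') ^+ 2 * ((1 - rnorm (f z) ^+ 2) * (1 - rnorm (f z') ^+ 2)).

Lemma disc_sqr_gt0 (z : C) : disc z -> 0 < 1 - rnorm z ^+ 2.
Proof.
move=> z1; have z1' : rnorm z < 1 by exact: z1.
by rewrite subr_gt0 expr_lt1 // rnorm_ge0.
Qed.

Lemma rnorm_convex (r : R) (c z : C) : 0 <= r -> r <= 1 ->
  rnorm (toC (1 - r) * c + toC r * z) <= (1 - r) * rnorm c + r * rnorm z.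
Proof.
move=> r0 r1; apply: le_trans (modD _ _) _.
by rewrite !rnormM !rnorm_toC !ger0_norm // subr_ge0.
Qed.

Lemma rnorm_convex_sqr (r : R) (c z : C) : 0 <= r -> r <= 1 ->
  rnorm (toC (1 - r) * c + toC r * z) ^+ 2 <= (1 - r) * rnorm c ^+ 2 + r * rnorm z ^+ 2.
Proof.
move=> r0 r1; have h := rnorm_convex c z r0 r1.
apply: (@le_trans _ _ (((1 - r) * rnorm c + r * rnorm z) ^+ 2)).
  by rewrite ler_pXn2r ?nnegrE ?rnorm_ge0 // addr_ge0 ?mulr_ge0 ?rnorm_ge0 ?subr_ge0.
have : 0 <= r * (1 - r) * (rnorm c - rnorm z) ^+ 2.
  by rewrite mulr_ge0 ?sqr_ge0 // mulr_ge0 // subr_ge0.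
rlra.
Qed.

Section Wolff.
Variables (f : C -> C) (t : C) (B : R).
Hypothesis f_disc : forall z, disc z -> disc (f z).
Hypothesis f_sp : schwarz_pick f.
Hypothesis t1 : circle t.
Hypothesis B1 : 1 <= B.

(** The closed horodisc of size B at t; [B = |z - t|^2 / (1 - |z|^2)] on its boundary. *)
Definition in_horodisc (z : C) := rnorm (z - t) ^+ 2 <= B * (1 - rnorm z ^+ 2).
Hypothesis f_horo : forall z, disc z -> in_horodisc z -> in_horodisc (f z).

(* The point c lies in all horodiscs of size at least 1. *)
Let c : C := toC (1 / 2) * t.

Let c_norm : rnorm c = 1 / 2.
Proof. by rewrite rnormM t1 mulr1 rnorm_toC ger0_norm // divr_ge0. Qed.

Let c_sub : c - t = - c.
Proof.
have E : t = c + c.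
  by rewrite -mulrDl -toCD (_ : 1 / 2 + 1 / 2 = 1) ?toC1 ?mul1r //; lra.
by rewrite E opprD addrA subrr sub0r.
Qed.

Let c_horo : in_horodisc c.
Proof. by rewrite /in_horodisc c_sub modN c_norm; have := B1; lra. Qed.

Let ell (r : R) z : C := toC (1 - r) * c + toC r * f z.

Let ell_norm (r : R) z : 0 <= r -> r <= 1 -> disc z ->
  rnorm (ell r z) <= (1 - r) / 2 + r.
Proof.
move=> r0 r1 zd; apply: le_trans (rnorm_convex _ _ r0 r1) _; rewrite c_norm.
have f1 : rnorm (f z) < 1 := f_disc zd.
have := ler_wpM2l r0 (ltW f1); rlra.
Qed.

Let ell_defect (r : R) z : 0 <= r -> r <= 1 -> disc z ->
  (3 + r) / 4 * (1 - rnorm (f z) ^+ 2) <= 1 - rnorm (ell r z) ^+ 2.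
Proof.
move=> r0 r1 zd; have := rnorm_convex_sqr c (f z) r0 r1; rewrite -/(ell r z) c_norm.
have : 0 <= (1 - r) * rnorm (f z) ^+ 2 by rewrite mulr_ge0 ?sqr_ge0 // subr_ge0.
rlra.
Qed.

Let ell_horo (r : R) z : 0 <= r -> r <= 1 -> disc z -> in_horodisc z ->
  in_horodisc (ell r z).
Proof.
move=> r0 r1 zd zh; have fh := f_horo zd zh; rewrite /in_horodisc in fh *.
have -> : ell r z - t = toC (1 - r) * (c - t) + toC r * (f z - t).
  by rewrite /ell !toCB toC1; ring.
have h1 := rnorm_convex_sqr (c - t) (f z - t) r0 r1.
have h2 : rnorm (ell r z) ^+ 2 <= _ := rnorm_convex_sqr c (f z) r0 r1.
have ch : rnorm (c - t) ^+ 2 <= B * (1 - rnorm c ^+ 2) := c_horo.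
apply: le_trans h1 _.
have B0 : 0 <= B by apply: le_trans B1.
have r1' : 0 <= 1 - r by rewrite subr_ge0.
apply: (@le_trans _ _ (B * (1 - ((1 - r) * rnorm c ^+ 2 + r * rnorm (f z) ^+ 2)))).
  have := ler_wpM2l r1' ch; have := ler_wpM2l r0 fh; rlra.
by apply: ler_wpM2l => //; rewrite lerD2l lerN2.
Qed.

Lemma horodisc_closed z : (forall e : R, 0 < e -> exists y,
  [/\ disc y, in_horodisc y & rnorm (y - z) < e]) -> in_horodisc z.
Proof.
move=> h; have B0 : 0 <= B by apply: le_trans B1.
apply: (@ler_eps _ _ _ (5 + 3 * B)); first by rewrite addr_ge0 // mulr_ge0.
move=> e0 e00.
have [e [e0' ee0 e1]] : exists e, [/\ 0 < e, e <= e0 & e <= 1].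
  by exists (Num.min e0 1); rewrite lt_min e00 ltr01 !ge_min !lexx orbT.
have [y [yd yh yz]] := h e e0'.
have y1 : rnorm y < 1 := yd; have Y0 := rnorm_ge0 y; have Z0 := rnorm_ge0 (z - t).
have yt : rnorm (y - t) <= 2.
  by apply: le_trans (modB _ _) _; have -> : rnorm t = 1 := t1; rlra.
have n1 : rnorm (z - t) <= rnorm (y - t) + e.
  by apply: le_trans (mod_tri y _ _) _; rewrite (mod_subC z y); rlra.
have n2 : rnorm z <= rnorm y + e by have := mod_lerB z y; rewrite mod_subC; rlra.
have s1 : rnorm (z - t) ^+ 2 <= rnorm (y - t) ^+ 2 + 5 * e.
  apply: (@le_trans _ _ ((rnorm (y - t) + e) ^+ 2)).
    by rewrite ler_pXn2r ?nnegrE ?addr_ge0 ?rnorm_ge0 // ltW.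
  have := ler_wpM2l (ltW e0') yt; have := ler_wpM2l (ltW e0') e1; rlra.
have s2 : rnorm z ^+ 2 <= rnorm y ^+ 2 + 3 * e.
  apply: (@le_trans _ _ ((rnorm y + e) ^+ 2)).
    by rewrite ler_pXn2r ?nnegrE ?addr_ge0 ?rnorm_ge0 // ltW.
  have := ler_wpM2l (ltW e0') (ltW y1); have := ler_wpM2l (ltW e0') e1; rlra.
have yh' : rnorm (y - t) ^+ 2 <= B * (1 - rnorm y ^+ 2) := yh.
have := ler_wpM2l B0 s2; have := ler_wpM2l B0 ee0; rlra.
Qed.

Lemma schwarz_pick_lipschitz (s : R) z z' : 0 <= s -> s < 1 ->
  rnorm z <= s -> rnorm z' <= s -> (1 - s ^+ 2) * rnorm (f z - f z') <= rnorm (z - z').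
Proof.
move=> s0 s1 zs zs'.
have zd : disc z := le_lt_trans zs s1; have zd' : disc z' := le_lt_trans zs' s1.
have S0 : 0 < 1 - s ^+ 2 by rewrite subr_gt0 expr_lt1.
have Z : 1 - s ^+ 2 <= 1 - rnorm z ^+ 2.
  by rewrite lerD2l lerN2 ler_pXn2r ?nnegrE ?rnorm_ge0.
have Z' : 1 - s ^+ 2 <= 1 - rnorm z' ^+ 2.
  by rewrite lerD2l lerN2 ler_pXn2r ?nnegrE ?rnorm_ge0.
have F := disc_sqr_gt0 (f_disc zd); have F' := disc_sqr_gt0 (f_disc zd').
have sp := f_sp zd zd'.
rewrite -(@ler_pXn2r _ 2) ?nnegrE ?mulr_ge0 ?rnorm_ge0 ?(ltW S0) // exprMn.
apply: (@le_trans _ _ (rnorm (f z - f z') ^+ 2 *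
    ((1 - rnorm z ^+ 2) * (1 - rnorm z' ^+ 2)))).
  rewrite mulrC; apply: ler_wpM2l; first exact: sqr_ge0.
  by rewrite expr2; apply: ler_pM => //; exact: ltW.
apply: le_trans sp _; rewrite ler_piMr ?sqr_ge0 // mulr_ile1 ?(ltW F) ?(ltW F') //.
  by rewrite gerBl sqr_ge0.
by rewrite gerBl sqr_ge0.
Qed.

(* Compared with f, the map ell contracts differences by r, while it keeps at least the
   part (3 + r) / 4 > r of the defects 1 - |f z|^2; so the pseudo-hyperbolic steps of its
   iterates decrease geometrically. *)
Let approx_fixed (r : R) : 0 < r -> r < 1 ->
  exists z, [/\ disc z, in_horodisc z & z = ell r z].
Proof.
move=> r0 r1; pose s := (1 - r) / 2 + r.
have r0' := ltW r0; have r1' := ltW r1.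
have s0 : 0 <= s by rewrite /s; lra.
have s1 : s < 1 by rewrite /s; lra.
have s2 : 1 / 2 <= s by rewrite /s; lra.
have S0 : 0 < 1 - s ^+ 2 by rewrite subr_gt0 expr_lt1.
pose z k := iter k (ell r) c.
have zP k : rnorm (z k) <= s /\ in_horodisc (z k).
  elim: k => [|k [IH1 IH2]]; first by rewrite /z /= c_norm.
  have d : disc (z k) := le_lt_trans IH1 s1.
  by split; [exact: ell_norm|exact: ell_horo].
have zd k : disc (z k) := le_lt_trans (zP k).1 s1.
pose G k := 1 - rnorm (z k) ^+ 2.
have G0 k : 0 < G k := disc_sqr_gt0 (zd k).
have G1 k : G k <= 1 by rewrite /G gerBl sqr_ge0.
pose h : R := (3 + r) / 4.
have h0 : 0 < h by rewrite /h; lra.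
have rh : r < h by rewrite /h; lra.
pose q := (r / h) ^+ 2.
have q0 : 0 <= q by exact: sqr_ge0.
have q1 : q < 1.
  have rh1 : r / h < 1 by rewrite ltr_pdivrMr ?mul1r.
  by rewrite /q expr_lt1 // divr_ge0 // ltW.
pose E0 := rnorm (z 1%N - z 0%N) ^+ 2 / (G 0%N * G 1%N).
have E00 : 0 <= E0 by rewrite divr_ge0 ?sqr_ge0 // mulr_ge0 // ltW.
have step k : rnorm (z k.+1 - z k) ^+ 2 <= q ^+ k * E0 * (G k * G k.+1).
  elim: k => [|k IH].
    by rewrite expr0 mul1r /E0 divfK // mulf_neq0 // gt_eqF.
  have F := disc_sqr_gt0 (f_disc (zd k)); have F' := disc_sqr_gt0 (f_disc (zd k.+1)).
  have sp := f_sp (zd k.+1) (zd k); rewrite -/(G k) -/(G k.+1) in sp.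
  have D := ell_defect r0' r1' (zd k); have D' := ell_defect r0' r1' (zd k.+1).
  rewrite -/h in D D'.
  have eq1 : z k.+2 - z k.+1 = toC r * (f (z k.+1) - f (z k)).
    by transitivity (ell r (z k.+1) - ell r (z k)); [|rewrite /ell; ring].
  rewrite eq1 rnormM rnorm_toC gtr0_norm // exprMn.
  move: F F' D D' sp; rewrite -[ell r (z k)]/(z k.+1) -[ell r (z k.+1)]/(z k.+2).
  rewrite -/(G k.+1) -/(G k.+2).
  set F1 := 1 - rnorm (f (z k)) ^+ 2; set F2 := 1 - rnorm (f (z k.+1)) ^+ 2.
  move=> F10 F20 D1 D2 sp.
  have GG : 0 < G k.+1 * G k by exact: mulr_gt0.
  have sp2 : rnorm (f (z k.+1) - f (z k)) ^+ 2 <= q ^+ k * E0 * (F2 * F1).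
    rewrite -(ler_pM2r GG); apply: le_trans sp _.
    have := ler_wpM2r (ltW (mulr_gt0 F20 F10)) IH.
    by move=> /le_trans; apply; rewrite le_eqVlt; apply/orP; left; apply/eqP; ring.
  apply: le_trans (ler_wpM2l (sqr_ge0 r) sp2) _.
  have -> : q ^+ k.+1 * E0 * (G k.+1 * G k.+2) =
     r ^+ 2 * (q ^+ k * E0 * ((h^-1 * G k.+1) * (h^-1 * G k.+2))).
    by rewrite exprS /q; field; rewrite gt_eqF.
  apply: ler_wpM2l; first exact: sqr_ge0.
  apply: ler_wpM2l; first by apply: mulr_ge0 E00; exact: exprn_ge0.
  rewrite mulrC; apply: ler_pM; rewrite ?(ltW F10) ?(ltW F20) //.
    by rewrite mulrC ler_pdivlMr // mulrC.
  by rewrite mulrC ler_pdivlMr // mulrC.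
have small (e : R) : 0 < e -> exists N, forall k, (N <= k)%N -> rnorm (z k.+1 - z k) < e.
  move=> e0; have e2 : 0 < e ^+ 2 / (E0 + 1) by rewrite divr_gt0 ?exprn_gt0 // ltr_wpDl.
  have qn : `|q| < 1 by rewrite ger0_norm.
  have /cvgrPdist_lt /(_ _ e2) [N _ NP] := cvg_expr qn.
  exists N => k kN; have qk0 : 0 <= q ^+ k by exact: exprn_ge0.
  have E1 : 0 < E0 + 1 by rewrite ltr_wpDl.
  have : `|0 - q ^+ k| < e ^+ 2 / (E0 + 1) := NP k kN.
  rewrite sub0r normrN ger0_norm // ltr_pdivlMr // => qk.
  rewrite -(@ltr_pXn2r _ 2) ?nnegrE ?rnorm_ge0 ?(ltW e0) //.
  apply: le_lt_trans (step k) _; apply: le_lt_trans qk.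
  have a1 : q ^+ k * E0 * (G k * G k.+1) <= q ^+ k * E0.
    rewrite -[leRHS]mulr1; apply: ler_wpM2l; first exact: mulr_ge0.
    by rewrite mulr_ile1 ?G1 ?(ltW (G0 _)).
  by apply: le_trans a1 _; apply: ler_wpM2l => //; rewrite lerDl.
have [y yP] := bounded_cluster (fun k => (zP k).1).
have ys : rnorm y <= s.
  apply: (@ler_eps _ _ _ 1) => // e e0; have [k _ ky] := yP e e0 0%N.
  have ky' : rnorm (z k - y) < e := ky.
  have := mod_lerB y (z k); rewrite mod_subC; have := (zP k).1; rlra.
exists y; split; first exact: le_lt_trans ys s1.
  apply: horodisc_closed => e e0; have [k _ ky] := yP e e0 0%N.
  by exists (z k); split; [exact: zd|exact: (zP k).2|exact: ky].
apply: mod_eq; apply/eqP; rewrite eq_le rnorm_ge0 andbT.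
apply: (@ler_eps _ _ _ (2 + (1 - s ^+ 2)^-1)).
  by rewrite addr_ge0 // invr_ge0 ltW.
move=> e e0; rewrite add0r; have [N NP] := small e e0; have [k kN ky] := yP e e0 N.
have ky' : rnorm (z k - y) < e := ky.
have L := schwarz_pick_lipschitz s0 s1 (zP k).1 ys.
have -> : y - ell r y = (y - z k) + (- (z k.+1 - z k) + toC r * (f (z k) - f y)).
  by rewrite -[z k.+1]/(ell r (z k)) /ell; ring.
apply: le_trans (modD _ _) _; rewrite mod_subC.
have T : rnorm (- (z k.+1 - z k) + toC r * (f (z k) - f y)) <= e + e * (1 - s ^+ 2)^-1.
  apply: le_trans (modD _ _) _; rewrite modN rnormM rnorm_toC gtr0_norm //.
  apply: lerD; first exact: ltW (NP k kN).
  rewrite ler_pdivlMr // mulrC mulrCA.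
  apply: (@le_trans _ _ (r * e)); last by rewrite ler_piMl // ltW.
  by apply: ler_wpM2l => //; apply: le_trans L _; exact: ltW.
apply: le_trans (lerD (ltW ky') T) _; rlra.
Qed.

(** Wolff's alternative.  The maps (1 - r) c + r f are uniformly contracting and have
    fixed points in the horodisc; these accumulate as r -> 1 either at a fixed point
    of f, or at t, and in the second case f moves them away from c, hence outwards. *)
Lemma wolff_alternative : (exists2 a, disc a & f a = a) \/
  forall e : R, 0 < e -> exists z, [/\ disc z, rnorm (z - t) < e, rnorm (f z - t) < e
    & rnorm z <= rnorm (f z)].
Proof.
pose r (n : nat) : R := 1 - n.+2%:R^-1.
have n2 (n : nat) : 0 < n.+2%:R^-1 :> R by rewrite invr_gt0.
have r0 n : 0 < r n by rewrite /r subr_gt0 invf_lt1 // ltr1n.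
have r1 n : r n < 1 by rewrite /r ltrBlDr ltrDl.
have [z zP] := choice (fun n => approx_fixed (r0 n) (r1 n)).
have zd n : disc (z n) by have [] := zP n.
have zh n : in_horodisc (z n) by have [] := zP n.
have zE n : z n = ell (r n) (z n) by have [] := zP n.
have z1 n : rnorm (z n) <= 1 by exact: ltW (zd n).
have [y yP] := bounded_cluster z1.
have yh : in_horodisc y.
  by apply: horodisc_closed => e e0; have [n _ ny] := yP e e0 0%N; exists (z n).
have small (e : R) : 0 < e -> exists N : nat, forall n, (N <= n)%N -> n.+2%:R^-1 < e.
  move=> e0; have [N _ NP] := near_infty_natSinv_lt (PosNum e0); exists N => n nN.
  by apply: (NP n.+1); rewrite /= (leq_trans nN).
have disp n : rnorm (f (z n) - z n) <= 2 * n.+2%:R^-1.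
  have -> : f (z n) - z n = toC (n.+2%:R^-1) * (f (z n) - c).
    by rewrite {2}zE /ell /r !toCB toC1; ring.
  rewrite rnormM rnorm_toC gtr0_norm // mulrC; apply: ler_wpM2r; first exact: ltW.
  have f1 : rnorm (f (z n)) < 1 := f_disc (zd n).
  by apply: le_trans (modB _ _) _; rewrite c_norm; rlra.
have y1 : rnorm y <= 1.
  apply: (@ler_eps _ _ _ 1) => // e e0; have [n _ ny] := yP e e0 0%N.
  have ny' : rnorm (z n - y) < e := ny.
  have := mod_lerB y (z n); rewrite mod_subC; have := z1 n; rlra.
have [yd|yt] := ltP (rnorm y) 1; [left; exists y => //|right].
  pose s := (1 + rnorm y) / 2.
  have s0 : 0 <= s by rewrite /s; have := rnorm_ge0 y; rlra.
  have s1 : s < 1 by rewrite /s; rlra.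
  have ys : rnorm y <= s by rewrite /s; rlra.
  have S0 : 0 < 1 - s ^+ 2 by rewrite subr_gt0 expr_lt1.
  apply: mod_eq; apply/eqP; rewrite eq_le rnorm_ge0 andbT.
  apply: (@ler_eps _ _ _ (3 + (1 - s ^+ 2)^-1)).
    by rewrite addr_ge0 // invr_ge0 ltW.
  move=> e e0; rewrite add0r; have [N NP] := small e e0.
  have m0 : 0 < Num.min e (s - rnorm y) by rewrite lt_min e0 subr_gt0 /s; rlra.
  have [n nN ny] := yP _ m0 N.
  have {ny} [ny ny2] : rnorm (z n - y) < e /\ rnorm (z n - y) < s - rnorm y.
    by apply/andP; rewrite -lt_min.
  have zs : rnorm (z n) <= s by have := mod_lerB (z n) y; rlra.
  have L := schwarz_pick_lipschitz s0 s1 zs ys.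
  have D := disp n; have N2 := NP n nN.
  have -> : f y - y = - (f (z n) - f y) + ((f (z n) - z n) + (z n - y)) by ring.
  apply: le_trans (modD _ _) _; rewrite modN.
  have T : rnorm (f (z n) - f y) <= e * (1 - s ^+ 2)^-1.
    by rewrite ler_pdivlMr // mulrC; apply: le_trans L _; exact: ltW.
  have T2 : rnorm ((f (z n) - z n) + (z n - y)) <= 3 * e.
    apply: le_trans (modD _ _) _.
    have D2 : rnorm (f (z n) - z n) <= 2 * e.
      by apply: le_trans D _; apply: ler_wpM2l => //; exact: ltW.
    apply: le_trans (lerD D2 (ltW ny)) _; rlra.
  apply: le_trans (lerD T T2) _; rlra.
have yE : y = t.
  have e1 : rnorm y = 1 by apply/eqP; rewrite eq_le y1.
  move: yh; rewrite /in_horodisc e1 expr1n subrr mulr0 => h.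
  by apply: mod_eq; apply/eqP; rewrite -sqrf_eq0 eq_le h sqr_ge0.
move=> e e0; have e4 : 0 < e / 4 by lra.
have [N NP] := small _ e4.
have m0 : 0 < Num.min (e / 4) (1 / 2) by rewrite lt_min e4; lra.
have [n nN ny] := yP _ m0 N; rewrite yE in ny.
have {ny} [ny ny2] : rnorm (z n - t) < e / 4 /\ rnorm (z n - t) < 1 / 2.
  by apply/andP; rewrite -lt_min.
have D := disp n; have N2 := NP n nN.
exists (z n); split => //; first by rlra.
  apply: le_lt_trans (mod_tri (z n) _ _) _.
  by move: (n.+2%:R^-1) D N2 => k D N2; rlra.
have zc : 1 / 2 <= rnorm (z n).
  have := mod_lerB t (z n); have -> : rnorm t = 1 := t1.
  by rewrite mod_subC; rlra.
have rr := r0 n; have rr1 := r1 n.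
have : rnorm (z n) <= (1 - r n) * (1 / 2) + r n * rnorm (f (z n)).
  by rewrite {1}zE -c_norm; apply: rnorm_convex; exact: ltW.
rewrite leNgt => h; rewrite leNgt; apply/negP => h'; move: h; apply/negP; rewrite negbK.
have a1 : r n * rnorm (f (z n)) < r n * rnorm (z n) by rewrite ltr_pM2l.
have a2 : (1 - r n) * (1 / 2) <= (1 - r n) * rnorm (z n).
  by apply: ler_wpM2l => //; rewrite subr_ge0 ltW.
rlra.
Qed.

End Wolff.
End DiscContractions.

(** * Julia's lemma in the disc *)

Section OneVariableJulia.
Context {R : realType}.
Local Notation C := (Cplx R).
Variables (xi : C -> C) (s t : C).
Hypothesis xi_disc : forall m, disc m -> disc (xi m).
Hypotheses (s1 : circle s) (t1 : circle t).

(** Julia's inequality: horodiscs at t are mapped into horodiscs at s, with sizes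
    multiplied by b. *)
Definition julia_horo (b : R) := forall m, disc m ->
  rnorm (xi m - s) ^+ 2 * (1 - rnorm m ^+ 2) <=
  b * rnorm (m - t) ^+ 2 * (1 - rnorm (xi m) ^+ 2).

Let defect_le m : disc m -> 1 - rnorm (xi m) ^+ 2 <= 2 * rnorm (xi m - s).
Proof.
move=> md; have x1 : rnorm (xi m) < 1 := xi_disc md; have x0 := rnorm_ge0 (xi m).
have s1' : rnorm s = 1 := s1.
have := mod_lerB s (xi m); rewrite s1' mod_subC; rnra.
Qed.

Lemma julia_horo_nt_bound (b c : R) m : 0 <= b -> 0 <= c -> julia_horo b -> disc m ->
  rnorm (m - t) <= c * (1 - rnorm m) -> rnorm (xi m - s) <= 2 * b * c * rnorm (m - t).
Proof.
move=> b0 c0 J md mc; have m1 : rnorm m < 1 := md; have m0 := rnorm_ge0 m.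
have D := defect_le md; have J' := J m md.
have X0 := rnorm_ge0 (xi m - s); have T0 := rnorm_ge0 (m - t).
have m1' : 0 < 1 - rnorm m by rewrite subr_gt0.
apply: ler_of_sqr_le; first by rewrite !mulr_ge0.
rewrite -(ler_pM2r m1').
apply: (@le_trans _ _ (rnorm (xi m - s) ^+ 2 * (1 - rnorm m ^+ 2))).
  apply: ler_wpM2l; first exact: sqr_ge0.
  by rewrite lerD2l lerN2 expr2 ler_piMr // ltW.
apply: le_trans J' _.
apply: (@le_trans _ _ (b * rnorm (m - t) ^+ 2 * (2 * rnorm (xi m - s)))).
  by apply: ler_wpM2l D; rewrite mulr_ge0 ?sqr_ge0.
have h : 2 * b * rnorm (m - t) * rnorm (xi m - s) * rnorm (m - t) <=
    2 * b * rnorm (m - t) * rnorm (xi m - s) * (c * (1 - rnorm m)).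
  by apply: ler_wpM2l => //; rewrite !mulr_ge0.
rlra.
Qed.

Lemma julia_horo_nt_limit (b : R) : 0 <= b -> julia_horo b -> nt_limit xi t s.
Proof.
move=> b0 J; apply/nt_limitP => // c e c0 e0.
have q0 : 0 < 2 * b * c + 1 by rewrite ltr_wpDl // !mulr_ge0 // ltW.
exists (e / (2 * b * c + 1)); first exact: divr_gt0.
move=> m md; rewrite rnorm_subC => mc; rewrite ltr_pdivlMr // => mt.
have mc' : rnorm (m - t) <= c * (1 - rnorm m) := mc.
have mt' : rnorm (m - t) * (2 * b * c + 1) < e := mt.
have := julia_horo_nt_bound b0 (ltW c0) J md mc'; have := rnorm_ge0 (m - t); rlra.
Qed.

Let point (r : R) : C := toC (1 - r) * t.

Lemma radius_point (r : R) : 0 < r -> r < 1 ->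
  [/\ disc (toC (1 - r) * t), rnorm (toC (1 - r) * t) = 1 - r
    & rnorm (toC (1 - r) * t - t) = r].
Proof.
move=> r0 r1; have E : rnorm (toC (1 - r) * t) = 1 - r.
  by rewrite rnormM t1 mulr1 rnorm_toC ger0_norm // subr_ge0 ltW.
split => //; first by rewrite /disc /unit_ball /= E ltrBlDr ltrDl.
have -> : toC (1 - r) * t - t = - (toC r * t) by rewrite toCB toC1; ring.
by rewrite modN rnormM t1 mulr1 rnorm_toC gtr0_norm.
Qed.

Lemma julia_horo_radius (b r : R) : 0 <= b -> julia_horo b -> 0 < r -> r < 1 ->
  (2 - r) * (1 - rnorm (xi (point r))) <= 2 * b * r /\
  (2 - r) * rnorm (xi (point r) - s) <= 2 * b * r.
Proof.
move=> b0 J r0 r1; have [md mN mt] := radius_point r0 r1; rewrite -/(point r) in md mN mt.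
have J' := J _ md; rewrite mN mt in J'.
have D := defect_le md.
have X0 := rnorm_ge0 (xi (point r) - s).
have S : (2 - r) * rnorm (xi (point r) - s) <= 2 * b * r.
  suff : r * ((2 - r) * rnorm (xi (point r) - s) ^+ 2) <=
         r * (2 * b * r * rnorm (xi (point r) - s)).
    rewrite ler_pM2l // => h; apply: ler_of_sqr_le; first by rewrite !mulr_ge0 // ltW.
    have r2 : 0 <= 2 - r by rewrite subr_ge0 (le_trans (ltW r1)) // ler1n.
    have := ler_wpM2l r2 h; rlra.
  have h2 : b * r ^+ 2 * (1 - rnorm (xi (point r)) ^+ 2) <=
      b * r ^+ 2 * (2 * rnorm (xi (point r) - s)).
    by apply: ler_wpM2l => //; rewrite mulr_ge0 ?sqr_ge0.
  rlra.
split => //; apply: le_trans S; apply: ler_wpM2l; first by rlra.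
by have s1' : rnorm s = 1 := s1; rewrite mod_subC -{1}s1' mod_lerB.
Qed.

Lemma julia_horo_liminf (b : R) : 0 <= b -> julia_horo b ->
  (julia_liminf xi t <= b%:E)%E.
Proof.
move=> b0 J; apply/julia_liminf_le => e d e0 d0.
have q0 : 0 < e / (b + 1) by rewrite divr_gt0 // ltr_wpDl.
have : all (fun x => 0 < x) [:: d; 1; e / (b + 1)] by rewrite /= d0 ltr01 q0.
move=> /exists_small [r r0 /= /and4P[k1 k2 k3 _]].
have [md mN mt] := radius_point r0 k2; rewrite -/(point r) in md mN mt.
have [h _] := julia_horo_radius b0 J r0 k2.
exists (point r); split => //.
  by have mt' : rnorm (point r - t) < d by rewrite mt.
rewrite /julia_quotient; have -> : 1 - rnorm (point r) = r by rewrite mN; ring.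
rewrite ltr_pdivrMr //.
rewrite ltr_pdivlMr ?ltr_wpDl // in k3.
have h3 : r * (r * (b + 1)) < r * e by rewrite ltr_pM2l.
have h4 : r * (r * e) <= r * (1 * e).
  by apply: ler_wpM2l; [exact: ltW|apply: ler_wpM2r; exact: ltW].
have h5 : 0 < r ^+ 2 by rewrite exprn_gt0.
have br := mulr_ge0 b0 (ltW r0).
have r2 : 0 < 2 - r by rlra.
rewrite -(ltr_pM2l r2); apply: le_lt_trans h _; rlra.
Qed.

Lemma julia_horo_B_point (b : R) : 0 <= b -> julia_horo b -> B_point xi t.
Proof. by move=> b0 J; split => //; apply: le_lt_trans (julia_horo_liminf b0 J) (ltry _). Qed.

Lemma julia_horo_pos (b : R) : julia_horo b -> 0 < b.
Proof.
move=> J; have z0 : disc (0 : C) by rewrite /disc /unit_ball /= rnorm0 ltr01.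
have J0 := J _ z0; have x1 : rnorm (xi 0) < 1 := xi_disc z0.
have F := disc_sqr_gt0 (xi_disc z0); have s1' : rnorm s = 1 := s1.
have X0 : 0 < rnorm (xi 0 - s).
  by have := mod_lerB s (xi 0); rewrite s1' mod_subC; rlra.
have N : rnorm (0 - t) = 1 by rewrite sub0r modN.
rewrite mod0 N expr0n /= subr0 mulr1 expr1n mulr1 in J0.
have : 0 < b * (1 - rnorm (xi 0) ^+ 2) by apply: lt_le_trans J0; rewrite exprn_gt0.
by rewrite pmulr_lgt0.
Qed.

(** The angular derivative: Julia's inequality bounds xi from above on the radius and
    the lower limit bounds it from below, so only the real direction remains. *)
Lemma radial_derivative (b : R) : 0 <= b -> julia_horo b -> (b%:E <= julia_liminf xi t)%E ->
  forall e : R, 0 < e -> exists2 d : R, 0 < d & forall r, 0 < r -> r < d -> r < 1 ->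
    rnorm (1 - s^* * xi (point r) - toC (b * r)) <= e * r.
Proof.
move=> b0 J lb e e0.
have Q0 : 0 < 3 * b ^+ 2 + 2 * b + 1.
  by rewrite ltr_wpDl // addr_ge0 ?mulr_ge0 ?exprn_ge0.
have [h [h0 h1 hQ]] : exists h : R,
    [/\ 0 < h, h <= 1 & h * (3 * b ^+ 2 + 2 * b + 1) <= e ^+ 2].
  exists (Num.min 1 (e ^+ 2 / (3 * b ^+ 2 + 2 * b + 1))).
  rewrite lt_min ltr01 divr_gt0 ?exprn_gt0 // ge_min lexx; split => //.
  by rewrite -ler_pdivlMr // ge_min lexx orbT.
have [d d0 dP] := julia_liminf_gt lb h0.
have m0 : 0 < Num.min d h by rewrite lt_min d0.
exists (Num.min d h) => // r r0; rewrite lt_min => /andP[rd rh] r1.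
have [md mN mt] := radius_point r0 r1; rewrite -/(point r) in md mN mt.
have [_ S] := julia_horo_radius b0 J r0 r1.
have qr : (b - h) * r < 1 - rnorm (xi (point r)).
  have mt' : rnorm (point r - t) < d by rewrite mt.
  have mN' : 1 - rnorm (point r) = r by rewrite mN; ring.
  by have := dP _ md mt'; rewrite /julia_quotient mN' ltr_pdivlMr.
have r2 : 0 < 2 - r by rlra.
have {}S : rnorm (xi (point r) - s) <= b * r * (1 + r).
  rewrite -(ler_pM2l r2); apply: le_trans S _.
  have h2 : 0 <= b * r * (r * (1 - r)) by rewrite !mulr_ge0 ?subr_ge0 // ltW.
  rlra.
have s1' : rnorm s = 1 := s1.
have zN : rnorm (1 - s^* * xi (point r)) = rnorm (xi (point r) - s).
  by rewrite -(rnorm_1sub_conj _ s1') -rnorm_conj rmorphB rmorph1 rmorphM /= conjCK.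
have zR : 1 - rnorm (xi (point r)) <= complex.Re (1 - s^* * xi (point r)).
  rewrite cReD cReN [complex.Re 1]/= lerD2l lerN2.
  apply: le_trans (ler_norm _) (le_trans (Re_le_rnorm _) _).
  by rewrite rnormM rnorm_conj s1' mul1r.
rewrite -(@ler_pXn2r _ 2) ?nnegrE ?rnorm_ge0 ?mulr_ge0 ?(ltW e0) ?(ltW r0) //.
have E : rnorm (1 - s^* * xi (point r) - toC (b * r)) ^+ 2 =
   rnorm (xi (point r) - s) ^+ 2 - 2 * (b * r) * complex.Re (1 - s^* * xi (point r))
     + (b * r) ^+ 2.
  rewrite -zN; set z := 1 - _; rewrite !rnorm_sqr !cReD !cImD !cReN !cImN [complex.Re (toC _)]/=.
  by rewrite [complex.Im (toC _)]/=; ring.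
rewrite E; have br : 0 <= b * r by rewrite mulr_ge0 // ltW.
have S2 : rnorm (xi (point r) - s) ^+ 2 <= (b * r) ^+ 2 * (1 + 3 * h).
  apply: (@le_trans _ _ ((b * r * (1 + r)) ^+ 2)).
    by rewrite ler_pXn2r ?nnegrE ?rnorm_ge0 // mulr_ge0 // addr_ge0 // ltW.
  rewrite exprMn; apply: ler_wpM2l; first exact: sqr_ge0.
  have := ler_wpM2l (ltW r0) (ltW r1); rlra.
have W2 := ler_wpM2l br (ltW (lt_le_trans qr zR)).
apply: (@le_trans _ _ (r ^+ 2 * (h * (3 * b ^+ 2 + 2 * b + 1)))).
  have := mulr_ge0 (sqr_ge0 r) (ltW h0); rlra.
by rewrite exprMn [leRHS]mulrC; apply: ler_wpM2l hQ; exact: sqr_ge0.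
Qed.

End OneVariableJulia.

Section JuliaLemma.
Context {R : realType}.
Local Notation C := (Cplx R).
Variables (xi : C -> C) (t : C).
Hypotheses (xi_disc : forall m, disc m -> disc (xi m)) (t1 : circle t).
Hypothesis xi_sp : schwarz_pick xi.

(** Julia's lemma: let one of the points in the Schwarz-Pick inequality tend to t along
    a sequence that realises the lower limit. *)
Lemma julia_lemma (b : R) : 0 <= b -> (julia_liminf xi t <= b%:E)%E ->
  exists2 w, circle w & julia_horo xi w t b.
Proof.
move=> b0 /julia_liminf_le lb.
have n0 (n : nat) : 0 < n.+1%:R^-1 :> R by rewrite invr_gt0.
have [z zP] := choice (fun n => lb _ _ (n0 n) (n0 n)).
have small (e : R) : 0 < e -> exists N, forall n, (N <= n)%N -> n.+1%:R^-1 < e.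
  move=> e0; have [N _ NP] := near_infty_natSinv_lt (PosNum e0); exists N => n nN.
  exact: NP nN.
have zd n : disc (z n) by have [] := zP n.
have [w wP] := bounded_cluster (fun n => ltW (xi_disc (zd n))).
have approx (e : R) : 0 < e -> exists y, [/\ disc y, rnorm (y - t) < e,
    1 - rnorm (xi y) < (b + e) * (1 - rnorm y) & rnorm (xi y - w) < e].
  move=> e0; have [N NP] := small e e0; have [n nN nw] := wP e e0 N.
  have [yd yt yq] := zP n; exists (z n); split => //; first exact: lt_trans yt (NP n nN).
  rewrite /julia_quotient ltr_pdivrMr ?subr_gt0 // in yq.
  apply: lt_le_trans yq _; apply: ler_wpM2r; first by rewrite subr_ge0 ltW.
  by rewrite lerD2l ltW // NP.
have t1' : rnorm t = 1 := t1.
have w1 : rnorm w = 1.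
  apply/eqP; rewrite eq_le; apply/andP; split.
    apply: (@ler_eps _ _ _ 1) => // e e0; have [y [yd _ _ yw]] := approx e e0.
    have x1 : rnorm (xi y) < 1 := xi_disc yd.
    have := mod_lerB w (xi y); rewrite mod_subC; rlra.
  apply: (@ler_eps _ _ _ (b + 2)); first by rewrite addr_ge0.
  move=> e00 e000.
  have [e [e0 ee e1]] : exists e, [/\ 0 < e, e <= e00 & e <= 1].
    by exists (Num.min e00 1); rewrite lt_min e000 ltr01 !ge_min !lexx orbT.
  have [y [yd yt yq yw]] := approx e e0; have y1 : rnorm y < 1 := yd.
  have := mod_lerB (xi y) w; have T := mod_lerB t y; rewrite mod_subC t1' in T.
  have T2 : (b + e) * (1 - rnorm y) <= (b + 1) * e.
    by apply: ler_pM; rlra.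
  have := ler_wpM2l b0 ee; rlra.
exists w => // m md.
have m1 : rnorm m < 1 := md; have x1 : rnorm (xi m) < 1 := xi_disc md.
have m0 := rnorm_ge0 m; have x0 := rnorm_ge0 (xi m).
have mt : rnorm (m - t) <= 2 by apply: le_trans (modB _ _) _; rewrite t1'; rlra.
have G := disc_sqr_gt0 md; have F := disc_sqr_gt0 (xi_disc md).
apply: (@ler_eps _ _ _ (5 * b + 9 * (b + 2) + 5)).
  by rewrite !addr_ge0 ?mulr_ge0 ?addr_ge0.
move=> e00 e000.
have [e [e0 ee e1]] : exists e, [/\ 0 < e, e <= e00 & e <= 1].
  by exists (Num.min e00 1); rewrite lt_min e000 ltr01 !ge_min !lexx orbT.
have [y [yd yt yq yw]] := approx e e0.
have y1 : rnorm y < 1 := yd; have y0 := rnorm_ge0 y.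
have ye : 1 - e <= rnorm y by have := mod_lerB t y; rewrite mod_subC t1'; rlra.
have v1 : rnorm (xi y) < 1 := xi_disc yd; have v0 := rnorm_ge0 (xi y).
have Gy := disc_sqr_gt0 yd.
have E1 := one_sub_sqr y m; have E2 := one_sub_sqr (xi y) (xi m).
have sp := xi_sp yd md.
have P : rnorm (xi m - w) ^+ 2 <= rnorm (1 - xi y * (xi m)^*) ^+ 2 + 5 * e.
  have P0 := rnorm_ge0 (1 - xi y * (xi m)^*).
  have P2 : rnorm (1 - xi y * (xi m)^*) <= 2.
    apply: le_trans (modB _ _) _; rewrite rnorm1 rnormM rnorm_conj.
    have := ler_pM v0 x0 (ltW v1) (ltW x1); rlra.
  have P3 : rnorm (xi m - w) <= rnorm (1 - xi y * (xi m)^*) + e.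
    rewrite -(rnorm_1sub_conj _ w1).
    have -> : 1 - w * (xi m)^* = (1 - xi y * (xi m)^*) + (xi y - w) * (xi m)^* by ring.
    apply: le_trans (modD _ _) _; rewrite lerD2l rnormM rnorm_conj.
    by rewrite -[leRHS]mulr1; apply: ler_pM; rewrite ?rnorm_ge0 // ltW.
  apply: (@le_trans _ _ ((rnorm (1 - xi y * (xi m)^*) + e) ^+ 2)).
    by rewrite ler_pXn2r ?nnegrE ?rnorm_ge0 // addr_ge0 // ltW.
  have := ler_wpM2r (ltW e0) P2; have := ler_wpM2r (ltW e0) e1; rlra.
have Q : rnorm (1 - y * m^*) ^+ 2 <= rnorm (m - t) ^+ 2 + 5 * e.
  have Q0 := rnorm_ge0 (m - t).
  have Q3 : rnorm (1 - y * m^*) <= rnorm (m - t) + e.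
    rewrite -(rnorm_1sub_conj _ t1').
    have -> : 1 - y * m^* = (1 - t * m^*) + (t - y) * m^* by ring.
    apply: le_trans (modD _ _) _; rewrite lerD2l rnormM rnorm_conj mod_subC.
    by rewrite -[leRHS]mulr1; apply: ler_pM; rewrite ?rnorm_ge0 // ltW.
  apply: (@le_trans _ _ ((rnorm (m - t) + e) ^+ 2)).
    by rewrite ler_pXn2r ?nnegrE ?rnorm_ge0 // addr_ge0 // ltW.
  have := ler_wpM2r (ltW e0) mt; have := ler_wpM2r (ltW e0) e1; rlra.
have J : rnorm (1 - xi y * (xi m)^*) ^+ 2 * (1 - rnorm m ^+ 2) <=
    rnorm (1 - y * m^*) ^+ 2 * ((b + e * (b + 2)) * (1 - rnorm (xi m) ^+ 2)).
  rewrite -(ler_pM2l Gy).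
  have V : 1 - rnorm (xi y) ^+ 2 <= (b + e * (b + 2)) * (1 - rnorm y ^+ 2).
    have be : 0 <= b + e by rewrite addr_ge0 // ltW.
    have V1 : 1 - rnorm (xi y) ^+ 2 <= 2 * (1 - rnorm (xi y)).
      by have := sqr_ge0 (1 - rnorm (xi y)); rlra.
    have V2 : (2 - e) * (1 - rnorm y) <= 1 - rnorm y ^+ 2.
      have : 0 <= 1 - rnorm y by rewrite subr_ge0 ltW.
      by have h : 2 - e <= 1 + rnorm y by [rlra]; move=> /ler_wpM2r /(_ _ _ h); rlra.
    have e2 : 0 <= b + e * (b + 2) by rewrite !addr_ge0 ?mulr_ge0 ?addr_ge0 // ltW.
    have V3 := ler_wpM2l e2 V2.
    have V4 : 2 * (b + e) <= (b + e * (b + 2)) * (2 - e).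
      by have := mulr_ge0 (mulr_ge0 b0 (ltW e0)) (_ : 0 <= 1 - e); rewrite subr_ge0 => /(_ e1);
         have := mulr_ge0 (ltW e0) (_ : 0 <= 1 - e); rewrite subr_ge0 => /(_ e1); rlra.
    have y1' : 0 <= 1 - rnorm y by rewrite subr_ge0 ltW.
    have := ler_wpM2r y1' V4; rlra.
  have D0 := sqr_ge0 (rnorm (1 - y * m^*)).
  have V5 := ler_wpM2l (mulr_ge0 D0 (ltW F)) V.
  rewrite E1 E2 in V5 *; rlra.
have F1 : 1 - rnorm (xi m) ^+ 2 <= 1 by rewrite gerBl sqr_ge0.
have G1 : 1 - rnorm m ^+ 2 <= 1 by rewrite gerBl sqr_ge0.
have e2 : 0 <= b + e * (b + 2) by rewrite !addr_ge0 ?mulr_ge0 ?addr_ge0 // ltW.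
have J1 := ler_wpM2r (ltW G) P.
have J2 := ler_wpM2r (mulr_ge0 e2 (ltW F)) Q.
have J3 : 5 * e * (1 - rnorm m ^+ 2) <= 5 * e * 1 by apply: ler_wpM2l; rlra.
have Q4 : rnorm (m - t) ^+ 2 <= 4.
  by rewrite (_ : 4 = 2 ^+ 2) ?ler_pXn2r ?nnegrE ?rnorm_ge0 //; ring.
have bF0 := mulr_ge0 b0 (ltW F).
have J4 : 5 * e * (b * (1 - rnorm (xi m) ^+ 2)) <= 5 * e * b.
  by apply: ler_wpM2l; [rlra|rewrite ler_piMr].
have J5 : (rnorm (m - t) ^+ 2 + 5 * e) * (e * (b + 2) * (1 - rnorm (xi m) ^+ 2)) <=
    9 * (e * (b + 2)).
  have eb : 0 <= e * (b + 2) by rewrite mulr_ge0 ?addr_ge0 // ltW.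
  apply: ler_pM.
  - by rewrite addr_ge0 ?sqr_ge0 // mulr_ge0 // ltW.
  - by rewrite mulr_ge0 // ltW.
  - rlra.
  - by rewrite ler_piMr.
have J6 := ler_wpM2l b0 ee.
rlra.
Qed.

Lemma julia_horo_of_liminf (s : C) (b : R) : circle s -> 0 <= b -> nt_limit xi t s ->
  (julia_liminf xi t <= b%:E)%E -> julia_horo xi s t b.
Proof.
move=> s1 b0 xs /(julia_lemma b0) [w w1 J].
by rewrite (nt_limit_unique t1 xs (julia_horo_nt_limit xi_disc w1 t1 b0 J)).
Qed.

End JuliaLemma.

Lemma julia_liminf_real {R : realType} (xi : Cplx R -> Cplx R) (t : Cplx R) (c : R) :
  (forall m, disc m -> disc (xi m)) -> (julia_liminf xi t <= c%:E)%E ->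
  exists b : R, [/\ 0 <= b, b <= c & julia_liminf xi t = b%:E].
Proof.
move=> xid lc; have : (0%:E <= julia_liminf xi t)%E.
  apply: julia_liminf_ge => e e0; exists 1 => // x xb _.
  apply: (@le_trans _ _ 0); first by rewrite sub0r oppr_le0 ltW.
  rewrite divr_ge0 // subr_ge0 ltW //; exact: (xid x xb).
case: (julia_liminf xi t) lc => [b||] //; rewrite !lee_fin => bc b0.
by exists b.
Qed.

(** * The model and its slices *)

Section Model.
Context {R : realType}.
Local Notation C := (Cplx R).
Context {H : completeNormedModType C}.
Variables (phi : C * C -> C) (ip : {dot H for Num.conj}) (M1 M2 : set H).
Variables (p1 p2 : H -> H) (u : C * C -> H).
Hypothesis phi_holo : holo_into_disc phi.
Hypothesis model : is_model phi ip M1 M2 p1 p2 u.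
Implicit Types (l m : C * C) (v x : H).

Let hd := model_space model.
Let hd' := hilbert_decomposition_swap hd.
Let nip := norm_ip hd.
Local Notation a1 l := (rnorm (p1 (u l))).
Local Notation a2 l := (rnorm (p2 (u l))).

Lemma phi_lt1 l : bidisc l -> rnorm (phi l) < 1.
Proof. exact: phi_holo.2. Qed.

Lemma model_diag l : bidisc l ->
  1 - rnorm (phi l) ^+ 2 =
    (1 - rnorm l.1 ^+ 2) * a1 l ^+ 2 + (1 - rnorm l.2 ^+ 2) * a2 l ^+ 2.
Proof.
move=> lb; apply: toC_inj; have := model_eq model lb lb.
by rewrite !(ip_diag nip) !conjM_rnorm -!toC1 -!toCB -!toCM -toCD.
Qed.

Lemma kernel_bound l m : bidisc l -> bidisc m ->
  rnorm (1 - phi l * (phi m)^*) <=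
    rnorm (1 - l.1 * (m.1)^*) * (a1 l * a1 m) + rnorm (1 - l.2 * (m.2)^*) * (a2 l * a2 m).
Proof.
move=> lb mb; rewrite (model_eq model lb mb).
apply: le_trans (modD _ _) _; rewrite !rnormM.
by apply: lerD; rewrite ler_wpM2l ?rnorm_ge0 ?(cauchy_schwarz nip).
Qed.

Lemma u_le l : bidisc l ->
  (1 - rnorm l) * (a1 l ^+ 2 + a2 l ^+ 2) <= 1 - rnorm (phi l) ^+ 2.
Proof.
move=> lb; rewrite (model_diag lb).
have := pair_fst l; have := pair_snd l; have := rnorm_ge0 l.1; have := rnorm_ge0 l.2.
move/bidiscP : lb => [l1 l2].
have : rnorm l < 1 by rewrite rnorm_pair gt_max l1 l2.
have := sqr_ge0 (a1 l); have := sqr_ge0 (a2 l).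
set A := a1 l ^+ 2; set B := a2 l ^+ 2; set r := rnorm l.
set r1 := rnorm l.1; set r2 := rnorm l.2 => B0 A0 rl1 h2 h1 hr2 hr1.
rewrite mulrDr; apply: lerD; apply: ler_wpM2r => //; rnra.
Qed.

(** Sequences as in the definition of Y_tau have bounded model vectors. *)
Lemma u_quotient_bound l (B : R) : bidisc l -> julia_quotient phi l <= B ->
  a1 l ^+ 2 + a2 l ^+ 2 <= 2 * B.
Proof.
move=> lb; have l1 : rnorm l < 1 by exact: lb.
rewrite /julia_quotient ler_pdivrMr ?subr_gt0 // => q.
have := u_le lb; have := phi_lt1 lb; have := rnorm_ge0 (phi l).
set A := a1 l ^+ 2 + a2 l ^+ 2 => h0 h1 h2.
suff : (1 - rnorm l) * A <= (1 - rnorm l) * (2 * B).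
  by rewrite ler_pM2l // subr_gt0.
apply: le_trans h2 _; rnra.
Qed.

Lemma pair_bidisc (z m : C) : disc z -> disc m -> bidisc ((z, m) : C * C).
Proof. by move=> zd md; apply/bidiscP. Qed.

Lemma model_diag_pair (z m : C) : disc z -> disc m ->
  1 - rnorm (phi (z, m)) ^+ 2 =
    (1 - rnorm z ^+ 2) * a1 (z, m) ^+ 2 + (1 - rnorm m ^+ 2) * a2 (z, m) ^+ 2.
Proof. by move=> zd md; exact: model_diag (pair_bidisc zd md). Qed.

Lemma kernel_bound_pair (z m z' m' : C) : disc z -> disc m -> disc z' -> disc m' ->
  rnorm (1 - phi (z, m) * (phi (z', m'))^*) <=
    rnorm (1 - z * z'^*) * (a1 (z, m) * a1 (z', m')) +
    rnorm (1 - m * m'^*) * (a2 (z, m) * a2 (z', m')).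
Proof.
by move=> zd md zd' md'; exact: kernel_bound (pair_bidisc zd md) (pair_bidisc zd' md').
Qed.

(** Schwarz-Pick on the slices of phi, from the positivity of the model kernel.  The
    additional term on the left makes the inequality strict, also infinitesimally,
    wherever the second component of the model does not vanish. *)
Lemma slice_schwarz_pick_strict (m z z' : C) : disc m -> disc z -> disc z' ->
  rnorm (phi (z, m) - phi (z', m)) ^+ 2 * ((1 - rnorm z ^+ 2) * (1 - rnorm z' ^+ 2)) +
  rnorm (z - z') ^+ 2 *
    ((1 - rnorm m ^+ 2) ^+ 2 * (a2 (z, m) ^+ 2 * a2 (z', m) ^+ 2)) <=
  rnorm (z - z') ^+ 2 *
    ((1 - rnorm (phi (z, m)) ^+ 2) * (1 - rnorm (phi (z', m)) ^+ 2)).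
Proof.
move=> md zd zd'; have kb := kernel_bound_pair zd md zd' md.
have c0 := disc_sqr_gt0 md; have A0 := disc_sqr_gt0 zd; have A'0 := disc_sqr_gt0 zd'.
have mm : rnorm (1 - m * m^*) = 1 - rnorm m ^+ 2.
  by rewrite conjM_rnorm -toC1 -toCB rnorm_toC gtr0_norm.
have E1 := one_sub_sqr z z'; have E2 := one_sub_sqr (phi (z, m)) (phi (z', m)).
have D0 := sqr_ge0 (rnorm (z - z')).
have pA : (1 - rnorm z ^+ 2) * (1 - rnorm z' ^+ 2) <= rnorm (1 - z * z'^*) ^+ 2.
  by rewrite E1 lerDr.
have T := kernel_two_point (rnorm_ge0 (p1 (u (z, m)))) (rnorm_ge0 (p2 (u (z, m))))
  (rnorm_ge0 (p1 (u (z', m)))) (rnorm_ge0 (p2 (u (z', m)))) (ltW A0) (ltW A'0) (ltW c0)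
  (rnorm_ge0 (1 - z * z'^*)) pA.
have N1 := model_diag_pair zd md; have N2 := model_diag_pair zd' md.
rewrite -N1 -N2 E1 addrK in T.
rewrite mm in kb.
have Q : (rnorm (phi (z, m) - phi (z', m)) ^+ 2 + (1 - rnorm (phi (z, m)) ^+ 2) *
     (1 - rnorm (phi (z', m)) ^+ 2)) * ((1 - rnorm z ^+ 2) * (1 - rnorm z' ^+ 2)) <=
  (rnorm (1 - z * z'^*) * (a1 (z, m) * a1 (z', m)) +
     (1 - rnorm m ^+ 2) * (a2 (z, m) * a2 (z', m))) ^+ 2 *
   ((1 - rnorm z ^+ 2) * (1 - rnorm z' ^+ 2)).
  apply: ler_wpM2r; first by rewrite mulr_ge0 // ltW.
  rewrite -E2 ler_pXn2r ?nnegrE ?rnorm_ge0 //.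
  by apply: le_trans kb; exact: rnorm_ge0.
have := le_trans (lerD Q (lexx _)) T; rlra.
Qed.

Lemma slice_schwarz_pick (m : C) : disc m -> schwarz_pick (fun z => phi (z, m)).
Proof.
move=> md z z' zd zd'; apply: le_trans (slice_schwarz_pick_strict md zd zd').
rewrite lerDl; apply: mulr_ge0 (sqr_ge0 _) _; apply: mulr_ge0 (sqr_ge0 _) _.
exact: mulr_ge0 (sqr_ge0 _) (sqr_ge0 _).
Qed.

(** * Fixed points of the slices *)

Lemma fixed_diag (a m : C) : disc a -> disc m -> phi (a, m) = a ->
  (1 - rnorm a ^+ 2) * (1 - a1 (a, m) ^+ 2) = (1 - rnorm m ^+ 2) * a2 (a, m) ^+ 2.
Proof.
by move=> ad md fa; have := model_diag_pair ad md; rewrite fa; rlra.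
Qed.

Lemma fixed_a1_le1 (a m : C) : disc a -> disc m -> phi (a, m) = a -> a1 (a, m) <= 1.
Proof.
move=> ad md fa; have E := fixed_diag ad md fa.
rewrite -(@ler_pXn2r _ 2) ?nnegrE ?rnorm_ge0 // expr1n -subr_ge0.
rewrite -(pmulr_rge0 _ (disc_sqr_gt0 ad)) E mulr_ge0 ?sqr_ge0 // ltW //.
exact: disc_sqr_gt0.
Qed.

Lemma fixed_a1_eq1 (a m : C) : disc a -> disc m -> phi (a, m) = a -> 1 <= a1 (a, m) ->
  p2 (u (a, m)) = 0.
Proof.
move=> ad md fa h; have E := fixed_diag ad md fa.
apply: rnorm_eq0; apply/eqP; rewrite -sqrf_eq0 eq_le sqr_ge0 andbT.
rewrite -(pmulr_rle0 _ (disc_sqr_gt0 md)) -E pmulr_rle0 ?disc_sqr_gt0 // subr_le0.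
by rewrite -[leLHS](expr1n R 2) ler_pXn2r ?nnegrE ?rnorm_ge0.
Qed.

(** At a fixed point without second component the model kernel reduces to its first
    term, which forces all slices to contract towards the same point. *)
Lemma common_fixed_point (a m n : C) : disc a -> disc m -> disc n ->
  phi (a, m) = a -> p2 (u (a, m)) = 0 -> phi (a, n) = a.
Proof.
move=> ad md nd fa u2.
have kb := kernel_bound_pair ad nd ad md; rewrite u2 rnorm0 !mulr0 addr0 fa in kb.
have A0 := disc_sqr_gt0 ad; have N0 := disc_sqr_gt0 nd.
have x1 := fixed_a1_le1 ad md fa.
have aa : rnorm (1 - a * a^*) = 1 - rnorm a ^+ 2.
  by rewrite conjM_rnorm -toC1 -toCB rnorm_toC gtr0_norm.
rewrite aa in kb.
have E := one_sub_sqr (phi (a, n)) a; have M := model_diag_pair ad nd.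
have X0 := rnorm_ge0 (p1 (u (a, n))).
have k2 : rnorm (1 - phi (a, n) * a^*) ^+ 2 <= ((1 - rnorm a ^+ 2) * a1 (a, n)) ^+ 2.
  rewrite ler_pXn2r ?nnegrE ?rnorm_ge0 ?mulr_ge0 ?(ltW A0) //.
  apply: le_trans kb _; apply: ler_wpM2l; first exact: ltW.
  by rewrite -[leRHS]mulr1; apply: ler_wpM2l.
rewrite E exprMn in k2.
have k3 : (1 - rnorm a ^+ 2) * ((1 - rnorm a ^+ 2) * a1 (a, n) ^+ 2) <=
    (1 - rnorm a ^+ 2) * (1 - rnorm (phi (a, n)) ^+ 2).
  by apply: ler_wpM2l; [exact: ltW|rewrite M lerDl mulr_ge0 ?sqr_ge0 // ltW].
apply: mod_eq; apply/eqP; rewrite -sqrf_eq0 eq_le sqr_ge0 andbT; rlra.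
Qed.

(** At two fixed points the model identity is
    (1 - a conj(b)) (1 - <u1, u1'>) = (1 - m conj(n)) <u2, u2'>. *)
Lemma fixed_schwarz_pick (a b m n : C) : disc a -> disc b -> disc m -> disc n ->
  phi (a, m) = a -> phi (b, n) = b -> p2 (u (a, m)) <> 0 -> p2 (u (b, n)) <> 0 ->
  rnorm (a - b) ^+ 2 * ((1 - rnorm m ^+ 2) * (1 - rnorm n ^+ 2)) <=
  rnorm (m - n) ^+ 2 * ((1 - rnorm a ^+ 2) * (1 - rnorm b ^+ 2)).
Proof.
move=> ad bd md nd fa fb ua ub.
have Fa := disc_sqr_gt0 ad; have Fb := disc_sqr_gt0 bd.
have Gm := disc_sqr_gt0 md; have Gn := disc_sqr_gt0 nd.
have xa : a1 (a, m) < 1.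
  by rewrite ltNge; apply/negP => /(fixed_a1_eq1 ad md fa).
have xb : a1 (b, n) < 1.
  by rewrite ltNge; apply/negP => /(fixed_a1_eq1 bd nd fb).
have Xa := rnorm_ge0 (p1 (u (a, m))); have Xb := rnorm_ge0 (p1 (u (b, n))).
have Ya := rnorm_ge0 (p2 (u (a, m))); have Yb := rnorm_ge0 (p2 (u (b, n))).
have Da := fixed_diag ad md fa; have Db := fixed_diag bd nd fb.
have kb := kernel_bound_pair ad md bd nd; rewrite fa fb in kb.
set p := rnorm (1 - m * n^*) in kb; set q := rnorm (1 - a * b^*) in kb.
have p0 : 0 <= p := rnorm_ge0 _; have q0 : 0 <= q := rnorm_ge0 _.
have Ep : p ^+ 2 = _ := one_sub_sqr m n; have Eq : q ^+ 2 = _ := one_sub_sqr a b.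
have xx1 : 0 < 1 - a1 (a, m) * a1 (b, n).
  rewrite subr_gt0; apply: le_lt_trans xb; rewrite ler_piMl //; exact: ltW.
have k1 : q * (1 - a1 (a, m) * a1 (b, n)) <= p * (a2 (a, m) * a2 (b, n)) by rlra.
have k2 : (q * (1 - a1 (a, m) * a1 (b, n))) ^+ 2 <= (p * (a2 (a, m) * a2 (b, n))) ^+ 2.
  by rewrite ler_pXn2r ?nnegrE ?mulr_ge0 // ltW.
have k3 : (1 - a1 (a, m) ^+ 2) * (1 - a1 (b, n) ^+ 2) <= (1 - a1 (a, m) * a1 (b, n)) ^+ 2.
  by have := sqr_ge0 (a1 (a, m) - a1 (b, n)); rlra.
suff : q ^+ 2 * ((1 - rnorm m ^+ 2) * (1 - rnorm n ^+ 2)) <=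
       p ^+ 2 * ((1 - rnorm a ^+ 2) * (1 - rnorm b ^+ 2)) by rewrite Ep Eq; rlra.
have XX : 0 < (1 - a1 (a, m) * a1 (b, n)) ^+ 2 by rewrite exprn_gt0.
rewrite -(ler_pM2r XX).
have GG : 0 <= (1 - rnorm m ^+ 2) * (1 - rnorm n ^+ 2) by rewrite mulr_ge0 // ltW.
have FF : 0 <= (1 - rnorm a ^+ 2) * (1 - rnorm b ^+ 2) by rewrite mulr_ge0 // ltW.
apply: (@le_trans _ _ ((p * (a2 (a, m) * a2 (b, n))) ^+ 2 *
    ((1 - rnorm m ^+ 2) * (1 - rnorm n ^+ 2)))).
  by apply: le_trans (ler_wpM2r GG k2); rewrite le_eqVlt; apply/orP; left; apply/eqP; ring.
have -> : (p * (a2 (a, m) * a2 (b, n))) ^+ 2 * ((1 - rnorm m ^+ 2) * (1 - rnorm n ^+ 2)) =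
   p ^+ 2 * (((1 - rnorm m ^+ 2) * a2 (a, m) ^+ 2) * ((1 - rnorm n ^+ 2) * a2 (b, n) ^+ 2)).
  by ring.
rewrite -Da -Db -[leRHS]mulrA; apply: ler_wpM2l; first exact: sqr_ge0.
by apply: le_trans (ler_wpM2l FF k3); rewrite le_eqVlt; apply/orP; left; apply/eqP; ring.
Qed.

Lemma fixed_point_unique (a b m : C) : disc a -> disc b -> disc m ->
  phi (a, m) = a -> phi (b, m) = b -> p2 (u (a, m)) <> 0 -> p2 (u (b, m)) <> 0 -> a = b.
Proof.
move=> ad bd md fa fb ua ub; have := fixed_schwarz_pick ad bd md md fa fb ua ub.
rewrite subrr rnorm0 expr0n /= mul0r pmulr_lle0; last by rewrite mulr_gt0 ?disc_sqr_gt0.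
by move=> h; apply: mod_eq; apply/eqP; rewrite -sqrf_eq0 eq_le h sqr_ge0.
Qed.

(** Were the derivative 1, the strict Schwarz-Pick inequality between a and a + s would
    fail to leading order as s -> 0. *)
Lemma slice_derivative_neq1 (a m : C) : disc a -> disc m -> phi (a, m) = a ->
  p2 (u (a, m)) <> 0 -> 'd phi ((a, m) : C * C) ((1, 0) : C * C) <> 1.
Proof.
move=> ad md fa ua al1.
have lb := pair_bidisc ad md.
have dphi : differentiable phi ((a, m) : C * C) := phi_holo.1 _ lb.
have du : differentiable u ((a, m) : C * C) := model_holo model lb.
have B0 := disc_sqr_gt0 ad; have c0 := disc_sqr_gt0 md.
have y0 : 0 < a2 (a, m).
  rewrite lt_def rnorm_ge0 andbT; apply/negP => /eqP h; apply: ua; exact: rnorm_eq0.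
have an1 : rnorm a < 1 := ad.
set B := 1 - rnorm a ^+ 2 in B0; set c := 1 - rnorm m ^+ 2 in c0.
set y := a2 (a, m) in y0.
have [Q Q0 QE] : exists2 Q : R, 0 <= Q &
    Q = 6 * B + c ^+ 2 * (2 * y ^+ 2 * y).
  exists (6 * B + c ^+ 2 * (2 * y ^+ 2 * y)) => //.
  by rewrite !addr_ge0 // ?mulr_ge0 // ?exprn_ge0 // ltW.
suff : c ^+ 2 * (y ^+ 2 * y ^+ 2) <= 0.
  by apply/negP; rewrite -ltNge !mulr_gt0 // exprn_gt0.
apply: (@ler_eps _ _ _ Q Q0) => e00 e000; rewrite add0r.
have [e [e0 ee e1]] : exists e, [/\ 0 < e, e <= e00 & e <= 1].
  by exists (Num.min e00 1); rewrite lt_min e000 ltr01 !ge_min !lexx orbT.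
have [d1 d10 d1P] := differentiable_eps dphi e0.
have [d2 d20 d2P] := differentiable_continuous_eps dphi e0.
have [d3 d30 d3P] := differentiable_continuous_eps du e0.
have q0 : 0 < 1 - rnorm a by rewrite subr_gt0.
have : all (fun r => 0 < r) [:: d1; d2; d3; e; 1 - rnorm a].
  by rewrite /= d10 d20 d30 e0 q0.
move=> /exists_small [s s0 /= /and5P[k1 k2 k3 k4 /andP[k5 _]]].
pose z : C := toC s + a.
have sN : rnorm (toC s) = s by rewrite rnorm_toC gtr0_norm.
have zn : rnorm z <= s + rnorm a by rewrite -sN; exact: modD.
have zd : disc z by apply: le_lt_trans zn _; rewrite -ltrBrDr.
have za : z - a = toC s by rewrite /z addrK.
pose h : C * C := (toC s, 0).
have hN : rnorm h = s.
  rewrite pair_max; have -> : rnorm h.1 = s := sN.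
  by have -> : rnorm h.2 = 0 := mod0; apply/max_idPl; exact: ltW.
have hz : h + (a, m) = (z, m) :> C * C.
  by rewrite /h /z; congr pair; rewrite add0r.
have hz' : ((z, m) : C * C) - (a, m) = h by rewrite -hz addrK.
have D1 := d1P h; rewrite hN hz in D1.
have {}D1 : rnorm (phi (z, m) - (phi (a, m) + 'd phi ((a, m) : C * C) h)) <= e * s.
  exact: D1 k1.
have dh : 'd phi ((a, m) : C * C) h = toC s.
  have -> : h = toC s *: ((1, 0) : C * C).
    by rewrite /h; congr pair; [exact: esym (mulr1 _)|exact: esym (mulr0 _)].
  by rewrite linearZ al1; exact: mulr1.
rewrite dh fa in D1.
have D2 : rnorm (phi (z, m) - phi (a, m)) < e by apply: d2P; rewrite hz' hN.
rewrite fa in D2.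
have D3 : rnorm (p2 (u (z, m)) - p2 (u (a, m))) < e.
  rewrite -(proj1B hd'); apply: le_lt_trans (rnorm_proj1_le hd' _) _.
  by apply: d3P; rewrite hz' hN.
have SP := slice_schwarz_pick_strict md zd ad.
rewrite fa za sN -/B -/c -/y in SP.
have N1 : (1 - e) * s <= rnorm (phi (z, m) - a).
  have E : (phi (z, m) - a) - (phi (z, m) - (a + toC s)) = toC s by ring.
  have T := modB (phi (z, m) - a) (phi (z, m) - (a + toC s)); rewrite E sN in T.
  rlra.
have N2 : ((1 - e) * s) ^+ 2 <= rnorm (phi (z, m) - a) ^+ 2.
  by rewrite ler_pXn2r ?nnegrE ?rnorm_ge0 // mulr_ge0 ?subr_ge0 // ltW.
have A1 : B - 2 * e <= 1 - rnorm z ^+ 2.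
  have Z0 := rnorm_ge0 z; have z1 : rnorm z < 1 := zd; have a0 := rnorm_ge0 a.
  have za' : rnorm z - rnorm a <= e by rewrite lerBlDr; apply: le_trans zn _; rewrite lerD2r ltW.
  have : rnorm z ^+ 2 - rnorm a ^+ 2 <= 2 * e.
    exact: (sqr_sub_le Z0 (ltW z1) a0 (ltW an1) (ltW e0) za').
  by rewrite /B; rlra.
have F1 : 1 - rnorm (phi (z, m)) ^+ 2 <= B + 2 * e.
  have Z0 := rnorm_ge0 (phi (z, m)); have a0 := rnorm_ge0 a.
  have z1 : rnorm (phi (z, m)) < 1 := phi_lt1 (pair_bidisc zd md).
  have T := mod_lerB a (phi (z, m)); rewrite mod_subC in T.
  have : rnorm a ^+ 2 - rnorm (phi (z, m)) ^+ 2 <= 2 * e.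
    exact: (sqr_sub_le a0 (ltW an1) Z0 (ltW z1) (ltW e0) (le_trans T (ltW D2))).
  by rewrite /B; rlra.
have Y1 : y ^+ 2 - 2 * y * e <= a2 (z, m) ^+ 2.
  have T := vec_lerB (p2 (u (a, m))) (p2 (u (z, m))); rewrite vec_subC -/y in T.
  have Y0 := rnorm_ge0 (p2 (u (z, m))).
  have T2 : y - e <= a2 (z, m) by rlra.
  have [le|gt] := lerP y e.
    apply: (@le_trans _ _ 0); last exact: sqr_ge0.
    have := ler_wpM2l (ltW y0) le; have := mulr_gt0 y0 e0; rlra.
  apply: (@le_trans _ _ ((y - e) ^+ 2)); first by have := sqr_ge0 e; rlra.
  by rewrite ler_pXn2r ?nnegrE // subr_ge0 ltW.
have A0 := disc_sqr_gt0 zd; set A := 1 - rnorm z ^+ 2 in A0 A1 SP.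
have A1' : A <= 1 by rewrite /A gerBl sqr_ge0.
set F := 1 - rnorm (phi (z, m)) ^+ 2 in F1 SP.
have AB0 : 0 < A * B by rewrite mulr_gt0.
have G1 := ler_wpM2r (ltW AB0) N2.
have G3 : B ^+ 2 - 4 * e * B <= (1 - e) ^+ 2 * (A * B).
  have h1 := ler_wpM2r (ltW B0) A1; have h2 := ler_wpM2r (mulr_ge0 (ltW e0) (ltW B0)) A1'.
  have h3 : 0 <= e ^+ 2 * (A * B) by rewrite mulr_ge0 ?sqr_ge0 // ltW.
  rlra.
have G4 : (1 - e) ^+ 2 * (A * B) + c ^+ 2 * (a2 (z, m) ^+ 2 * y ^+ 2) <= F * B.
  have s20 : 0 < s ^+ 2 by rewrite exprn_gt0.
  rewrite -(ler_pM2l s20); apply: le_trans SP; apply: le_trans (lerD G1 (lexx _)).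
  by rewrite le_eqVlt; apply/orP; left; apply/eqP; ring.
have G5 := ler_wpM2r (ltW B0) F1.
have G6 : c ^+ 2 * ((y ^+ 2 - 2 * y * e) * y ^+ 2) <= c ^+ 2 * (a2 (z, m) ^+ 2 * y ^+ 2).
  by apply: ler_wpM2l; [exact: sqr_ge0|exact: (ler_wpM2r (sqr_ge0 y) Y1)].
apply: le_trans (ler_wpM2l Q0 ee); rewrite QE.
have G7 := mulr_gt0 e0 B0.
move: (a2 (z, m)) G4 G6 => v G4 G6; rlra.
Qed.

(** If u2 = 0 at (a, m), the identity between two fixed points forces <u1, u1'> = 1, which
    |u1'| < 1 excludes. *)
Lemma fixed_u2_eq0 (a b m n : C) : disc a -> disc b -> disc m -> disc n ->
  phi (a, m) = a -> phi (b, n) = b -> p2 (u (a, m)) = 0 -> p2 (u (b, n)) = 0.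
Proof.
move=> ad bd md nd fa fb ua; apply: contrapT => ub.
have xb : a1 (b, n) < 1 by rewrite ltNge; apply/negP => /(fixed_a1_eq1 bd nd fb).
have Xb := rnorm_ge0 (p1 (u (b, n))); have Xa := rnorm_ge0 (p1 (u (a, m))).
have xa := fixed_a1_le1 ad md fa.
have kb := kernel_bound_pair ad md bd nd.
rewrite fa fb ua rnorm0 mul0r mulr0 addr0 in kb.
have q0 : 0 < rnorm (1 - a * b^*).
  rewrite lt_def rnorm_ge0 andbT; apply/negP => /eqP q0.
  suff : 0 < 0 :> R by rewrite ltxx.
  have := one_sub_sqr a b; rewrite q0 (expr2 0) mul0r.
  have := mulr_gt0 (disc_sqr_gt0 ad) (disc_sqr_gt0 bd).
  have := sqr_ge0 (rnorm (a - b)); rlra.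
have : a1 (a, m) * a1 (b, n) < 1.
  by apply: le_lt_trans xb; rewrite ler_piMl.
by rewrite -(ltr_pM2l q0) mulr1 => /(le_lt_trans kb); rewrite ltxx.
Qed.

(** Nonvanishing of the second component is what makes the slices strictly contracting
    at their fixed points. *)
Definition fixed_branch (xi : C -> C) := forall m : C, disc m ->
  [/\ disc (xi m), phi (xi m, m) = xi m & p2 (u (xi m, m)) <> 0].

Lemma fixed_branch_unique xi (a m : C) : fixed_branch xi -> disc a -> disc m ->
  phi (a, m) = a -> xi m = a.
Proof.
move=> fb ad md fa; have [bd fb' ub] := fb m md.
by apply: (fixed_point_unique bd ad md fb' fa ub) => ua; apply: ub; exact: fixed_u2_eq0 ua.
Qed.

Lemma fixed_branch_schwarz_pick xi : fixed_branch xi -> schwarz_pick xi.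
Proof.
move=> fb m n md nd; have [ad fa ua] := fb m md; have [bd fb' ub] := fb n nd.
exact: fixed_schwarz_pick.
Qed.

(** Implicit differentiation: xi is locally Lipschitz by Schwarz-Pick, and the partial
    derivative of phi along the slice differs from 1 at the fixed point. *)
Lemma fixed_branch_holomorphic xi : fixed_branch xi -> holo_into_disc xi.
Proof.
move=> fb; split; last by move=> m md; have [] := fb m md.
move=> m md; have [ad fa ua] := fb m md.
have dphi : differentiable phi ((xi m, m) : C * C) := phi_holo.1 _ (pair_bidisc ad md).
pose al := 'd phi ((xi m, m) : C * C) ((1, 0) : C * C).
pose be := 'd phi ((xi m, m) : C * C) ((0, 1) : C * C).
have al1 : al <> 1 by exact: slice_derivative_neq1.
have al1' : 1 - al != 0 by rewrite subr_eq0; apply/eqP => h; apply: al1.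
have N0 : 0 < rnorm (1 - al).
  rewrite lt_def rnorm_ge0 andbT; apply/negP => /eqP /rnorm_eq0 h.
  by move: al1'; rewrite h eqxx.
have lin (h k : C) : 'd phi ((xi m, m) : C * C) ((h, k) : C * C) = h * al + k * be.
  have -> : ((h, k) : C * C) = h *: ((1, 0) : C * C) + k *: ((0, 1) : C * C).
    congr pair.
      by transitivity (h * 1 + k * 0); [rewrite mulr1 mulr0 addr0|].
    by transitivity (h * 0 + k * 1); [rewrite mulr1 mulr0 add0r|].
  by rewrite linearD !linearZ.
have m1 : rnorm m < 1 := md.
pose s : R := (1 + rnorm m) / 2.
have s0 : 0 <= s by rewrite /s; have := rnorm_ge0 m; rlra.
have s1 : s < 1 by rewrite /s; rlra.
have ms : rnorm m <= s by rewrite /s; rlra.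
have S0 : 0 < 1 - s ^+ 2 by rewrite subr_gt0 expr_lt1.
have S1 : 1 - s ^+ 2 <= 1 by rewrite gerBl sqr_ge0.
have xid z : disc z -> disc (xi z) by move=> zd; have [] := fb z zd.
apply/derivable1_diffP; rewrite /derivable; apply/cvg_ex; exists (be / (1 - al)).
apply/cvg_rnorm => e e0.
have e'0 : 0 < e * ((1 - s ^+ 2) * rnorm (1 - al)) / 2.
  by rewrite divr_gt0 // !mulr_gt0.
have [d d0 dP] := differentiable_eps dphi e'0.
have m0 : 0 < Num.min (d * (1 - s ^+ 2)) (s - rnorm m).
  by rewrite lt_min mulr_gt0 //= subr_gt0 /s; rlra.
suff core (h : C) : rnorm h < Num.min (d * (1 - s ^+ 2)) (s - rnorm m) -> h != 0 ->
    rnorm (h^-1 * (xi (h + m) - xi m) - be / (1 - al)) < e.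
  apply/nbhs_rnorm; exists (Num.min (d * (1 - s ^+ 2)) (s - rnorm m)) => // h.
  rewrite subr0 => hl h0; have -> : (xi \o shift m) (h *: (1 : C)) = xi ((h : C) + m).
    by congr (xi (_ + _)); exact: mulr1.
  exact: core.
rewrite lt_min => /andP[hl hs] h0.
have h00 : 0 < rnorm h.
  by rewrite lt_def rnorm_ge0 andbT; apply/negP => /eqP /rnorm_eq0 hh; move/eqP: h0.
pose n : C := h + m.
have nm : n - m = h by rewrite /n addrK.
have ns : rnorm n <= s by have := modD h m; rewrite -/n; rlra.
have nd : disc n := le_lt_trans ns s1.
have [bd fb' ub] := fb n nd.
pose D := xi n - xi m.
have L : (1 - s ^+ 2) * rnorm D <= rnorm h.
  rewrite -nm; exact: (schwarz_pick_lipschitz xid (fixed_branch_schwarz_pick fb) s0 s1 ns ms).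
have D0 : 0 <= rnorm D := rnorm_ge0 _.
pose k : C * C := (D, h).
have kE : k + (xi m, m) = (xi n, n) :> C * C by rewrite /k /D /n; congr pair; rewrite subrK.
have kN : (1 - s ^+ 2) * rnorm k <= rnorm h.
  rewrite pair_max; have [le|gt] := lerP (rnorm k.1) (rnorm k.2).
    by rewrite ler_piMl // ltW.
  exact: L.
have kd : rnorm k < d by rewrite -(ltr_pM2l S0) [X in _ < X]mulrC; exact: le_lt_trans kN hl.
have E := dP k kd; rewrite kE fa fb' lin in E.
have -> : h^-1 * (xi (h + m) - xi m) - be / (1 - al) =
   (h * (1 - al))^-1 * (xi n - (xi m + (D * al + h * be))).
  rewrite -/n -/D.
  have -> : xi n - (xi m + (D * al + h * be)) = D * (1 - al) - h * be by rewrite /D; ring.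
  by field; rewrite h0 al1'.
rewrite rnormM rnormV rnormM mulrC ltr_pdivrMr ?mulr_gt0 //.
apply: le_lt_trans E _.
rewrite mulrAC ltr_pdivrMr // -!mulrA ltr_pM2l //.
have : (1 - s ^+ 2) * rnorm k * rnorm (1 - al) <= rnorm h * rnorm (1 - al).
  by apply: ler_wpM2r kN; exact: rnorm_ge0.
have := mulr_gt0 h00 N0; rlra.
Qed.

(** * The model near a boundary point *)

Variable tau : C * C.
Hypotheses (tau1 : circle tau.1) (tau2 : circle tau.2).

Let tau_sphere : unit_sphere tau := torus_sphere tau1 tau2.

(** What the kernel leaves of a sequence with bounded quotients tending to tau; w is then
    the value phi(tau). *)
Definition julia_at (w : C) (K : R) := [/\ rnorm w = 1, 0 < K &
  forall m, bidisc m ->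
    rnorm (phi m - w) <= K * (rnorm (m.1 - tau.1) * a1 m + rnorm (m.2 - tau.2) * a2 m)].

Lemma sphere_dist l : 1 - rnorm l <= rnorm (l - tau).
Proof. by rewrite pair_subC -(tau_sphere) pair_lerB. Qed.

(** Let the first argument of the kernel bound run through the sequence, along which the
    model vectors are bounded. *)
Lemma julia_of_seq (w : C) (B : R) :
  (forall e : R, 0 < e -> exists l, [/\ bidisc l, rnorm (l - tau) < e,
     julia_quotient phi l <= B & rnorm (phi l - w) < e]) ->
  exists K, julia_at w K.
Proof.
move=> Hl.
have B0 : 0 <= B.
  have [l [lb _ lq _]] := Hl 1 ltr01; apply: le_trans lq; apply: divr_ge0.
    by rewrite subr_ge0 ltW // phi_lt1.
  by rewrite subr_ge0 ltW.
have w1 : rnorm w = 1.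
  apply/eqP; rewrite eq_le; apply/andP; split.
    apply: (@ler_eps _ _ _ 1) => // e e0; have [l [lb ll lq lw]] := Hl e e0.
    have := mod_lerB w (phi l); rewrite mod_subC; have := phi_lt1 lb; rlra.
  apply: (@ler_eps _ _ _ (1 + B)); first rlra.
  move=> e e0; have [l [lb ll lq lw]] := Hl e e0.
  have := mod_lerB (phi l) w; have := sphere_dist l.
  move: lq; rewrite /julia_quotient ler_pdivrMr ?subr_gt0 // => lq h1 h2.
  have : B * (1 - rnorm l) <= B * e by apply: ler_wpM2l => //; rlra.
  rlra.
exists (2 * B + 1); split => //; first rlra.
move=> m mb; apply: (@ler_eps _ _ _ (1 + (2 * B + 1) * (a1 m + a2 m))).
  by rewrite addr_ge0 ?mulr_ge0 ?addr_ge0 ?rnorm_ge0 //; rlra.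
move=> e e0; have [l [lb ll lq lw]] := Hl e e0.
have uB := u_quotient_bound lb lq.
have ul1 : a1 l <= 2 * B + 1 by have := sqr_ge0 (a2 l); have := sqr_ge0 (a1 l - 1); rnra.
have ul2 : a2 l <= 2 * B + 1 by have := sqr_ge0 (a1 l); have := sqr_ge0 (a2 l - 1); rnra.
have := kernel_bound lb mb.
have hp : rnorm (phi m - w) <= rnorm (1 - phi l * (phi m)^*) + e.
  rewrite -(rnorm_1sub_conj _ w1).
  have -> : 1 - w * (phi m)^* = (1 - phi l * (phi m)^*) + (phi l - w) * (phi m)^* by ring.
  apply: le_trans (modD _ _) _; rewrite lerD2l rnormM rnorm_conj.
  have := phi_lt1 mb; have := rnorm_ge0 (phi m); have := rnorm_ge0 (phi l - w); rnra.
have d1 : rnorm (1 - l.1 * (m.1)^*) <= rnorm (m.1 - tau.1) + e.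
  rewrite -(rnorm_1sub_conj _ tau1).
  have -> : 1 - l.1 * (m.1)^* = (1 - tau.1 * (m.1)^*) + (tau.1 - l.1) * (m.1)^* by ring.
  apply: le_trans (modD _ _) _; rewrite lerD2l rnormM rnorm_conj.
  have := (bidiscP m).1 mb; have := pair_fstB l tau; have := rnorm_ge0 m.1.
  by rewrite (mod_subC tau.1) /=; have := rnorm_ge0 (l.1 - tau.1) => ? ? ? [? ?]; rnra.
have d2 : rnorm (1 - l.2 * (m.2)^*) <= rnorm (m.2 - tau.2) + e.
  rewrite -(rnorm_1sub_conj _ tau2).
  have -> : 1 - l.2 * (m.2)^* = (1 - tau.2 * (m.2)^*) + (tau.2 - l.2) * (m.2)^* by ring.
  apply: le_trans (modD _ _) _; rewrite lerD2l rnormM rnorm_conj.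
  have := (bidiscP m).1 mb; have := pair_sndB l tau; have := rnorm_ge0 m.2.
  by rewrite (mod_subC tau.2) /=; have := rnorm_ge0 (l.2 - tau.2) => ? ? ? [? ?]; rnra.
have m10 := rnorm_ge0 (p1 (u m)); have m20 := rnorm_ge0 (p2 (u m)).
have l10 := rnorm_ge0 (p1 (u l)); have l20 := rnorm_ge0 (p2 (u l)).
have t1 : rnorm (1 - l.1 * (m.1)^*) * (a1 l * a1 m) <=
   (rnorm (m.1 - tau.1) + e) * ((2 * B + 1) * a1 m).
  by apply: ler_pM => //; rewrite ?rnorm_ge0 ?mulr_ge0 //; apply: ler_wpM2r.
have t2 : rnorm (1 - l.2 * (m.2)^*) * (a2 l * a2 m) <=
   (rnorm (m.2 - tau.2) + e) * ((2 * B + 1) * a2 m).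
  by apply: ler_pM => //; rewrite ?rnorm_ge0 ?mulr_ge0 //; apply: ler_wpM2r.
move=> kb; apply: le_trans hp _.
apply: (@le_trans _ _ ((rnorm (m.1 - tau.1) + e) * ((2 * B + 1) * a1 m) +
  (rnorm (m.2 - tau.2) + e) * ((2 * B + 1) * a2 m) + e)); first rlra.
by rewrite le_eqVlt; apply/orP; left; apply/eqP; ring.
Qed.

(** The segment along which the derivative in the direction (tau1, M tau2) is taken. *)
Definition line (M t : R) : C * C := (tau.1 * toC (1 - t), tau.2 * toC (1 - M * t)).

Lemma line_facts (M t : R) : 0 < M -> 0 < t -> t < 1 -> M * t < 1 ->
  [/\ rnorm (line M t).1 = 1 - t /\ rnorm (line M t).2 = 1 - M * t,
      rnorm ((line M t).1 - tau.1) = t /\ rnorm ((line M t).2 - tau.2) = M * t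
    & bidisc (line M t)].
Proof.
move=> M0 t0 t1 Mt1; have Mt0 : 0 < M * t by exact: mulr_gt0.
have N (z : C) (s : R) : circle z -> 0 < s -> s < 1 ->
    rnorm (z * toC (1 - s)) = 1 - s /\ rnorm (z * toC (1 - s) - z) = s.
  move=> z1 s0 s1; rewrite rnormM z1 mul1r rnorm_toC ger0_norm; last by rlra.
  split=> //; have -> : z * toC (1 - s) - z = - (z * toC s) by rewrite toCB toC1; ring.
  by rewrite modN rnormM z1 mul1r rnorm_toC gtr0_norm.
have [n1 n2] := N _ _ tau1 t0 t1; have [n3 n4] := N _ _ tau2 Mt0 Mt1.
split; [by []|by []|apply/bidiscP; split].
  by rewrite n1 ltrBlDr ltrDl.
by rewrite n3 ltrBlDr ltrDl.
Qed.

Lemma line_nt (M t : R) : 0 < M -> 0 < t -> t < 1 -> M * t < 1 ->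
  rnorm (line M t - tau) <= (1 + M) * t /\
  rnorm (line M t - tau) <= (1 + M) ^+ 2 / M * (1 - rnorm (line M t)).
Proof.
move=> M0 t0 t1 Mt1; have [[n1 n2] [n3 n4] lb] := line_facts M0 t0 t1 Mt1.
have Mt0 : 0 < M * t by exact: mulr_gt0.
have D : rnorm (line M t - tau) <= (1 + M) * t.
  by rewrite pair_maxB n3 n4 ge_max; apply/andP; split; rlra.
split=> //; apply: le_trans D _.
have Mp : 0 < 1 + M by rlra.
suff : t * (M / (1 + M)) <= 1 - rnorm (line M t).
  move=> /(ler_wpM2l (_ : 0 <= (1 + M) ^+ 2 / M)) h; apply: le_trans (h _).
    by rewrite le_eqVlt; apply/orP; left; apply/eqP; field; rewrite !gt_eqF.
  by rewrite divr_ge0 ?exprn_ge0 // ltW.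
rewrite lerBrDr -lerBrDl pair_max n1 n2 ge_max.
have h1 : M / (1 + M) <= 1 by rewrite ler_pdivrMr //; rlra.
have h2 : M / (1 + M) <= M by rewrite ler_pdivrMr //; rnra.
have h3 : t * (M / (1 + M)) <= t * 1 by apply: ler_wpM2l; [exact: ltW|].
have h4 : t * (M / (1 + M)) <= t * M by apply: ler_wpM2l; [exact: ltW|].
by apply/andP; split; rlra.
Qed.

Section JuliaAt.
Variables (w : C) (K : R).
Hypothesis jw : julia_at w K.

Let w1 : rnorm w = 1. Proof. by case: jw. Qed.

Let K0 : 0 < K. Proof. by case: jw. Qed.

(** On approach regions the diagonal of the model gives (1 - |l|) |u|^2 <= 2 |phi - w| and
    the inequality at w gives |phi - w| <= K |l - tau| (|u1| + |u2|); together they bound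
    u. *)
Lemma julia_nt_bound l (c : R) : bidisc l -> 0 < c ->
  rnorm (l - tau) <= c * (1 - rnorm l) ->
  a1 l + a2 l <= 4 * K * c /\ rnorm (phi l - w) <= 4 * K ^+ 2 * c * rnorm (l - tau).
Proof.
move=> lb c0 lc; have [_ _ /(_ l lb) J] := jw.
have l1 : rnorm l < 1 by exact: lb.
have A10 := rnorm_ge0 (p1 (u l)); have A20 := rnorm_ge0 (p2 (u l)).
have L0 : 0 <= rnorm (l - tau) := rnorm_ge0 _.
have D1 : rnorm (l.1 - tau.1) <= rnorm (l - tau) := pair_fstB l tau.
have D2 : rnorm (l.2 - tau.2) <= rnorm (l - tau) := pair_sndB l tau.
have P1 : rnorm (phi l) < 1 := phi_lt1 lb.
have P2 : 1 - rnorm (phi l) <= rnorm (phi l - w).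
  by rewrite mod_subC -{1}w1 mod_lerB.
have P3 := u_le lb.
have S1 : rnorm (phi l - w) <= K * (rnorm (l - tau) * (a1 l + a2 l)).
  apply: le_trans J _; apply: ler_wpM2l; first exact: ltW.
  by rewrite mulrDr; apply: lerD; apply: ler_wpM2r.
have P0 : 0 <= rnorm (phi l) := rnorm_ge0 _.
have S2 : (1 - rnorm l) * (a1 l ^+ 2 + a2 l ^+ 2) <= 2 * rnorm (phi l - w).
  apply: le_trans P3 _; rnra.
have S3 : a1 l ^+ 2 + a2 l ^+ 2 <= 2 * K * c * (a1 l + a2 l).
  suff : (1 - rnorm l) * (a1 l ^+ 2 + a2 l ^+ 2) <=
         (1 - rnorm l) * (2 * K * c * (a1 l + a2 l)) by rewrite ler_pM2l ?subr_gt0.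
  apply: le_trans S2 _.
  have : rnorm (l - tau) * (a1 l + a2 l) <= c * (1 - rnorm l) * (a1 l + a2 l).
    by apply: ler_wpM2r lc; exact: addr_ge0.
  move=> /(ler_wpM2l (ltW K0)); rlra.
have S4 : a1 l + a2 l <= 4 * K * c.
  apply: ler_of_sqr_le; first by rewrite !mulr_ge0 ?ltW.
  have := sqr_ge0 (a1 l - a2 l); rlra.
split => //; apply: le_trans S1 _.
have : rnorm (l - tau) * (a1 l + a2 l) <= rnorm (l - tau) * (4 * K * c).
  exact: ler_wpM2l.
by move=> /(ler_wpM2l (ltW K0)); rlra.
Qed.

Lemma julia_nt_limit : nt_limit phi tau w.
Proof.
apply/nt_limitP => // c e c0 e0.
have q0 : 0 < 4 * K ^+ 2 * c by rewrite !mulr_gt0 // exprn_gt0.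
exists (e / (4 * K ^+ 2 * c)); first exact: divr_gt0.
move=> l lb lc ld; rewrite pair_subC in lc.
have [_ h] := julia_nt_bound lb c0 lc.
by apply: le_lt_trans h _; rewrite mulrC -ltr_pdivlMr.
Qed.

(** The sequences in the definition of Y_tau may be tangential.  Their points l are
    compared with the point of the diagonal segment at the distance of l from tau. *)
Lemma julia_quotient_limit (B : R) : exists2 Q : R, 0 < Q & forall l, bidisc l ->
  julia_quotient phi l <= B -> rnorm (l - tau) < 1 ->
  rnorm (phi l - w) <= Q * rnorm (l - tau).
Proof.
exists (32 * K * (1 + 4 * `|B|) + 16 * K ^+ 2).
  have := normr_ge0 B; have : 0 < K ^+ 2 by rewrite exprn_gt0.
  have := mulr_gt0 K0 ltr01 => ? ? ?; have := mulr_ge0 (ltW K0) (normr_ge0 B); rlra.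
move=> l lb lq ld.
have l1 : rnorm l < 1 by exact: lb.
have uB := u_quotient_bound lb lq.
have A10 := rnorm_ge0 (p1 (u l)); have A20 := rnorm_ge0 (p2 (u l)).
have UB : a1 l + a2 l <= 1 + 4 * `|B|.
  have : (a1 l + a2 l) ^+ 2 <= 4 * `|B|.
    have := ler_norm B; have := sqr_ge0 (a1 l - a2 l); rlra.
  have := normr_ge0 B; rnra.
set s := rnorm (l - tau).
have s0 : 0 < s by apply: lt_le_trans (sphere_dist l); rewrite subr_gt0.
have s1 : 1 * s < 1 by rewrite mul1r; exact: ld.
clear lq.
have [[n1 n2] [n3 n4] mb] := line_facts ltr01 s0 ld s1.
have [_ mc] := line_nt ltr01 s0 ld s1.
set m := line 1 s in n1 n2 n3 n4 mb mc.
rewrite mul1r in n2 n4.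
have c4 : 0 < (1 + 1 : R) ^+ 2 / 1 by rlra.
have ms : rnorm (m - tau) = s by rewrite pair_maxB n3 n4 maxxx.
have [m12 mw] := julia_nt_bound mb c4 mc; rewrite ms in mw.
have B10 := rnorm_ge0 (p1 (u m)); have B20 := rnorm_ge0 (p2 (u m)).
have D1 : rnorm (1 - l.1 * (m.1)^*) <= 2 * s.
  have -> : 1 - l.1 * (m.1)^* = (1 - tau.1 * (m.1)^*) + (tau.1 - l.1) * (m.1)^* by ring.
  apply: le_trans (modD _ _) _; rewrite (rnorm_1sub_conj _ tau1) n3 rnormM rnorm_conj n1.
  have := pair_fstB l tau; rewrite -/s mod_subC; have := rnorm_ge0 (tau.1 - l.1); rnra.
have D2 : rnorm (1 - l.2 * (m.2)^*) <= 2 * s.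
  have -> : 1 - l.2 * (m.2)^* = (1 - tau.2 * (m.2)^*) + (tau.2 - l.2) * (m.2)^* by ring.
  apply: le_trans (modD _ _) _; rewrite (rnorm_1sub_conj _ tau2) n4 rnormM rnorm_conj n2.
  have := pair_sndB l tau; rewrite -/s mod_subC; have := rnorm_ge0 (tau.2 - l.2); rnra.
have kb := kernel_bound lb mb.
have t1 : rnorm (1 - l.1 * (m.1)^*) * (a1 l * a1 m) <= 2 * s * (a1 l * a1 m).
  by apply: ler_wpM2r => //; exact: mulr_ge0.
have t2 : rnorm (1 - l.2 * (m.2)^*) * (a2 l * a2 m) <= 2 * s * (a2 l * a2 m).
  by apply: ler_wpM2r => //; exact: mulr_ge0.
have t3 : 2 * s * (a1 l * a1 m) + 2 * s * (a2 l * a2 m) <=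
    2 * s * ((1 + 4 * `|B|) * (4 * K * ((1 + 1) ^+ 2 / 1))).
  rewrite -mulrDr; apply: ler_wpM2l; first by rewrite mulr_ge0 // ltW.
  apply: (@le_trans _ _ ((a1 l + a2 l) * (a1 m + a2 m))).
    by have := mulr_ge0 A10 B20; have := mulr_ge0 A20 B10; rlra.
  by apply: ler_pM => //; exact: addr_ge0.
have -> : rnorm (phi l - w) = rnorm (1 - phi l * w^*).
  by rewrite -(rnorm_1sub_conj _ w1) -rnorm_conj rmorphB rmorph1 rmorphM /= conjCK mulrC.
have -> : 1 - phi l * w^* = (1 - phi l * (phi m)^*) + phi l * (phi m - w)^*.
  by rewrite rmorphB; ring.
apply: le_trans (modD _ _) _; rewrite rnormM rnorm_conj.
have P : rnorm (phi l) * rnorm (phi m - w) <= rnorm (phi m - w).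
  by rewrite ler_piMl ?rnorm_ge0 ?ltW ?phi_lt1.
rlra.
Qed.

(** * Directional derivatives as slopes *)

Definition weighted_sq (M : R) x : R := rnorm (p1 x) ^+ 2 + M * rnorm (p2 x) ^+ 2.

Lemma weighted_sq_ge0 M x : 0 <= M -> 0 <= weighted_sq M x.
Proof. by move=> M0; apply: addr_ge0; [|apply: mulr_ge0 => //]; exact: sqr_ge0. Qed.

Lemma one_sub_line (z : C) (s t : R) : circle z ->
  1 - (z * toC (1 - t)) * (z * toC (1 - s))^* = toC (t + s - t * s).
Proof.
move=> z1; have zz : z * z^* = 1 by rewrite conjM_rnorm z1 expr1n.
rewrite rmorphM /= conj_toC !toCB toCD toC1 toCM.
transitivity (1 - (z * z^*) * ((1 - toC t) * (1 - toC s))); first by ring.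
by rewrite zz; ring.
Qed.

Lemma one_sub_end (z : C) (s : R) : circle z -> 1 - z * (z * toC (1 - s))^* = toC s.
Proof.
by move=> z1; have := @one_sub_line z s 0 z1; rewrite subr0 toC1 mulr1 add0r mul0r subr0.
Qed.

(** [x] is the norm limit of the model along the segment, and phi has there the
    derivative -w (|x1|^2 + M |x2|^2) in the direction -(tau1, M tau2). *)
Definition line_vector (M : R) x :=
  (forall e : R, 0 < e -> exists2 d, 0 < d & forall t, 0 < t -> t < d ->
    rnorm (u (line M t) - x) < e) /\
  (forall e : R, 0 < e -> exists2 d, 0 < d & forall t, 0 < t -> t < d ->
    rnorm (1 - w^* * phi (line M t) - toC (t * weighted_sq M x)) <= e * t).

(** For x = p1 u + sqrt M p2 u the kernel along the segment is (t + s) <x t, x s> + O(ts),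
    which is the situation of the radial limit. *)
Lemma line_limit (M : R) : 0 < M -> exists x, line_vector M x.
Proof.
move=> M0; pose q := Num.sqrt M.
have q0 : 0 < q by rewrite sqrtr_gt0.
have qq : q ^+ 2 = M by rewrite sqr_sqrtr // ltW.
have [c c0 cE] : exists2 c, 0 < c & (1 + M) ^+ 2 / M = c.
  by eexists; last by []; rewrite divr_gt0 // exprn_gt0 // addr_gt0.
pose K1 := 4 * K * c; pose K2 := 4 * K ^+ 2 * c * (1 + M).
have K10 : 0 <= K1 by apply: mulr_ge0 (ltW c0); apply: mulr_ge0 (ltW K0).
have K20 : 0 <= K2.
  apply: mulr_ge0; last by rewrite addr_ge0 // ltW.
  by apply: mulr_ge0 (ltW c0); apply: mulr_ge0 (sqr_ge0 K).
pose K3 := K1 * (1 + q) + K2 + (K1 ^+ 2 + M ^+ 2 * K1 ^+ 2) + 1.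
have K30 : 0 < K3.
  have g1 : 0 <= K1 * (1 + q) by rewrite mulr_ge0 // addr_ge0 // ltW.
  have g2 : 0 <= K1 ^+ 2 + M ^+ 2 * K1 ^+ 2 by rewrite -exprMn addr_ge0 ?sqr_ge0.
  rewrite /K3; rlra.
pose d0 := Num.min 1 M^-1.
have d00 : 0 < d0 by rewrite /d0; rewrite lt_min ltr01 invr_gt0.
have dP t : 0 < t -> t < d0 -> t < 1 /\ M * t < 1.
  by move=> t0; rewrite lt_min => /andP[-> h]; rewrite mulrC -ltr_pdivlMr ?div1r.
have B t : 0 < t -> t < d0 ->
    [/\ bidisc (line M t), a1 (line M t) + a2 (line M t) <= K1 &
        rnorm (phi (line M t) - w) <= K2 * t].
  move=> t0 /(dP t t0) [t1 Mt1]; have [_ _ lb] := line_facts M0 t0 t1 Mt1.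
  have [h1 h2] := line_nt M0 t0 t1 Mt1; rewrite cE in h2.
  have [h3 h4] := julia_nt_bound lb c0 h2; split => //.
  apply: le_trans h4 _; rewrite /K2 -[leRHS]mulrA; apply: ler_wpM2l h1.
  by apply: mulr_ge0 (ltW c0); apply: mulr_ge0 (sqr_ge0 K).
pose x t := p1 (u (line M t)) + toC q *: p2 (u (line M t)).
have px y z : p1 (p1 y + z *: p2 y) = p1 y /\ p2 (p1 y + z *: p2 y) = z *: p2 y.
  apply: (decomposition_unique hd) => //; first exact: proj1_in hd _.
  have [_ M20 lin2] := closed2 hd.
  by rewrite -[_ *: _]addr0; apply: lin2 => //; exact: proj2_in hd _.
have ipx s t : ip (x t) (x s) = ip (p1 (u (line M t))) (p1 (u (line M s))) +
   toC M * ip (p2 (u (line M t))) (p2 (u (line M s))).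
  rewrite (ip_proj hd) /x !(px _ _).1 !(px _ _).2 ipZl ipZr conj_toC mulrA -toCM.
  by rewrite -expr2 qq.
have f1 t : 0 < t -> t < d0 -> rnorm (phi (line M t)) <= 1.
  by move=> t0 td; have [lb _ _] := B t t0 td; exact: ltW (phi_lt1 lb).
have xK t : 0 < t -> t < d0 -> rnorm (x t) <= K3.
  move=> t0 td; have [_ h _] := B t t0 td; apply: le_trans (vecD _ _) _.
  have hZ : rnorm (toC q *: p2 (u (line M t))) = q * a2 (line M t).
    by rewrite rnormZ rnorm_toC gtr0_norm.
  rewrite hZ; have A10 := rnorm_ge0 (p1 (u (line M t))).
  have A20 := rnorm_ge0 (p2 (u (line M t))).
  have g1 : q * a2 (line M t) <= q * K1 by apply: ler_wpM2l; rlra.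
  have g2 : 0 <= K1 ^+ 2 + M ^+ 2 * K1 ^+ 2 by rewrite -exprMn addr_ge0 ?sqr_ge0.
  rewrite /K3; rlra.
have fw t : 0 < t -> t < d0 -> rnorm (phi (line M t) - w) <= K3 * t.
  move=> t0 td; have [_ _ h] := B t t0 td; apply: le_trans h _.
  apply: ler_wpM2r; first exact: ltW.
  have g1 : 0 <= K1 * (1 + q) by rewrite mulr_ge0 // addr_ge0 // ltW.
  have g2 : 0 <= K1 ^+ 2 + M ^+ 2 * K1 ^+ 2 by rewrite -exprMn addr_ge0 ?sqr_ge0.
  rewrite /K3; rlra.
have ker s t : 0 < s -> s < d0 -> 0 < t -> t < d0 ->
   rnorm (1 - phi (line M t) * (phi (line M s))^* - toC (t + s) * ip (x t) (x s))
     <= K3 * t * s.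
  move=> s0 sd t0 td; have [lt ht _] := B t t0 td; have [ls hs _] := B s s0 sd.
  have E1 : 1 - (line M t).1 * ((line M s).1)^* = toC (t + s - t * s).
    exact: one_sub_line tau1.
  have E2 : 1 - (line M t).2 * ((line M s).2)^* = toC (M * t + M * s - M * t * (M * s)).
    exact: one_sub_line tau2.
  rewrite (model_eq model lt ls) ipx E1 E2.
  set g1 := ip _ _; set g2 := ip _ _.
  have -> : toC (t + s - t * s) * g1 + toC (M * t + M * s - M * t * (M * s)) * g2 -
     toC (t + s) * (g1 + toC M * g2) = - (toC (t * s) * (g1 + toC (M ^+ 2) * g2)).
    by rewrite toCX !toCB !toCD !toCM; ring.
  have A10 := rnorm_ge0 (p1 (u (line M t))); have A20 := rnorm_ge0 (p2 (u (line M t))).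
  have B10 := rnorm_ge0 (p1 (u (line M s))); have B20 := rnorm_ge0 (p2 (u (line M s))).
  rewrite modN rnormM rnorm_toC gtr0_norm ?mulr_gt0 // -mulrA mulrC.
  apply: ler_wpM2r; first by rewrite mulr_ge0 // ltW.
  apply: le_trans (modD _ _) _.
  have h1 : rnorm g1 <= K1 ^+ 2.
    apply: le_trans (cauchy_schwarz nip _ _) _; rewrite expr2.
    by apply: ler_pM => //; rlra.
  have h2 : rnorm (toC (M ^+ 2) * g2) <= M ^+ 2 * K1 ^+ 2.
    rewrite rnormM rnorm_toC ger0_norm ?sqr_ge0 //; apply: ler_wpM2l; first exact: sqr_ge0.
    apply: le_trans (cauchy_schwarz nip _ _) _; rewrite expr2.
    by apply: ler_pM => //; rlra.
  have g3 : 0 <= K1 * (1 + q) by rewrite mulr_ge0 // addr_ge0 // ltW.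
  by apply: le_trans (lerD h1 h2) _; rewrite /K3; rlra.
have [y xy yP] := radial_limit nip d00 K30 w1 f1 xK fw ker.
pose z := p1 y + toC q^-1 *: p2 y.
have zE : weighted_sq M z = rnorm y ^+ 2.
  rewrite /weighted_sq (px _ _).1 (px _ _).2 rnormZ rnorm_toC gtr0_norm ?invr_gt0 //.
  by rewrite exprMn exprVn qq mulrA divff ?mul1r ?gt_eqF // (pythagoras hd y).
exists z; split; last by rewrite zE.
move=> e e0; have e'0 : 0 < e / (1 + q^-1) by rewrite divr_gt0 // addr_gt0 ?invr_gt0.
have [d d1 d1P] := (cvg_at_right_rnorm _ _).1 xy _ e'0.
exists d => // t t0 td.
have E : u (line M t) - z = p1 (x t - y) + toC q^-1 *: p2 (x t - y).
  rewrite (proj1B hd) (proj1B hd') scalerBr /x (px _ _).1 (px _ _).2 scalerA -toCM.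
  rewrite mulVf ?gt_eqF // toC1 scale1r /z {1}(proj_sum hd (u (line M t))).
  by rewrite opprD addrACA.
have xe : rnorm (x t - y) < e / (1 + q^-1) := d1P t t0 td.
rewrite E; apply: le_lt_trans (vecD _ _) _.
rewrite rnormZ rnorm_toC gtr0_norm ?invr_gt0 //.
have n1 := rnorm_proj1_le hd (x t - y); have n2 := rnorm_proj1_le hd' (x t - y).
rewrite ltr_pdivlMr ?addr_gt0 ?invr_gt0 // in xe; apply: le_lt_trans xe.
have qi : 0 <= q^-1 by rewrite invr_ge0 ltW.
have := ler_wpM2l qi n2; rlra.
Qed.

(** The model identity with one of its arguments moved to tau. *)
Definition boundary_vector v := forall m, bidisc m ->
  1 - w * (phi m)^* = (1 - tau.1 * (m.1)^*) * ip (p1 v) (p1 (u m)) +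
                      (1 - tau.2 * (m.2)^*) * ip (p2 v) (p2 (u m)).

Lemma cvgn_fun (f : nat -> C) (a : C) :
  (forall e : R, 0 < e -> exists N, forall n, (N <= n)%N -> rnorm (f n - a) < e) ->
  f n @[n --> \oo] --> a.
Proof. by move=> h; apply/cvgn_rnorm. Qed.

Lemma Yset_boundary v : Yset phi ip u tau v -> boundary_vector v.
Proof.
move=> [l [lb lt [B lB] lv]] m mb.
have lt' := (cvgn_rnorm _ _).1 lt.
have l1 : (l n).1 @[n --> \oo] --> tau.1.
  apply: cvgn_fun => e e0; have [N NP] := lt' e e0; exists N => n nN.
  exact: le_lt_trans (pair_fstB _ _) (NP n nN).
have l2 : (l n).2 @[n --> \oo] --> tau.2.
  apply: cvgn_fun => e e0; have [N NP] := lt' e e0; exists N => n nN.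
  exact: le_lt_trans (pair_sndB _ _) (NP n nN).
have [Q Q0 QP] := julia_quotient_limit B.
have phil : phi (l n) @[n --> \oo] --> w.
  apply: cvgn_fun => e e0.
  have e0' : 0 < Num.min (e / Q) 1 by rewrite lt_min ltr01 divr_gt0.
  have [N NP] := lt' _ e0'; exists N => n nN.
  have := NP n nN; rewrite lt_min ltr_pdivlMr // mulrC => /andP[h1 h2].
  exact: le_lt_trans (QP _ (lb n) (lB n) h2) h1.
have v1 : ip (p1 (u (l n))) (p1 (u m)) @[n --> \oo] --> ip (p1 v) (p1 (u m)).
  rewrite -(ip_proj1 hd); under eq_fun do rewrite -(ip_proj1 hd); exact: lv.
have v2 : ip (p2 (u (l n))) (p2 (u m)) @[n --> \oo] --> ip (p2 v) (p2 (u m)).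
  rewrite -(ip_proj1 hd'); under eq_fun do rewrite -(ip_proj1 hd'); exact: lv.
have c1 : 1 - phi (l n) * (phi m)^* @[n --> \oo] --> 1 - w * (phi m)^*.
  by apply: cvgB; [exact: cvg_cst|apply: cvgM phil _; exact: cvg_cst].
have c2 : (1 - (l n).1 * (m.1)^*) * ip (p1 (u (l n))) (p1 (u m)) +
      (1 - (l n).2 * (m.2)^*) * ip (p2 (u (l n))) (p2 (u m)) @[n --> \oo] -->
   (1 - tau.1 * (m.1)^*) * ip (p1 v) (p1 (u m)) +
                      (1 - tau.2 * (m.2)^*) * ip (p2 v) (p2 (u m)).
  have coef (f : nat -> C) (a z : C) : f n @[n --> \oo] --> a ->
      1 - f n * z @[n --> \oo] --> 1 - a * z.
    by move=> fa; apply: cvgB; [exact: cvg_cst|apply: cvgM fa _; exact: cvg_cst].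
  exact: cvgD (cvgM (coef _ _ _ l1) v1) (cvgM (coef _ _ _ l2) v2).
have E : (fun n => 1 - phi (l n) * (phi m)^*) =
  fun n => (1 - (l n).1 * (m.1)^*) * ip (p1 (u (l n))) (p1 (u m)) +
      (1 - (l n).2 * (m.2)^*) * ip (p2 (u (l n))) (p2 (u m)).
  by apply/funext => n; rewrite (model_eq model (lb n) mb).
rewrite E in c1; exact: cvg_unique c1 c2.
Qed.

Lemma Yset_strong v (B : R) :
  (forall e : R, 0 < e -> exists l, [/\ bidisc l, rnorm (l - tau) < e,
     julia_quotient phi l <= B & rnorm (u l - v) < e]) -> Yset phi ip u tau v.
Proof.
move=> h.
have n0 (n : nat) : 0 < n.+1%:R^-1 :> R by rewrite invr_gt0.
have [l lP] := choice (fun n => h _ (n0 n)).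
have small (e : R) : 0 < e -> exists N, forall n, (N <= n)%N -> n.+1%:R^-1 < e.
  move=> e0; have [N _ NP] := near_infty_natSinv_lt (PosNum e0); exists N => n nN.
  exact: NP nN.
exists l; split.
- by move=> n; have [] := lP n.
- apply/cvgn_rnorm => e e0; have [N NP] := small e e0; exists N => n nN.
  by have [_ h1 _ _] := lP n; exact: lt_trans h1 (NP n nN).
- by exists B => n; have [] := lP n.
move=> y; apply: cvgn_fun => e e0.
have y0 : 0 < rnorm y + 1 by rewrite ltr_wpDl ?rnorm_ge0.
have [N NP] := small (e / (rnorm y + 1)) (divr_gt0 e0 y0); exists N => n nN.
have [_ _ _ h1] := lP n; have h2 := lt_trans h1 (NP n nN).
rewrite -ipNl -ipDl; apply: le_lt_trans (cauchy_schwarz nip _ _) _.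
rewrite ltr_pdivlMr // in h2; apply: le_lt_trans h2.
by apply: ler_wpM2l; [exact: rnorm_ge0|rewrite lerDl].
Qed.

Section LineVectors.
Variable X : R -> H.
Hypothesis XP : forall M, 0 < M -> line_vector M (X M).

(** Minus the derivative of phi / w at tau in the direction -(tau1, M tau2). *)
Definition slope (M : R) : R := weighted_sq M (X M).
Local Notation al := slope.

Lemma line_small (M e : R) : 0 < M -> 0 < e -> exists t,
  [/\ 0 < t, t < 1, M * t < 1, t < e & (1 + M) * t < e].
Proof.
move=> M0 e0; have Mp : 0 < 1 + M by rewrite addr_gt0.
have : all (fun r => 0 < r) [:: 1; M^-1; e; e / (1 + M)].
  by rewrite /= ltr01 invr_gt0 M0 e0 divr_gt0.
move=> /exists_small [t t0 /= /and5P[h1 h2 h3 h4 _]]; exists t; split => //.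
  by rewrite mulrC -ltr_pdivlMr ?div1r.
by rewrite mulrC -ltr_pdivlMr.
Qed.

Lemma line_approx (M e : R) : 0 < M -> 0 < e -> exists t,
  [/\ 0 < t, bidisc (line M t), rnorm (line M t - tau) < e,
      julia_quotient phi (line M t) <= (al M + e) / Num.min 1 M &
      rnorm (u (line M t) - X M) < e /\
      rnorm (1 - w^* * phi (line M t) - toC (t * al M)) <= e * t].
Proof.
move=> M0 e0; have [uX phiX] := XP M0.
have [d1 d10 d1P] := uX e e0; have [d2 d20 d2P] := phiX e e0.
have m0 : 0 < Num.min (Num.min d1 d2) e by rewrite !lt_min d10 d20 e0.
have [t [t0 t1 Mt1]] := line_small M0 m0.
rewrite !lt_min => /andP[/andP[td1 td2] te] /andP[_ Mte].
have [[n1 n2] _ lb] := line_facts M0 t0 t1 Mt1.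
exists t; split => //; last by split; [exact: d1P|exact: d2P].
  by have [h _] := line_nt M0 t0 t1 Mt1; exact: le_lt_trans h Mte.
have E : 1 - rnorm (line M t) = Num.min 1 M * t.
  by rewrite pair_max n1 n2 /Num.max /Num.min; case: ltrP => h; case: ltrP => h'; rnra.
have q0 : 0 < Num.min 1 M * t by rewrite mulr_gt0 // lt_min ltr01.
rewrite /julia_quotient E ler_pdivrMr // mulrA divfK; last first.
  by rewrite gt_eqF // lt_min ltr01.
have P := d2P t t0 td2.
have N : rnorm (toC (t * al M)) = t * al M.
  by rewrite rnorm_toC ger0_norm // mulr_ge0 ?weighted_sq_ge0 // ltW.
have T : rnorm (1 - w^* * phi (line M t)) <= e * t + t * al M.
  rewrite -N -[1 - _](subrK (toC (t * al M))).
  by apply: le_trans (modD _ _) _; rewrite lerD2r.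
have D : 1 - rnorm (phi (line M t)) <= rnorm (1 - w^* * phi (line M t)).
  by apply: le_trans (mod_lerB _ _); rewrite rnorm1 rnormM rnorm_conj w1 mul1r.
apply: le_trans D (le_trans T _); rlra.
Qed.

Lemma line_vector_Yset (M : R) : 0 < M -> Yset phi ip u tau (X M).
Proof.
move=> M0; apply: (@Yset_strong _ ((al M + 1) / Num.min 1 M)) => e e0.
have e'0 : 0 < Num.min e 1 by rewrite lt_min e0 ltr01.
have [t [t0 lb lt lq [lu _]]] := line_approx M0 e'0; exists (line M t); split => //.
- by apply: lt_le_trans lt _; rewrite ge_min lexx.
- apply: le_trans lq _; apply: ler_wpM2r; last by rewrite lerD2l ge_min lexx orbT.
  by rewrite invr_ge0 le_min ler01 ltW.
- by apply: lt_le_trans lu _; rewrite ge_min lexx.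
Qed.

(** Boundary vectors pair with the vectors of the segments like the model with itself:
    evaluate the boundary identity on the segment, divide by the parameter and let it
    tend to 0. *)
Lemma boundary_pairing v (M : R) : boundary_vector v -> 0 < M ->
  ip (p1 v) (p1 (X M)) + toC M * ip (p2 v) (p2 (X M)) = toC (al M).
Proof.
move=> bv M0; apply: mod_eq; apply/eqP; rewrite eq_le rnorm_ge0 andbT.
apply: (@ler_eps _ _ _ (rnorm (p1 v) + M * rnorm (p2 v) + 1)).
  by rewrite !addr_ge0 ?mulr_ge0 ?rnorm_ge0 // ltW.
move=> e e0; rewrite add0r.
have [t [t0 lb _ _ [lu lphi]]] := line_approx M0 e0.
have E1 : 1 - tau.1 * ((line M t).1)^* = toC t.
  exact: one_sub_end.
have E2 : 1 - tau.2 * ((line M t).2)^* = toC (M * t).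
  exact: one_sub_end.
have B := bv _ lb; rewrite E1 E2 in B.
set g1 := ip (p1 v) (p1 (u (line M t))) in B; set g2 := ip (p2 v) (p2 (u (line M t))) in B.
have n1 : rnorm (ip (p1 v) (p1 (X M)) - g1) <= rnorm (p1 v) * e.
  rewrite /g1 -ipNr -ipDr -(proj1B hd); apply: le_trans (cauchy_schwarz nip _ _) _.
  apply: ler_wpM2l; first exact: rnorm_ge0.
  by apply: le_trans (rnorm_proj1_le hd _) _; rewrite vec_subC ltW.
have n2 : rnorm (ip (p2 v) (p2 (X M)) - g2) <= rnorm (p2 v) * e.
  rewrite /g2 -ipNr -ipDr -(proj1B hd'); apply: le_trans (cauchy_schwarz nip _ _) _.
  apply: ler_wpM2l; first exact: rnorm_ge0.
  by apply: le_trans (rnorm_proj1_le hd' _) _; rewrite vec_subC ltW.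
have n3 : rnorm (g1 + toC M * g2 - toC (al M)) <= e.
  suff : t * rnorm (g1 + toC M * g2 - toC (al M)) <= t * e by rewrite ler_pM2l.
  rewrite (mulrC t e); apply: le_trans lphi.
  rewrite -rnorm_conj -[X in X * _ <= _]gtr0_norm // -rnorm_toC -rnormM.
  rewrite !rmorphB rmorphM rmorph1 /= conjCK conj_toC B.
  by rewrite !toCM le_eqVlt; apply/orP; left; apply/eqP; congr rnorm; ring.
have -> : ip (p1 v) (p1 (X M)) + toC M * ip (p2 v) (p2 (X M)) - toC (al M) =
  (ip (p1 v) (p1 (X M)) - g1) + toC M * (ip (p2 v) (p2 (X M)) - g2) +
   (g1 + toC M * g2 - toC (al M)) by ring.
apply: le_trans (modD _ _) _; apply: le_trans (lerD (modD _ _) n3) _.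
rewrite rnormM rnorm_toC gtr0_norm //.
by apply: le_trans (lerD (lerD n1 (ler_wpM2l (ltW M0) n2)) (lexx e)) _; rlra.
Qed.

Lemma boundary_pairing_Re v (M : R) : boundary_vector v -> 0 < M ->
  complex.Re (ip (p1 v) (p1 (X M))) + M * complex.Re (ip (p2 v) (p2 (X M))) = al M.
Proof.
move=> bv M0; have := congr1 (@complex.Re R) (boundary_pairing bv M0).
by rewrite Re_toC cReD Re_toCM.
Qed.

(** Pythagoras: [X M] has the least weighted norm among all boundary vectors. *)
Lemma weighted_sqB v (M : R) : boundary_vector v -> 0 < M ->
  weighted_sq M (v - X M) = weighted_sq M v - al M.
Proof.
move=> bv M0; have := boundary_pairing_Re bv M0.
rewrite /slope /weighted_sq (proj1B hd) (proj1B hd') !(rnorm_sqrB nip); rlra.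
Qed.

Lemma slope_le_weighted v (M : R) : boundary_vector v -> 0 < M -> al M <= weighted_sq M v.
Proof.
by move=> bv M0; rewrite -subr_ge0 -weighted_sqB // weighted_sq_ge0 // ltW.
Qed.

Lemma line_vector_boundary (M : R) : 0 < M -> boundary_vector (X M).
Proof. by move=> M0; apply: Yset_boundary; exact: line_vector_Yset. Qed.

(** The affine function N |-> weighted_sq N (X M) bounds the slope and touches it at M, so
    that the slope is concave. *)
Lemma slope_tangent (M N : R) : 0 < M -> 0 < N ->
  al N <= al M + (N - M) * rnorm (p2 (X M)) ^+ 2.
Proof.
move=> M0 N0; apply: le_trans (slope_le_weighted (line_vector_boundary M0) N0) _.
rewrite /slope /weighted_sq; rlra.
Qed.

Lemma slope_mono (M N : R) : 0 < M -> M <= N -> al M <= al N.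
Proof.
move=> M0 MN; have N0 := lt_le_trans M0 MN.
have := slope_tangent N0 M0; have : 0 <= (N - M) * rnorm (p2 (X N)) ^+ 2.
  by rewrite mulr_ge0 ?sqr_ge0 // subr_ge0.
rlra.
Qed.

Lemma slope_const (A M : R) : 0 < A -> 0 < M -> p2 (X A) = 0 -> al M = al A.
Proof.
move=> A0 M0 xA.
have := boundary_pairing_Re (line_vector_boundary A0) M0.
have := boundary_pairing_Re (line_vector_boundary M0) A0.
by rewrite xA linear0l linear0r (Re_ipC _ (p1 (X M))) !mulr0 !addr0 => -> ->.
Qed.

(** Equality leaves no room for |p2 (X B)|^2 in the tangent at B. *)
Lemma slope_eq_const (A B : R) : 0 < A -> A < B -> al A = al B ->
  forall M, 0 < M -> al M = al B.
Proof.
move=> A0 AB AB' M M0; have B0 := lt_trans A0 AB; apply: slope_const => //.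
have := slope_tangent B0 A0; rewrite AB' => h.
apply: rnorm_eq0; apply/eqP; rewrite -sqrf_eq0 eq_le sqr_ge0 andbT.
have : 0 < B - A by rewrite subr_gt0.
by move=> BA; rewrite -(ler_pM2l BA) mulr0; rlra.
Qed.

Lemma slope_deriv_mono (M N : R) : 0 < M -> M < N ->
  rnorm (p2 (X N)) ^+ 2 <= rnorm (p2 (X M)) ^+ 2.
Proof.
move=> M0 MN; have N0 := lt_trans M0 MN.
have NM : 0 < N - M by rewrite subr_gt0.
rewrite -(ler_pM2l NM); have := slope_tangent M0 N0; have := slope_tangent N0 M0; rlra.
Qed.

(** The tangents bound the increments of the slope, so that the supremum of the set where
    it is at most 1 has slope 1. *)
Lemma slope_ivt (a b : R) : 0 < a -> al a <= 1 -> 0 < b -> 1 < al b ->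
  exists2 A, a <= A & al A = 1.
Proof.
move=> a0 la b0 lb.
pose S := [set M : R | a <= M /\ al M <= 1].
have Sb : ubound S b.
  move=> M [aM lM]; rewrite leNgt; apply/negP => bM.
  by have := slope_mono b0 (ltW bM); rlra.
have hS : has_sup S by split; [exists a|exists b].
have aA : a <= sup S by apply: ub_le_sup; [exact: hS.2|].
have A0 := lt_le_trans a0 aA; have supS M : S M -> M <= sup S.
  by move=> SM; apply: ub_le_sup => //; exact: hS.2.
have supS' (e : R) : 0 < e -> exists M, [/\ S M, sup S - e < M & M <= sup S].
  move=> e0; have [M SM MA] := sup_adherent e0 hS.
  by exists M; split => //; exact: supS.
move: (sup S) => A in aA A0 supS supS' *.
exists A => //; apply/eqP; rewrite eq_le; apply/andP; split.
  rewrite leNgt; apply/negP => lA.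
  have A2 : 0 < A / 2 by rlra.
  have [c c0 cE] : exists2 c, 0 < c & rnorm (p2 (X (A / 2))) ^+ 2 <= c.
    exists (rnorm (p2 (X (A / 2))) ^+ 2 + 1); first by rewrite ltr_wpDl ?sqr_ge0.
    by rewrite lerDl.
  have q0 : 0 < (al A - 1) / c by rewrite divr_gt0 // subr_gt0.
  have m0 : 0 < Num.min ((al A - 1) / c) (A / 2) by rewrite lt_min q0 A2.
  have [M [[aM lM] AM MA]] := supS' _ m0.
  have Am : A - M < Num.min ((al A - 1) / c) (A / 2) by rlra.
  move: Am; rewrite lt_min ltr_pdivlMr // => /andP[h1 h2].
  have M0 := lt_le_trans a0 aM.
  have A2M : A / 2 < M by rlra.
  have t := slope_tangent M0 A0; have d := slope_deriv_mono A2 A2M.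
  have : (A - M) * rnorm (p2 (X M)) ^+ 2 <= (A - M) * c.
    by apply: ler_wpM2l; [rewrite subr_ge0|exact: le_trans d cE].
  rlra.
rewrite leNgt; apply/negP => lA.
have c0 : 0 < rnorm (p2 (X A)) ^+ 2 + 1 by rewrite ltr_wpDl ?sqr_ge0.
pose q := (1 - al A) / (rnorm (p2 (X A)) ^+ 2 + 1).
have q0 : 0 < q by rewrite divr_gt0 // subr_gt0.
have Aq0 : 0 < A + q by rewrite addr_gt0.
have : A + q <= A; last by rewrite gerDl leNgt q0.
apply: supS; split; first by rewrite (le_trans aA) // lerDl ltW.
apply: le_trans (slope_tangent A0 Aq0) _.
have E : q * (rnorm (p2 (X A)) ^+ 2 + 1) = 1 - al A by rewrite /q divfK // gt_eqF.
have -> : A + q - A = q by ring.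
clearbody q; rlra.
Qed.

(** If the slope never exceeds 1 it has a finite limit, so that its increments control
    the differences of the vectors [X M] as M grows: they converge in norm, and the
    limit has no second component because M |p2 (X M)|^2 stays below 1. *)
Lemma typeI_of_slope_le1 : (forall M, 0 < M -> al M <= 1) ->
  exists v, [/\ Yset phi ip u tau v, rnorm (p1 v) <= 1 & p2 v = 0].
Proof.
move=> l1.
pose x (n : nat) := X n.+1%:R.
have n0 (n : nat) : 0 < n.+1%:R :> R by [].
have inc : nondecreasing_seq (fun n : nat => al n.+1%:R).
  by move=> m n mn; apply: slope_mono => //; rewrite ler_nat ltnS.
have ub : has_ubound (range (fun n : nat => al n.+1%:R)).
  by exists 1 => _ [n _ <-]; exact: l1.
have cv := nondecreasing_cvgn inc ub.
have le_sup n : al n.+1%:R <= sup (range (fun n : nat => al n.+1%:R)).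
  by apply: ub_le_sup => //; exists n.
move: (sup _) => S in cv le_sup.
have dist (m n : nat) : (m <= n)%N -> rnorm (x n - x m) ^+ 2 <= al n.+1%:R - al m.+1%:R.
  move=> mn; have mn' : m.+1%:R <= n.+1%:R :> R by rewrite ler_nat ltnS.
  have W := weighted_sqB (line_vector_boundary (n0 n)) (n0 m).
  have W2 : rnorm (x n - x m) ^+ 2 <= weighted_sq m.+1%:R (x n - x m).
    rewrite (pythagoras hd (x n - x m)) /weighted_sq lerD2l ler_peMl ?sqr_ge0 //.
    by rewrite ler1n.
  apply: le_trans W2 _; rewrite W lerD2r /slope /weighted_sq lerD2l.
  by apply: ler_wpM2r => //; exact: sqr_ge0.
have [y xy] : exists y : H, x n @[n --> \oo] --> y.
  apply: complete_cvg => e e0.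
  have e20 : 0 < e ^+ 2 by rewrite exprn_gt0.
  have /cvgrPdist_lt /(_ _ e20) [N _ NP] := cv.
  exists (x N); exists N => // n /= nN.
  have := NP N (leqnn N); rewrite /= ger0_norm ?subr_ge0 // => h1.
  have h2 := dist N n nN; have h3 := le_sup n.
  rewrite -(@ltr_pXn2r _ 2) ?nnegrE ?rnorm_ge0 ?(ltW e0) //.
  by apply: le_lt_trans h2 _; apply: le_lt_trans h1; rewrite lerD2r.
have xy' := (cvgn_rnorm _ _).1 xy.
have small (e : R) : 0 < e -> exists n : nat, n.+1%:R^-1 < e /\ rnorm (x n - y) < e.
  move=> e0; have [N NP] := xy' e e0.
  have [N2 _ N2P] := near_infty_natSinv_lt (PosNum e0).
  exists (maxn N N2); split; first exact: N2P (leq_maxr _ _).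
  exact: NP (leq_maxl _ _).
have sq_le n : rnorm (p1 (x n)) ^+ 2 + n.+1%:R * rnorm (p2 (x n)) ^+ 2 <= 1 := l1 _ (n0 n).
exists y; split.
- apply: (@Yset_strong _ 2) => e e0.
  have e2 : 0 < e / 2 by rlra.
  have [n [_ xn]] := small _ e2.
  have m0 : 0 < Num.min (e / 2) 1 by rewrite lt_min e2 ltr01.
  have [t [t0 lb lt lq [lu _]]] := line_approx (n0 n) m0.
  have me : Num.min (e / 2) 1 <= e / 2 by rewrite ge_min lexx.
  have m1 : Num.min (e / 2) 1 <= 1 by rewrite ge_min lexx orbT.
  exists (line n.+1%:R t); split => //.
  + by apply: lt_trans lt _; rlra.
  + apply: le_trans lq _; rewrite (_ : Num.min 1 _ = 1) ?divr1; last first.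
      by apply/min_idPl; rewrite ler1n.
    by apply: lerD m1; exact: l1.
  apply: le_lt_trans (vec_tri (x n) _ _) _.
  have xn' : rnorm (x n - y) < e / 2 := xn.
  have lu' : rnorm (u (line n.+1%:R t) - x n) < Num.min (e / 2) 1 := lu.
  rlra.
- apply: (@ler_eps _ _ _ 1) => // e e0; have [n [_ xn]] := small e e0.
  have h1 : rnorm (p1 (x n)) <= 1.
    rewrite -(@ler_pXn2r _ 2) ?nnegrE ?rnorm_ge0 // expr1n.
    by apply: le_trans (sq_le n); rewrite lerDl mulr_ge0 ?sqr_ge0.
  have h2 : rnorm (p1 (x n - y)) < e := le_lt_trans (rnorm_proj1_le hd _) xn.
  rewrite (proj1B hd) in h2; have := vec_lerB (p1 y) (p1 (x n)).
  by rewrite vec_subC; rlra.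
apply: rnorm_eq0; apply/eqP; rewrite eq_le rnorm_ge0 andbT.
apply: (@ler_eps _ _ _ 2) => // e e0; rewrite add0r.
have m0 : 0 < Num.min e (e ^+ 2) by rewrite lt_min e0 exprn_gt0.
have [n [ne xn]] := small _ m0.
have h1 : rnorm (p2 (x n)) <= e.
  rewrite -(@ler_pXn2r _ 2) ?nnegrE ?rnorm_ge0 ?(ltW e0) //.
  apply: (@le_trans _ _ n.+1%:R^-1); last first.
    by apply: ltW; apply: lt_le_trans ne _; rewrite ge_min lexx orbT.
  rewrite -[_^-1]mul1r ler_pdivlMr // mulrC; apply: le_trans (sq_le n).
  by rewrite lerDr sqr_ge0.
have h2 : rnorm (p2 (x n - y)) < e.
  apply: (le_lt_trans (rnorm_proj1_le hd' _)); apply: lt_le_trans xn _.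
  by rewrite ge_min lexx.
rewrite (proj1B hd') in h2; have := vec_lerB (p2 y) (p2 (x n)).
by rewrite vec_subC; rlra.
Qed.

(** The first coordinate dominates: the boundary inequality of a Type I point. *)
Definition dominated := forall m, bidisc m ->
  rnorm (phi m - w) <= rnorm (m.1 - tau.1) * a1 m.

Lemma dominated_of_typeI v : Yset phi ip u tau v -> rnorm (p1 v) <= 1 -> p2 v = 0 ->
  dominated.
Proof.
move=> /Yset_boundary bv v1 v2 m mb; have := bv m mb.
rewrite v2 linear0l mulr0 addr0 => E.
rewrite -(rnorm_1sub_conj _ w1) E rnormM (rnorm_1sub_conj _ tau1).
apply: ler_wpM2l; first exact: rnorm_ge0.
by apply: le_trans (cauchy_schwarz nip _ _) _; rewrite ler_piMl ?rnorm_ge0.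
Qed.

(** On the segment domination reads al M <= |p1 (X M)|, while |p1 (X M)|^2 <= al M. *)
Lemma slope_le1_of_dominated : dominated -> forall M, 0 < M -> al M <= 1.
Proof.
move=> dom M M0.
have al0 : 0 <= al M by rewrite weighted_sq_ge0 // ltW.
have a1le : rnorm (p1 (X M)) ^+ 2 <= al M.
  by rewrite /slope /weighted_sq lerDl mulr_ge0 ?sqr_ge0 // ltW.
have X0 := rnorm_ge0 (p1 (X M)).
suff : al M <= rnorm (p1 (X M)) by rnra.
apply: (@ler_eps _ _ _ 2) => // e e0.
have [t [t0 lb lt _ [lu lphi]]] := line_approx M0 e0.
have D := dom _ lb.
have N : rnorm ((line M t).1 - tau.1) = t.
  by rewrite -(rnorm_1sub_conj _ tau1) one_sub_end // rnorm_toC gtr0_norm.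
have A : a1 (line M t) <= rnorm (p1 (X M)) + e.
  have h2 : rnorm (p1 (u (line M t) - X M)) < e := le_lt_trans (rnorm_proj1_le hd _) lu.
  rewrite (proj1B hd) in h2; have := vec_lerB (p1 (u (line M t))) (p1 (X M)); rlra.
suff : t * al M <= t * (rnorm (p1 (X M)) + 2 * e) by rewrite ler_pM2l.
have F : t * al M <= rnorm (phi (line M t) - w) + e * t.
  have -> : rnorm (phi (line M t) - w) = rnorm (1 - w^* * phi (line M t)).
    by rewrite -(rnorm_1sub_conj _ w1) -rnorm_conj rmorphB rmorph1 rmorphM /= conjCK.
  have -> : t * al M = rnorm (toC (t * al M)).
    by rewrite rnorm_toC ger0_norm // mulr_ge0 // ltW.
  apply: le_trans (lerD (lexx _) lphi); rewrite -lerBlDl.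
  by apply: le_trans (mod_lerB _ _) _; rewrite mod_subC.
rewrite N in D; have := ler_wpM2l (ltW t0) A; rlra.
Qed.

End LineVectors.

(** * The branch of fixed points at the boundary *)

(** The function phi maps products of horodiscs into horodiscs, with weights
    given by a boundary vector: Cauchy-Schwarz in the boundary identity, then the model
    identity on the diagonal. *)
Lemma boundary_horo v (z m : C) (B b : R) : boundary_vector v -> disc z -> disc m ->
  rnorm (z - tau.1) ^+ 2 <= B * (1 - rnorm z ^+ 2) ->
  rnorm (m - tau.2) ^+ 2 <= b * (1 - rnorm m ^+ 2) ->
  rnorm (phi (z, m) - w) ^+ 2 <=
    (rnorm (p1 v) ^+ 2 * B + rnorm (p2 v) ^+ 2 * b) * (1 - rnorm (phi (z, m)) ^+ 2).
Proof.
move=> bv zd md zB mb; have lb := pair_bidisc zd md.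
have A0 := disc_sqr_gt0 zd; have c0 := disc_sqr_gt0 md.
have N1 : rnorm (1 - tau.1 * z^*) = rnorm (z - tau.1) := rnorm_1sub_conj z tau1.
have N2 : rnorm (1 - tau.2 * m^*) = rnorm (m - tau.2) := rnorm_1sub_conj m tau2.
have B0 : 0 <= B by rewrite -(pmulr_lge0 _ A0); apply: le_trans zB; exact: sqr_ge0.
have b0 : 0 <= b by rewrite -(pmulr_lge0 _ c0); apply: le_trans mb; exact: sqr_ge0.
have k : rnorm (phi (z, m) - w) <= rnorm (z - tau.1) * (rnorm (p1 v) * a1 (z, m)) +
    rnorm (m - tau.2) * (rnorm (p2 v) * a2 (z, m)).
  rewrite -(rnorm_1sub_conj _ w1) (bv _ lb).
  apply: le_trans (modD _ _) _; rewrite !rnormM N1 N2.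
  by apply: lerD; apply: ler_wpM2l; rewrite ?rnorm_ge0 ?(cauchy_schwarz nip).
rewrite (model_diag_pair zd md).
apply: le_trans (_ : _ <= (rnorm (z - tau.1) * (rnorm (p1 v) * a1 (z, m)) +
    rnorm (m - tau.2) * (rnorm (p2 v) * a2 (z, m))) ^+ 2) _.
  rewrite ler_pXn2r ?nnegrE ?rnorm_ge0 //; first by apply: le_trans k; exact: rnorm_ge0.
apply: sqr_sum_le; rewrite ?mulr_ge0 ?sqr_ge0 ?rnorm_ge0 ?(ltW A0) ?(ltW c0) //.
  rewrite !exprMn; have := ler_wpM2r (mulr_ge0 (sqr_ge0 (rnorm (p1 v)))
    (sqr_ge0 (a1 (z, m)))) zB; rlra.
rewrite !exprMn; have := ler_wpM2r (mulr_ge0 (sqr_ge0 (rnorm (p2 v)))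
  (sqr_ge0 (a2 (z, m)))) mb; rlra.
Qed.

Hypothesis wt : w = tau.1.

(** Each slice of phi has a fixed point, unless Wolff's points for that slice give the
    boundary inequality of a Type I point. *)
Lemma fixed_or_dominated v (m : C) : boundary_vector v -> rnorm (p1 v) < 1 -> disc m ->
  (exists2 a, disc a & phi (a, m) = a) \/ dominated.
Proof.
move=> bv v1 md; have c0 := disc_sqr_gt0 md; have m1 : rnorm m < 1 := md.
have v0 := rnorm_ge0 (p1 v).
have g0 : 0 < 1 - rnorm (p1 v) ^+ 2 by rewrite subr_gt0 expr_lt1.
have [b b0 mb] : exists2 b, 0 <= b & rnorm (m - tau.2) ^+ 2 <= b * (1 - rnorm m ^+ 2).
  exists (rnorm (m - tau.2) ^+ 2 / (1 - rnorm m ^+ 2)).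
    by rewrite divr_ge0 ?sqr_ge0 // ltW.
  by rewrite divfK // gt_eqF.
have q0 : 0 <= rnorm (p2 v) ^+ 2 * b by rewrite mulr_ge0 ?sqr_ge0.
have [B B1 BE] : exists2 B, 1 <= B &
    rnorm (p1 v) ^+ 2 * B + rnorm (p2 v) ^+ 2 * b <= B.
  exists ((rnorm (p2 v) ^+ 2 * b) / (1 - rnorm (p1 v) ^+ 2) + 1).
    by rewrite lerDr divr_ge0 // ltW.
  have E : (rnorm (p2 v) ^+ 2 * b) / (1 - rnorm (p1 v) ^+ 2) * (1 - rnorm (p1 v) ^+ 2)
     = rnorm (p2 v) ^+ 2 * b by rewrite divfK // gt_eqF.
  move: (_ / _) E => q E; rlra.
have f_disc (z : C) : disc z -> disc (phi (z, m)).
  by move=> zd; exact: phi_lt1 (pair_bidisc zd md).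
have f_horo (z : C) : disc z -> in_horodisc tau.1 B z -> in_horodisc tau.1 B (phi (z, m)).
  move=> zd zB; have := boundary_horo bv zd md zB mb; rewrite wt => /le_trans; apply.
  by apply: ler_wpM2r BE; exact: ltW (disc_sqr_gt0 (f_disc z zd)).
have [[a ad fa]|W] := wolff_alternative f_disc (slice_schwarz_pick md) tau1 B1 f_horo.
  by left; exists a.
right => n nb; have x0 := rnorm_ge0 (p1 (u n)); have y0 := rnorm_ge0 (p2 (u n)).
have n1 : rnorm (phi n) < 1 := phi_lt1 nb.
have [n11 n21] := (bidiscP n).1 nb.
apply: (@ler_eps _ _ _ (a1 n + 2 * a2 n + 1)); first by rewrite !addr_ge0 ?mulr_ge0.
move=> e e0.
have m0 : 0 < Num.min e ((1 - rnorm m ^+ 2) * e ^+ 2 / 2).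
  by rewrite lt_min e0 divr_gt0 // mulr_gt0 // exprn_gt0.
have [z [zd zt ft zf]] := W _ m0.
move: zt ft; rewrite !lt_min => /andP[zt zt2] /andP[ft _].
have z1 : rnorm z < 1 := zd; have z0 := rnorm_ge0 z.
have A0 := disc_sqr_gt0 zd; have D := model_diag_pair zd md.
have fz : rnorm z ^+ 2 <= rnorm (phi (z, m)) ^+ 2.
  by rewrite ler_pXn2r ?nnegrE ?rnorm_ge0.
have X0 := rnorm_ge0 (p1 (u (z, m))); have Y0 := rnorm_ge0 (p2 (u (z, m))).
have Y20 : 0 <= (1 - rnorm m ^+ 2) * a2 (z, m) ^+ 2 by rewrite mulr_ge0 ?sqr_ge0 // ltW.
have X20 : 0 <= (1 - rnorm z ^+ 2) * a1 (z, m) ^+ 2 by rewrite mulr_ge0 ?sqr_ge0 // ltW.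
have X1 : a1 (z, m) <= 1.
  rewrite -(@ler_pXn2r _ 2) ?nnegrE // expr1n -(ler_pM2l A0); rlra.
have Y1 : a2 (z, m) <= e.
  rewrite -(@ler_pXn2r _ 2) ?nnegrE ?(ltW e0) // -(ler_pM2l c0).
  have t1' : rnorm tau.1 = 1 := tau1.
  have T := mod_lerB tau.1 z; rewrite t1' mod_subC in T.
  have := sqr_ge0 (1 - rnorm z); rlra.
have kb := kernel_bound (pair_bidisc zd md) nb.
have d1 : rnorm (1 - z * (n.1)^*) <= rnorm (n.1 - tau.1) + e.
  rewrite -(rnorm_1sub_conj _ tau1).
  have -> : 1 - z * (n.1)^* = (1 - tau.1 * (n.1)^*) + (z - tau.1) * - (n.1)^* by ring.
  apply: le_trans (modD _ _) _; rewrite lerD2l rnormM modN rnorm_conj.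
  by rewrite -[leRHS]mulr1; apply: ler_pM; rewrite ?rnorm_ge0 // ltW.
have d2 : rnorm (1 - m * (n.2)^*) <= 2.
  apply: le_trans (modB _ _) _; rewrite rnorm1 rnormM rnorm_conj.
  have := ler_pM (rnorm_ge0 m) (rnorm_ge0 n.2) (ltW m1) (ltW n21); rlra.
have d3 : rnorm (phi n - w) <= rnorm (1 - phi (z, m) * (phi n)^*) + e.
  rewrite -(rnorm_1sub_conj _ w1).
  have -> : 1 - w * (phi n)^* = (1 - phi (z, m) * (phi n)^*) + (phi (z, m) - w) * (phi n)^*.
    by ring.
  apply: le_trans (modD _ _) _; rewrite lerD2l rnormM rnorm_conj wt.
  by rewrite -[leRHS]mulr1; apply: ler_pM; rewrite ?rnorm_ge0 // ltW.
have g1 : rnorm (1 - z * (n.1)^*) * (a1 (z, m) * a1 n) <= (rnorm (n.1 - tau.1) + e) * a1 n.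
  by apply: ler_pM; rewrite ?rnorm_ge0 ?mulr_ge0 ?ler_piMl.
have g2 : rnorm (1 - m * (n.2)^*) * (a2 (z, m) * a2 n) <= 2 * (e * a2 n).
  by apply: ler_pM; rewrite ?rnorm_ge0 ?mulr_ge0 //; exact: ler_wpM2r.
apply: le_trans d3 _; apply: le_trans (lerD kb (lexx e)) _.
apply: le_trans (lerD (lerD g1 g2) (lexx e)) _; rlra.
Qed.

Lemma fixed_u2_neq0 v (a m : C) : boundary_vector v -> rnorm (p1 v) < 1 ->
  disc a -> disc m -> phi (a, m) = a -> p2 (u (a, m)) <> 0.
Proof.
move=> bv v1 ad md fa ua.
(* phi fixes a on all slices; as the slice tends to tau2, the horodisc inequality at a
   becomes |a - tau1|^2 <= |p1 v|^2 |a - tau1|^2. *)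
have fa' n : disc n -> phi (a, n) = a by move=> nd; exact: common_fixed_point fa ua.
have A0 := disc_sqr_gt0 ad; have a1' : rnorm a < 1 := ad.
have v0 := rnorm_ge0 (p1 v).
have g0 : 0 < 1 - rnorm (p1 v) ^+ 2 by rewrite subr_gt0 expr_lt1.
have t1' : rnorm tau.1 = 1 := tau1.
have at0 : 0 < rnorm (a - tau.1).
  by have := mod_lerB tau.1 a; rewrite t1' mod_subC; rlra.
suff : (1 - rnorm (p1 v) ^+ 2) * rnorm (a - tau.1) ^+ 2 <= 0.
  by apply/negP; rewrite -ltNge mulr_gt0 // exprn_gt0.
have k0 : 0 <= rnorm (p2 v) ^+ 2 * (1 - rnorm a ^+ 2) by rewrite mulr_ge0 ?sqr_ge0 // ltW.
apply: (@ler_eps _ _ _ _ k0) => e e0; rewrite add0r.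
have [r [r0 re r1]] : exists r, [/\ 0 < r, r <= e & r < 1].
  exists (Num.min e (1 / 2)); rewrite lt_min e0 ge_min lexx gt_min; split=> //.
    by rlra.
  by apply/orP; right; rlra.
have [nd nN nt] := radius_point tau2 r0 r1.
have aB : rnorm (a - tau.1) ^+ 2 <=
    rnorm (a - tau.1) ^+ 2 / (1 - rnorm a ^+ 2) * (1 - rnorm a ^+ 2).
  by rewrite divfK // gt_eqF.
have nb : rnorm (toC (1 - r) * tau.2 - tau.2) ^+ 2 <=
    r * (1 - rnorm (toC (1 - r) * tau.2) ^+ 2).
  rewrite nN nt; have := mulr_ge0 (sqr_ge0 r) (_ : 0 <= 1 - r).
  by rewrite subr_ge0 (ltW r1) => /(_ isT); rlra.
have := boundary_horo bv ad nd aB nb; rewrite wt (fa' _ nd).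
have -> : (rnorm (p1 v) ^+ 2 * (rnorm (a - tau.1) ^+ 2 / (1 - rnorm a ^+ 2)) +
    rnorm (p2 v) ^+ 2 * r) * (1 - rnorm a ^+ 2) =
   rnorm (p1 v) ^+ 2 * rnorm (a - tau.1) ^+ 2 + rnorm (p2 v) ^+ 2 * (1 - rnorm a ^+ 2) * r.
  by field; rewrite gt_eqF.
have := ler_wpM2l k0 re; rlra.
Qed.

Lemma exists_branch v : boundary_vector v -> rnorm (p1 v) < 1 -> ~ dominated ->
  exists xi, fixed_branch xi.
Proof.
move=> bv v1 nd.
have fix_m (m : C) : exists a : C, disc m -> disc a /\ phi (a, m) = a.
  have [md|md] := pselect (disc m); last by exists 0.
  by have [[a ad fa]|] := fixed_or_dominated bv v1 md; [exists a|].
have [xi xiP] := choice fix_m; exists xi => m md; have [ad fa] := xiP m md.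
by split => //; exact: fixed_u2_neq0 bv v1 ad md fa.
Qed.

(** At a fixed point the first term of the horodisc inequality is absorbed by its left
    side. *)
Lemma branch_horo xi v (A : R) : fixed_branch xi -> boundary_vector v -> rnorm (p1 v) < 1 ->
  0 < A -> weighted_sq A v <= 1 -> julia_horo xi tau.1 tau.2 A^-1.
Proof.
move=> fb bv v1 A0 wv m md; have [ad fa _] := fb m md.
have F := disc_sqr_gt0 ad; have G := disc_sqr_gt0 md.
have g0 : 0 < 1 - rnorm (p1 v) ^+ 2 by rewrite subr_gt0 expr_lt1 // rnorm_ge0.
have aB : rnorm (xi m - tau.1) ^+ 2 <=
    rnorm (xi m - tau.1) ^+ 2 / (1 - rnorm (xi m) ^+ 2) * (1 - rnorm (xi m) ^+ 2).
  by rewrite divfK // gt_eqF.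
have mb : rnorm (m - tau.2) ^+ 2 <=
    rnorm (m - tau.2) ^+ 2 / (1 - rnorm m ^+ 2) * (1 - rnorm m ^+ 2).
  by rewrite divfK // gt_eqF.
have := boundary_horo bv ad md aB mb; rewrite wt fa.
set P := rnorm (xi m - tau.1) ^+ 2; set Q := rnorm (m - tau.2) ^+ 2.
move=> h; have {}h := ler_wpM2r (ltW G) h.
have E : (rnorm (p1 v) ^+ 2 * (P / (1 - rnorm (xi m) ^+ 2)) +
      rnorm (p2 v) ^+ 2 * (Q / (1 - rnorm m ^+ 2))) * (1 - rnorm (xi m) ^+ 2) *
      (1 - rnorm m ^+ 2) = rnorm (p1 v) ^+ 2 * (P * (1 - rnorm m ^+ 2)) +
      rnorm (p2 v) ^+ 2 * (Q * (1 - rnorm (xi m) ^+ 2)).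
  by field; rewrite !gt_eqF.
rewrite E in h.
have QF : 0 <= Q * (1 - rnorm (xi m) ^+ 2) by rewrite mulr_ge0 ?sqr_ge0 // ltW.
rewrite -(ler_pM2l (mulr_gt0 A0 g0)).
have -> : A * (1 - rnorm (p1 v) ^+ 2) * (A^-1 * Q * (1 - rnorm (xi m) ^+ 2)) =
    (1 - rnorm (p1 v) ^+ 2) * (Q * (1 - rnorm (xi m) ^+ 2)) by field; rewrite gt_eqF.
have h1 := ler_wpM2l (ltW A0) h.
have h2 : A * rnorm (p2 v) ^+ 2 * (Q * (1 - rnorm (xi m) ^+ 2)) <=
    (1 - rnorm (p1 v) ^+ 2) * (Q * (1 - rnorm (xi m) ^+ 2)).
  by apply: ler_wpM2r => //; rewrite /weighted_sq in wv; rlra.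
rlra.
Qed.

(** At a fixed point domination gives |u1| >= 1, hence u2 = 0. *)
Lemma branch_not_dominated xi : fixed_branch xi -> ~ dominated.
Proof.
move=> fb dom; have d0 : disc (0 : C) by rewrite /disc /unit_ball /= rnorm0 ltr01.
have [ad fa ua] := fb 0 d0; apply: ua; apply: fixed_a1_eq1 => //.
have := dom _ (pair_bidisc ad d0); rewrite fa wt.
have t1' : rnorm tau.1 = 1 := tau1; have a1' : rnorm (xi 0) < 1 := ad.
have at0 : 0 < rnorm (xi 0 - tau.1).
  by have := mod_lerB tau.1 (xi 0); rewrite t1' mod_subC; rlra.
by rewrite -{1}[rnorm (xi 0 - _)]mulr1 ler_pM2l.
Qed.

(** The points of the graph of xi over the radius to tau2 are hyperbolically close to
    the segment of inclination 1/b, so that Schwarz-Pick on the slices transfers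
    phi(xi m, m) = xi m into the value of the derivative along the segment. *)
Lemma slope_of_branch (X : R -> H) xi (b : R) :
  (forall M : R, 0 < M -> line_vector M (X M)) ->
  fixed_branch xi -> 0 < b -> julia_horo xi tau.1 tau.2 b ->
  (b%:E <= julia_liminf xi tau.2)%E -> slope X b^-1 = 1.
Proof.
move=> XP fb b0 J lb; have xid (m : C) : disc m -> disc (xi m) by move=> md; have [] := fb m md.
have A0 : 0 < b^-1 by rewrite invr_gt0.
have al0 : 0 <= slope X b^-1 by rewrite weighted_sq_ge0 // ltW.
have [_ phiX] := XP _ A0.
rewrite -/(slope X b^-1) in phiX; move: (slope X b^-1) al0 phiX => al al0 phiX.
apply/eqP; rewrite -subr_eq0 -normr_eq0 eq_le normr_ge0 andbT -(ler_pM2l b0) mulr0.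
have k0 : 0 <= al + 3 + b by rewrite !addr_ge0 // ltW.
apply: (@ler_eps _ _ _ _ k0) => e00 e000; rewrite add0r.
have [e [e0 ee e1]] : exists e, [/\ 0 < e, e <= e00 & e <= 1].
  by exists (Num.min e00 1); rewrite lt_min e000 ltr01 !ge_min !lexx orbT.
have [d1 d10 d1P] := radial_derivative xid tau1 tau2 (ltW b0) J lb e0.
have [d2 d20 d2P] := phiX e e0.
have : all (fun r => 0 < r) [:: d1; 1; d2 / b; b^-1].
  by rewrite /= d10 ltr01 A0 divr_gt0.
move=> /exists_small [r r0 /= /and5P[k1 k2 k3 k4 _]].
have [t t0 tE] : exists2 t, 0 < t & t = b * r by exists (b * r); first exact: mulr_gt0.
have td2 : t < d2 by rewrite tE mulrC -ltr_pdivlMr.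
have t1 : t < 1 by rewrite tE mulrC -ltr_pdivlMr ?div1r.
have At : b^-1 * t = r by rewrite tE mulKf // gt_eqF.
have At1 : b^-1 * t < 1 by rewrite At.
have [[n1 _] _ lb'] := line_facts A0 t0 t1 At1.
have P := d2P t t0 td2; have Q := d1P r r0 k1 k2; rewrite -tE in Q.
pose z : C := tau.1 * toC (1 - t); pose n : C := toC (1 - r) * tau.2.
have lE : line b^-1 t = (z, n) by rewrite /line At /n [tau.2 * _]mulrC.
have [nd _ _] := radius_point tau2 r0 k2; rewrite -/n in nd Q.
rewrite lE in n1 lb' P.
have zN : rnorm z = 1 - t := n1.
have zd : disc z := ((bidiscP _).1 lb').1.
have [ad fa _] := fb n nd.
have SP := slice_schwarz_pick nd zd ad; rewrite fa in SP.
have t1' : rnorm tau.1 = 1 := tau1.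
have tt : tau.1^* * tau.1 = 1 by rewrite mulrC conjM_rnorm t1' expr1n.
have za : rnorm (z - xi n) <= e * r.
  suff <- : rnorm (1 - tau.1^* * xi n - toC t) = rnorm (z - xi n) by [].
  have -> : 1 - tau.1^* * xi n - toC t = tau.1^* * (z - xi n).
    rewrite /z toCB toC1; transitivity ((tau.1^* * tau.1) * (1 - toC t) - tau.1^* * xi n).
      by rewrite tt; ring.
    by ring.
  by rewrite rnormM rnorm_conj t1' mul1r.
rewrite wt in P.
have Pa : t * `|al - 1| <= rnorm (phi (z, n) - xi n) + e * t + e * r.
  have -> : t * `|al - 1| = rnorm (toC (t * (al - 1))).
    by rewrite rnorm_toC normrM (gtr0_norm t0).
  have -> : toC (t * (al - 1)) = - (1 - tau.1^* * phi (z, n) - toC (t * al)) -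
      tau.1^* * (phi (z, n) - xi n) + (1 - tau.1^* * xi n - toC t).
    by rewrite !toCM toCB toC1; ring.
  apply: le_trans (modD _ _) _; apply: lerD Q.
  apply: le_trans (modB _ _) _; rewrite modN rnormM rnorm_conj t1' mul1r addrC.
  by rewrite lerD2l.
have F1 : rnorm (phi (z, n)) < 1 := phi_lt1 lb'; have F0 := rnorm_ge0 (phi (z, n)).
have Fd : 1 - rnorm (phi (z, n)) ^+ 2 <= 2 * (t * (al + e)).
  have D : 1 - rnorm (phi (z, n)) <= rnorm (1 - tau.1^* * phi (z, n)).
    by apply: le_trans (mod_lerB _ _); rewrite rnorm1 rnormM rnorm_conj t1' mul1r.
  have T : rnorm (1 - tau.1^* * phi (z, n)) <= e * t + t * al.
    rewrite -[1 - _](subrK (toC (t * al))).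
    have N : rnorm (toC (t * al)) = t * al.
      by rewrite rnorm_toC ger0_norm // mulr_ge0 // ltW.
    by apply: le_trans (modD _ _) _; rewrite N lerD2r.
  have := sqr_ge0 (1 - rnorm (phi (z, n))); rlra.
have aF := disc_sqr_gt0 ad.
have {}SP : rnorm (phi (z, n) - xi n) ^+ 2 * (1 - rnorm z ^+ 2) <=
    rnorm (z - xi n) ^+ 2 * (1 - rnorm (phi (z, n)) ^+ 2).
  by rewrite -(ler_pM2r aF); rlra.
have zt : t <= 1 - rnorm z ^+ 2.
  rewrite zN; have := mulr_ge0 (ltW t0) (_ : 0 <= 1 - t); rewrite subr_ge0 (ltW t1).
  by move=> /(_ isT); rlra.
have er : 0 <= e * r by rewrite mulr_ge0 // ltW.
have S1 : rnorm (phi (z, n) - xi n) ^+ 2 * t <= (e * r) ^+ 2 * (2 * (t * (al + e))).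
  apply: le_trans (ler_wpM2l (sqr_ge0 _) zt) _; apply: le_trans SP _.
  apply: ler_pM Fd; first exact: sqr_ge0.
    by rewrite subr_ge0 expr_le1 // ltW.
  by rewrite ler_pXn2r ?nnegrE ?rnorm_ge0.
have S2 : rnorm (phi (z, n) - xi n) <= e * r * (al + 2).
  rewrite -(@ler_pXn2r _ 2) ?nnegrE ?rnorm_ge0 ?mulr_ge0 ?addr_ge0 ?(ltW e0) ?(ltW r0) //.
  rewrite -(ler_pM2r t0); apply: le_trans S1 _.
  rewrite [leRHS]mulrAC exprMn -[leRHS]mulrA -[leRHS]mulrA.
  have : 0 <= (e * r) ^+ 2 * t by rewrite mulr_ge0 ?sqr_ge0 // ltW.
  have h : 2 * (al + e) <= (al + 2) ^+ 2 by have := sqr_ge0 al; rlra.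
  move=> /ler_wpM2l /(_ _ _ h); rlra.
have S3 : r * (b * `|al - 1|) <= r * (e * (al + 3 + b)).
  rewrite tE in Pa; rlra.
rewrite (ler_pM2l r0) in S3; apply: le_trans S3 _; rewrite mulrC.
exact: ler_wpM2l.
Qed.

End JuliaAt.

(** * Type II points *)

(** Along the graph of the branch of fixed points phi satisfies the condition at a
    B-point, since 1 - |phi| = 1 - |xi| is controlled by Julia's inequality. *)
Lemma branch_approach xi (b : R) : fixed_branch xi -> 0 <= b ->
  julia_horo xi tau.1 tau.2 b -> forall e : R, 0 < e -> exists l,
  [/\ bidisc l, rnorm (l - tau) < e, julia_quotient phi l <= 1 + 2 * b
    & rnorm (phi l - tau.1) < e].
Proof.
move=> fb b0 J e e0.
have xid (m : C) : disc m -> disc (xi m) by move=> md; have [] := fb m md.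
have q0 : 0 < 2 * b + 1 by rewrite ltr_wpDl // mulr_ge0.
have : all (fun r => 0 < r) [:: 1; e; e / (2 * b + 1)] by rewrite /= ltr01 e0 divr_gt0.
move=> /exists_small [r r0 /= /and4P[r1 re rb _]].
have [nd nN nt] := radius_point tau2 r0 r1.
have [h1 h2] := julia_horo_radius xid tau1 tau2 b0 J r0 r1.
move: (toC (1 - r) * tau.2) => n in nd nN nt h1 h2.
have [ad fa _] := fb n nd; have x1 : rnorm (xi n) < 1 := ad.
rewrite ltr_pdivlMr // in rb.
have X0 := rnorm_ge0 (xi n - tau.1).
have D : rnorm (xi n - tau.1) < e.
  have : (1 - r) * rnorm (xi n - tau.1) >= 0 by rewrite mulr_ge0 // subr_ge0 ltW.
  rlra.
have lb := pair_bidisc ad nd; exists (xi n, n); split => //; last by rewrite fa.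
  by rewrite pair_maxB gt_max; apply/andP; split; rewrite ?nt.
have l1 : rnorm ((xi n, n) : C * C) < 1 := lb.
rewrite /julia_quotient ler_pdivrMr ?subr_gt0 // fa.
have le1 : 0 <= 1 - rnorm (xi n) by rewrite subr_ge0 ltW.
rewrite pair_max; have [le|gt] := lerP (rnorm (xi n)) (rnorm n).
  rewrite nN; have := mulr_ge0 (_ : 0 <= 1 - r) le1; rewrite subr_ge0 => /(_ (ltW r1)).
  rlra.
have := mulr_ge0 b0 le1; rlra.
Qed.

Lemma branch_B_point xi (b : R) : fixed_branch xi -> 0 <= b ->
  julia_horo xi tau.1 tau.2 b -> B_point phi tau.
Proof.
move=> fb b0 J; apply/B_pointP; split => //; exists (1 + 2 * b) => d d0.
by have [l [lb lt lq _]] := branch_approach fb b0 J d0; exists l.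
Qed.

(** The cluster values of phi along a sequence realising the B-point are nontangential
    limits. *)
Lemma B_point_julia : B_point phi tau -> nt_limit phi tau tau.1 ->
  exists K, julia_at tau.1 K.
Proof.
move=> /B_pointP [_ [B lB]] nt.
have n0 (n : nat) : 0 < n.+1%:R^-1 :> R by rewrite invr_gt0.
have [l lP] := choice (fun n => lB _ (n0 n)).
have small (e : R) : 0 < e -> exists N, forall n, (N <= n)%N -> n.+1%:R^-1 < e.
  move=> e0; have [N _ NP] := near_infty_natSinv_lt (PosNum e0); exists N => n nN.
  exact: NP nN.
have lb n : bidisc (l n) by have [] := lP n.
have [w wP] := bounded_cluster (fun n => ltW (phi_lt1 (lb n))).
have [K jw] : exists K, julia_at w K.
  apply: (@julia_of_seq _ B) => e e0; have [N NP] := small e e0.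
  have [n nN nw] := wP e e0 N; have [_ nl nq] := lP n.
  by exists (l n); split => //; exact: lt_trans nl (NP n nN).
by exists K; rewrite -(nt_limit_unique tau_sphere (julia_nt_limit jw) nt).
Qed.

Lemma line_vectors (w : C) (K : R) : julia_at w K ->
  exists X, forall M : R, 0 < M -> line_vector w M (X M).
Proof.
move=> jw; have ex (M : R) : exists x, 0 < M -> line_vector w M x.
  have [M0|M0] := ltP 0 M; last by exists 0.
  by have [x xP] := line_limit jw M0; exists x.
by have [X XP] := choice ex; exists X.
Qed.

Lemma dirder_line (w : C) (K M : R) X : julia_at w K -> 0 < M ->
  line_vector w M (X M) ->
  dirderN phi tau (tau.1, tau.2 * toC M) (- w * toC (slope X M)).
Proof.
move=> jw M0 [_ XP]; have [w1 _ _] := jw; exists w; first exact: julia_nt_limit jw.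
apply/cvg_at_right_rnorm => e e0; have e2 : 0 < e / 2 by rlra.
have [d d0 dP] := XP _ e2; exists d => // t t0 td.
have tt : toC t != 0 :> C by apply/eqP => /toC_inj h; move: t0; rewrite h ltxx.
have -> : tau - toC t *: ((tau.1, tau.2 * toC M) : C * C) = line M t.
  rewrite /line [LHS]surjective_pairing; congr pair.
    by transitivity (tau.1 - toC t * tau.1); rewrite // toCB toC1; ring.
  by transitivity (tau.2 - toC t * (tau.2 * toC M)); rewrite // toCB toCM toC1; ring.
have ww : w * w^* = 1 by rewrite conjM_rnorm w1 expr1n.
have -> : (phi (line M t) - w) / toC t - - w * toC (slope X M) =
    (toC t)^-1 * - (w * (1 - w^* * phi (line M t) - toC (t * slope X M))).
  rewrite toCM; transitivity ((toC t)^-1 *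
      - (w - (w * w^*) * phi (line M t) - toC t * (w * toC (slope X M)))).
    by rewrite ww; field.
  by congr (_ * _); ring.
rewrite rnormM modN rnormM w1 mul1r rnormV rnorm_toC gtr0_norm //.
rewrite mulrC ltr_pdivrMr //; apply: le_lt_trans (dP t t0 td) _.
by rewrite ltr_pM2r //; rlra.
Qed.

Lemma dirder_unique (delta d d' : C * C) (a a' : C) :
  dirderN phi tau delta a -> dirderN phi tau delta a' -> a = a'.
Proof.
move=> [w nw da] [w' nw' da']; rewrite -(nt_limit_unique tau_sphere nw nw') in da'.
exact: cvg_unique da da'.
Qed.

Section Slopes.
Variables (K0 : R) (X : R -> H).
Hypothesis jw : julia_at tau.1 K0.
Hypothesis XP : forall M : R, 0 < M -> line_vector tau.1 M (X M).
Hypotheses (tauB : B_point phi tau) (tau_limit : nt_limit phi tau tau.1).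
Local Notation al := (slope X).

Lemma dirder_slope (M : R) (d : C) : 0 < M ->
  dirderN phi tau (tau.1, tau.2 * toC M) d <-> d = - tau.1 * toC (al M).
Proof.
move=> M0; have D := dirder_line jw M0 (XP M0).
by split => [d'|->] //; exact: dirder_unique d' D.
Qed.

(** Both sides are equivalent to domination by the first coordinate, the right one through
    the limit of [X M] as M tends to infinity. *)
Lemma typeI_slope : left_typeI_DW phi ip p1 p2 u tau <-> forall M, 0 < M -> al M <= 1.
Proof.
split=> [[_ _ _ [v [vY v1 v2]]]|h].
  have dom : dominated tau.1 := @dominated_of_typeI _ _ jw v vY v1 v2.
  by move=> M M0; exact: (slope_le1_of_dominated jw XP dom M0).
split => //; last exact (@typeI_of_slope_le1 _ _ jw X XP h).
split => // P /nbhs_rnorm [d d0 dP].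
have : all (fun r => 0 < r) [:: 1; d] by rewrite /= ltr01 d0.
move=> /exists_small [r r0 /= /and3P[r1 rd _]].
have [nd _ nt] := radius_point tau2 r0 r1; exists (toC (1 - r) * tau.2); split => //.
by apply: dP; have nt' : rnorm (toC (1 - r) * tau.2 - tau.2) < d by rewrite nt.
Qed.

Lemma slope_one_unique (A B N : R) : 0 < A -> 0 < B -> al A = 1 -> al B = 1 ->
  0 < N -> al N <> 1 -> A = B.
Proof.
move=> A0 B0 a1 b1 N0 n1; apply/eqP; rewrite eq_le !leNgt.
apply/andP; split; apply/negP => lt; apply: n1.
  by rewrite -a1; apply: (slope_eq_const jw XP B0 lt) => //; rewrite a1 b1.
by rewrite -b1; apply: (slope_eq_const jw XP A0 lt) => //; rewrite a1 b1.
Qed.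

(** A vector v as in the definition of Type II points with constant K gives al K <= 1, and
    some slope exceeds 1 since tau is not of Type I.  Conversely [X A] is such a vector,
    for all K <= A. *)
Lemma typeII_slope (K : R) : 0 < K -> left_typeII_DW_const phi ip p1 p2 u tau K <->
  (exists2 A, K <= A & al A = 1) /\ exists2 N, 0 < N & al N <> 1.
Proof.
move=> K00; split.
  move=> [[_ _ _ _ nI] _ [v [vY v1 v2]]].
  have bv := Yset_boundary jw vY.
  have lK : al K <= 1 by apply: le_trans (slope_le_weighted jw XP bv K00) _.
  have [N [N0 lN]] : exists N, 0 < N /\ 1 < al N.
    apply: contrapT => nex; apply: nI; apply/typeI_slope => M M0.
    by rewrite leNgt; apply/negP => lM; apply: nex; exists M.
  split; first exact: (slope_ivt jw XP K00 lK N0 lN).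
  by exists N => // E; move: lN; rewrite E ltxx.
move=> [[A KA a1] [N N0 n1]]; have A0 := lt_le_trans K00 KA.
have x0 := rnorm_ge0 (p1 (X A)).
have x2 : p2 (X A) <> 0.
  by move=> x2; apply: n1; rewrite (slope_const jw XP A0 N0 x2).
have y0 : 0 < rnorm (p2 (X A)) ^+ 2.
  rewrite exprn_gt0 // lt_def rnorm_ge0 andbT; apply/negP => /eqP h.
  by apply: x2; exact: rnorm_eq0.
have a1' : rnorm (p1 (X A)) ^+ 2 + A * rnorm (p2 (X A)) ^+ 2 = 1 := a1.
have x1 : rnorm (p1 (X A)) < 1.
  rewrite -(@ltr_pXn2r _ 2) ?nnegrE // expr1n; have := mulr_gt0 A0 y0; rlra.
have Y := line_vector_Yset jw XP A0.
split => //; last by exists (X A); split => //; have := ler_wpM2r (ltW y0) KA; rlra.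
split => //; first by exists (X A).
move=> /typeI_slope l1; apply: n1.
have A1 : 0 < A + 1 by rewrite addr_gt0.
have AA : A < A + 1 by rewrite ltrDl.
have E : al (A + 1) = 1.
  apply/eqP; rewrite eq_le l1 //= -[X in X <= _]a1.
  by apply: (slope_mono jw XP A0); exact: ltW.
by rewrite (slope_eq_const jw XP A0 AA _ N0) // a1 E.
Qed.

Lemma slope_neq1_of_branch xi : fixed_branch xi -> exists2 N, 0 < N & al N <> 1.
Proof.
move=> fb; apply: contrapT => nex.
have [v [vY v1 v2]] : exists v, [/\ Yset phi ip u tau v, rnorm (p1 v) <= 1 & p2 v = 0].
  apply: (typeI_of_slope_le1 jw XP) => M M0; apply: contrapT => lM; apply: nex.
  by exists M => // E; apply: lM; rewrite E.
have dom : dominated tau.1 := @dominated_of_typeI _ _ jw v vY v1 v2.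
exact: (branch_not_dominated erefl fb dom).
Qed.

End Slopes.

Lemma left_typeII_of_branch (xi : C -> C) : ~ (forall l, bidisc l -> phi l = l.1) ->
  fixed_branch xi -> left_typeII phi.
Proof.
move=> ne fb; split => //; exists xi; first exact: fixed_branch_holomorphic.
move=> a m ad md; have [bd fa _] := fb m md; split => [|<- //].
exact: fixed_branch_unique.
Qed.

(** If u2 vanished at one point of the graph then xi would be constant, contrary to its
    boundary limit. *)
Lemma fixed_branch_of_typeII (xi : C -> C) : left_typeII phi ->
  (forall m : C, disc m -> disc (xi m)) ->
  (forall m : C, disc m -> phi (xi m, m) = xi m) -> nt_limit xi tau.2 tau.1 ->
  fixed_branch xi.
Proof.
move=> [_ [zeta _ zP]] xid fx lim m md; have ad := xid m md.
split; [exact: ad|exact: fx|move=> ua].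
have const (n : C) : disc n -> xi n = xi m.
  move=> nd; have fa := common_fixed_point ad md nd (fx m md) ua.
  by rewrite -((zP _ _ ad nd).1 fa); apply/esym/(zP _ _ (xid n nd) nd)/fx.
have x1 : rnorm (xi m) < 1 := ad.
have e0 : 0 < 1 - rnorm (xi m) by rewrite subr_gt0.
have [d d0 dP] := nt_limit_radius tau2 lim e0.
have : all (fun r => 0 < r) [:: 1; d] by rewrite /= ltr01 d0.
move=> /exists_small [r r0 /= /and3P[r1 rd _]].
have [nd _ _] := radius_point tau2 r0 r1.
have h : rnorm (xi (toC (1 - r) * tau.2) - tau.1) < 1 - rnorm (xi m) := dP r r0 rd r1.
rewrite (const _ nd) in h; have t1' : rnorm tau.1 = 1 := tau1.
by have := mod_lerB tau.1 (xi m); rewrite t1' mod_subC => /le_lt_trans /(_ h); rewrite ltxx.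
Qed.

Section Branch.
Variables (xi : C -> C) (c : R).
Hypothesis fb : fixed_branch xi.
Hypothesis xi_limit : nt_limit xi tau.2 tau.1.
Hypothesis xi_liminf : (julia_liminf xi tau.2 <= c%:E)%E.

Lemma branch_slope : exists b : R, [/\ 0 < b, b <= c, julia_liminf xi tau.2 = b%:E,
  B_point phi tau & exists K0, julia_at tau.1 K0 /\
    forall X, (forall M : R, 0 < M -> line_vector tau.1 M (X M)) -> slope X b^-1 = 1].
Proof.
have xid (m : C) : disc m -> disc (xi m) by move=> md; have [] := @fb m md.
have [b [b0 bc lb]] := julia_liminf_real xid xi_liminf.
have lb' : (julia_liminf xi tau.2 <= b%:E)%E by rewrite lb.
have J := julia_horo_of_liminf xid tau2 (fixed_branch_schwarz_pick fb) tau1 b0 xi_limit lb'.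
have b00 := julia_horo_pos xid tau1 tau2 J.
have [K0 jw] := julia_of_seq (branch_approach fb b0 J).
exists b; split => //; first exact: branch_B_point fb b0 J.
exists K0; split => // X XP.
have lb2 : (b%:E <= julia_liminf xi tau.2)%E by rewrite lb.
exact: (slope_of_branch erefl XP fb b00 J lb2).
Qed.

End Branch.

Lemma left_equivalence (K : R) : 0 < K -> ~ (forall l, bidisc l -> phi l = l.1) ->
    let is_xi (xi : C -> C) :=
      holo_into_disc xi /\ forall m : C, disc m -> phi (xi m, m) = xi m in
    let D (M : R) (d : C) := dirderN phi tau (tau.1, tau.2 * toC M) d in
    let i := left_typeII_DW_const phi ip p1 p2 u tau K in
    let ii := left_typeII phi /\
      exists2 xi, is_xi xi &
        [/\ B_point xi tau.2, nt_limit xi tau.2 tau.1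
          & (julia_liminf xi tau.2 <= (K^-1)%:E)%E] in
    let iii :=
      [/\ B_point phi tau, nt_limit phi tau tau.1,
          exists M M' d d', [/\ 0 < M, 0 < M', D M d, D M' d' & d <> d']
        & exists A d, [/\ K <= A, D A d & d / (- tau.1) = 1]] in
    [/\ i <-> ii, ii <-> iii
      & i \/ ii \/ iii -> forall xi, is_xi xi ->
        exists A : R,
          [/\ 0 < A, julia_liminf xi tau.2 = (A^-1)%:E,
              left_typeII_DW_const phi ip p1 p2 u tau A /\
                (forall K', 0 < K' ->
                  left_typeII_DW_const phi ip p1 p2 u tau K' -> K' <= A),
              exists2 d, D A d & d / (- tau.1) = 1
            & forall B d, 0 < B -> D B d -> d / (- tau.1) = 1 -> B = A]].
Proof.
move=> K00 ne is_xi D i ii iii.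
have t0 : - tau.1 != 0.
  rewrite oppr_eq0; apply/eqP => h; have t1' : rnorm tau.1 = 1 := tau1.
  by move: t1'; rewrite h mod0 => /eqP; rewrite eq_sym oner_eq0.
have quot (a : R) : (- tau.1 * toC a) / (- tau.1) = 1 <-> a = 1.
  rewrite mulrC mulKf //; split => [h|-> //]; exact: toC_inj.
(* The directional derivatives are -tau1 times the slopes. *)
have iiiP (K0 : R) X : julia_at tau.1 K0 ->
    (forall M : R, 0 < M -> line_vector tau.1 M (X M)) ->
    B_point phi tau -> nt_limit phi tau tau.1 -> i <-> iii.
  move=> jw XP tB tl; split.
    move=> /(typeII_slope jw XP tB tl K00) [[A KA a1] [N N0 n1]].
    have A0 := lt_le_trans K00 KA; split => //.
      exists N, A, (- tau.1 * toC (slope X N)), (- tau.1 * toC (slope X A)); split => //.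
      - by apply/(dirder_slope jw XP).
      - by apply/(dirder_slope jw XP).
      by move=> /(mulfI t0) /toC_inj; rewrite a1.
    exists A, (- tau.1 * toC (slope X A)); split => //.
      by apply/(dirder_slope jw XP).
    exact/quot.
  move=> [_ _ [M [M' [d [d' [M0 M'0 Dd Dd' dd]]]]] [A [d'' [KA DA a1]]]].
  have A0 := lt_le_trans K00 KA.
  move: DA a1 => /(dirder_slope jw XP _ A0) -> /quot a1.
  apply/(typeII_slope jw XP tB tl K00); split; first by exists A.
  move: Dd => /(dirder_slope jw XP _ M0) dE; move: Dd' => /(dirder_slope jw XP _ M'0) dE'.
  have [m1|m1] := eqVneq (slope X M) 1; last by exists M => //; apply/eqP.
  by exists M' => // m1'; apply: dd; rewrite dE dE' m1 m1'.
have i_iii : i <-> iii.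
  have [h|h] := pselect (B_point phi tau /\ nt_limit phi tau tau.1); last first.
    by split => [[[_ ? ? _ _] _ _]|[? ? _ _]]; case: h.
  have [tB tl] := h; have [K0 jw] := B_point_julia tB tl.
  have [X XP] := line_vectors jw; exact: (iiiP _ _ jw XP tB tl).
have branch (xi : C -> C) : left_typeII phi -> is_xi xi -> nt_limit xi tau.2 tau.1 -> fixed_branch xi.
  by move=> tII [xh fx]; exact: fixed_branch_of_typeII tII xh.2 fx.
have i_branch (A : R) : 0 < A -> left_typeII_DW_const phi ip p1 p2 u tau A ->
   exists2 xi, fixed_branch xi & forall zeta, fixed_branch zeta ->
     julia_horo zeta tau.1 tau.2 A^-1.
  move=> A0 [[_ tB tl _ nI] _ [v [vY v1 vA]]].
  have [K0 jw] := B_point_julia tB tl; have [X XP] := line_vectors jw.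
  have bv := Yset_boundary jw vY.
  have nd : ~ dominated tau.1.
    move=> dom; apply: nI; apply/(typeI_slope jw XP tB tl) => M M0.
    exact: (slope_le1_of_dominated jw XP dom M0).
  have [xi fb] := exists_branch jw erefl bv v1 nd; exists xi => // zeta fz.
  exact: (branch_horo jw erefl fz bv v1 A0).
have i_ii : i -> ii.
  move=> /(i_branch _ K00) [xi fb /(_ _ fb) J].
  have xh := fixed_branch_holomorphic fb.
  have K'0 : 0 <= K^-1 by rewrite invr_ge0 ltW.
  split; first exact: left_typeII_of_branch fb.
  exists xi; first by split => // m md; have [] := fb m md.
  split.
  - exact: (julia_horo_B_point xh.2 tau1 tau2 K'0 J).
  - exact: (julia_horo_nt_limit xh.2 tau1 tau2 K'0 J).
  exact: (julia_horo_liminf xh.2 tau1 tau2 K'0 J).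
have ii_i : ii -> i.
  move=> [tII [xi xP [_ xl xb]]]; have fb := branch xi tII xP xl.
  have [b [b0 bK _ tB [K0 [jw bX]]]] := branch_slope fb xl xb.
  have [X XP] := line_vectors jw; have tl := julia_nt_limit jw.
  apply/(typeII_slope jw XP tB tl K00); split; last exact: slope_neq1_of_branch jw XP _ fb.
  exists b^-1; last exact: bX.
  by rewrite -[K]invrK lef_pV2 // ?posrE ?invr_gt0.
split; [by split|by rewrite -i_iii; split|].
move=> any xi xP.
have hi : i by case: any => [//|[/ii_i //|/i_iii]].
have [[_ tB tl _ _] _ _] := hi; have [K0 jw] := B_point_julia tB tl.
have [X XP] := line_vectors jw.
have tS := typeII_slope jw XP tB tl.
have [[A KA a1] [N N0 n1]] := (tS _ K00).1 hi.
have A0 := lt_le_trans K00 KA; have A'0 : 0 <= A^-1 by rewrite invr_ge0 ltW.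
have uniq (B : R) : 0 < B -> slope X B = 1 -> B = A.
  by move=> B0 b1; exact: (slope_one_unique jw XP B0 A0 b1 a1 N0 n1).
have hA : left_typeII_DW_const phi ip p1 p2 u tau A.
  by apply/(tS _ A0); split; [exists A|exists N].
have [zeta fz J] := i_branch A A0 hA.
have fb : fixed_branch xi.
  move=> m md; have <- : zeta m = xi m.
    exact: (fixed_branch_unique fz (xP.1.2 m md) md (xP.2 m md)).
  exact: fz.
have xid := xP.1.2; have {}J := J _ fb.
have xl := julia_horo_nt_limit xid tau1 tau2 A'0 J.
have xb := julia_horo_liminf xid tau1 tau2 A'0 J.
have [b [b0 _ lb _ [_ [_ /(_ X XP) b1]]]] := branch_slope fb xl xb.
have bA : b^-1 = A by apply: uniq b1; rewrite invr_gt0.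
exists A; split => //.
- by rewrite lb -bA invrK.
- split => // K' K'0 /(tS _ K'0) [[B KB b1'] _].
  by rewrite -(uniq B _ b1') // (lt_le_trans K'0 KB).
- exists (- tau.1 * toC (slope X A)); last exact/quot.
  by apply/(dirder_slope jw XP).
by move=> B d B0 /(dirder_slope jw XP _ B0) -> /quot; exact: uniq.
Qed.

End Model.

(** * Exchange of the coordinates *)

Section Swap.
Context {R : realType}.
Local Notation C := (Cplx R).
Implicit Types (phi : C * C -> C) (l tau delta : C * C).

Lemma swapK : involutive (@swap R).
Proof. by case. Qed.

Lemma rnorm_swap l : rnorm (swap l) = rnorm l.
Proof. by rewrite !pair_max maxC. Qed.

Lemma rnorm_swapB l tau : rnorm (swap l - swap tau) = rnorm (l - tau).
Proof. exact: (rnorm_swap (l - tau)). Qed.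

Lemma comp_swapK (T : Type) (f : C * C -> T) : (f \o swap) \o swap = f.
Proof. by apply/funext => l; rewrite /comp swapK. Qed.

Lemma bidisc_swap l : bidisc l -> bidisc (swap l).
Proof. by move=> lb; have h : rnorm (swap l) < 1 by rewrite rnorm_swap. Qed.

Lemma differentiable_swap l : differentiable (@swap R) l.
Proof.
apply: differentiable_pair.
  exact: (@linear_differentiable _ _ _ (@snd C C) l (fun l => @cvg_snd _ _ _ _ _)).
exact: (@linear_differentiable _ _ _ (@fst C C) l (fun l => @cvg_fst _ _ _ _ _)).
Qed.

Lemma holomorphic_swap (V : normedModType C) (f : C * C -> V) :
  holomorphic f -> holomorphic (f \o swap).
Proof.
move=> fh l lb; apply: differentiable_comp; first exact: differentiable_swap.
by apply: fh; exact: bidisc_swap.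
Qed.

Lemma holo_into_disc_swap phi : holo_into_disc phi -> holo_into_disc (phi \o swap).
Proof.
by move=> [ph pd]; split; [exact: holomorphic_swap|move=> l /bidisc_swap; exact: pd].
Qed.

Lemma is_model_swap (H : completeNormedModType C) (ip : {dot H for Num.conj})
    (M1 M2 : set H) (p1 p2 : H -> H) (u : C * C -> H) phi :
  is_model phi ip M1 M2 p1 p2 u -> is_model (phi \o swap) ip M2 M1 p2 p1 (u \o swap).
Proof.
move=> [hd uh e]; split; first exact: hilbert_decomposition_swap.
  exact: holomorphic_swap.
by move=> l m lb mb; rewrite [RHS]addrC; exact: (e _ _ (bidisc_swap lb) (bidisc_swap mb)).
Qed.

Lemma sphere_swap tau : unit_sphere tau -> unit_sphere (swap tau).
Proof. by move=> h; have e : rnorm (swap tau) = 1 by rewrite rnorm_swap. Qed.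

Lemma B_point_swap phi tau : B_point (phi \o swap) (swap tau) = B_point phi tau.
Proof.
suff imp (f : C * C -> C) (t : C * C) : B_point f t -> B_point (f \o swap) (swap t).
  by apply/propext; split => [/imp|/imp //]; rewrite comp_swapK swapK.
move=> /B_pointP [t1 [B fB]]; apply/B_pointP; split; first exact: sphere_swap.
exists B => d d0; have [l [lb lt lq]] := fB d d0; exists (swap l); split.
- exact: bidisc_swap.
- by rewrite rnorm_swapB.
by rewrite /julia_quotient /comp swapK rnorm_swap.
Qed.

Lemma nt_limit_swap phi tau : unit_sphere tau ->
  nt_limit (phi \o swap) (swap tau) = nt_limit phi tau.
Proof.
move=> t1; apply/funext => w.
have imp (f : C * C -> C) (t : C * C) : unit_sphere t -> nt_limit f t w -> nt_limit (f \o swap) (swap t) w.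
  move=> h /(nt_limitP _ _ h) fl; apply/(nt_limitP _ _ (sphere_swap h)) => c e c0 e0.
  have [d d0 dP] := fl c e c0 e0; exists d; first exact: d0.
  move=> l lb lc ld.
  have ld' : rnorm (swap l - t) < d by rewrite -[t]swapK rnorm_swapB.
  have lc' : rnorm (t - swap l) <= c * (1 - rnorm (swap l)).
    by rewrite -[t]swapK rnorm_swapB rnorm_swap.
  exact: dP (bidisc_swap lb) lc' ld'.
apply/propext; split; last exact: imp.
by move=> /(imp _ _ (sphere_swap t1)); rewrite comp_swapK swapK.
Qed.

Lemma dirderN_swap phi tau : unit_sphere tau ->
  dirderN phi tau = fun delta => dirderN (phi \o swap) (swap tau) (swap delta).
Proof. by move=> t1; apply/funext => delta; rewrite /dirderN nt_limit_swap. Qed.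

End Swap.

Theorem theorem2p10 (R : realType) (phi : Cplx R * Cplx R -> Cplx R)
    (phi_holo : holo_into_disc phi)
    (H : completeNormedModType (Cplx R)) (ip : {dot H for Num.conj})
    (M1 M2 : set H) (p1 p2 : H -> H) (u : Cplx R * Cplx R -> H)
    (model : is_model phi ip M1 M2 p1 p2 u)
    (tau : Cplx R * Cplx R) (tau1 : circle tau.1) (tau2 : circle tau.2)
    (K : R) (K_gt0 : 0 < K) :
  (~ (forall l, bidisc l -> phi l = l.1) ->
    let is_xi (xi : Cplx R -> Cplx R) :=
      holo_into_disc xi /\ forall m, disc m -> phi (xi m, m) = xi m in
    let D (M : R) (d : Cplx R) := dirderN phi tau (tau.1, tau.2 * toC M) d in
    let i := left_typeII_DW_const phi ip p1 p2 u tau K in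
    let ii := left_typeII phi /\
      exists2 xi, is_xi xi &
        [/\ B_point xi tau.2, nt_limit xi tau.2 tau.1
          & (julia_liminf xi tau.2 <= (K^-1)%:E)%E] in
    let iii :=
      [/\ B_point phi tau, nt_limit phi tau tau.1,
          exists M M' d d', [/\ 0 < M, 0 < M', D M d, D M' d' & d <> d']
        & exists A d, [/\ K <= A, D A d & d / (- tau.1) = 1]] in
    [/\ i <-> ii, ii <-> iii
      & i \/ ii \/ iii -> forall xi, is_xi xi ->
        exists A : R,
          [/\ 0 < A, julia_liminf xi tau.2 = (A^-1)%:E,
              left_typeII_DW_const phi ip p1 p2 u tau A /\
                (forall K', 0 < K' ->
                  left_typeII_DW_const phi ip p1 p2 u tau K' -> K' <= A),
              exists2 d, D A d & d / (- tau.1) = 1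
            & forall B d, 0 < B -> D B d -> d / (- tau.1) = 1 -> B = A]]) /\
  (~ (forall l, bidisc l -> phi l = l.2) ->
    let is_eta (eta : Cplx R -> Cplx R) :=
      holo_into_disc eta /\ forall l, disc l -> phi (l, eta l) = eta l in
    let D (M : R) (d : Cplx R) := dirderN phi tau (tau.1 * toC M, tau.2) d in
    let i' := right_typeII_DW_const phi ip p1 p2 u tau K in
    let ii' := right_typeII phi /\
      exists2 eta, is_eta eta &
        [/\ B_point eta tau.1, nt_limit eta tau.1 tau.2
          & (julia_liminf eta tau.1 <= (K^-1)%:E)%E] in
    let iii' :=
      [/\ B_point phi tau, nt_limit phi tau tau.2,
          exists M M' d d', [/\ 0 < M, 0 < M', D M d, D M' d' & d <> d']
        & exists A d, [/\ K <= A, D A d & d / (- tau.2) = 1]] in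
    [/\ i' <-> ii', ii' <-> iii'
      & i' \/ ii' \/ iii' -> forall eta, is_eta eta ->
        exists A : R,
          [/\ 0 < A, julia_liminf eta tau.1 = (A^-1)%:E,
              right_typeII_DW_const phi ip p1 p2 u tau A /\
                (forall K', 0 < K' ->
                  right_typeII_DW_const phi ip p1 p2 u tau K' -> K' <= A),
              exists2 d, D A d & d / (- tau.2) = 1
            & forall B d, 0 < B -> D B d -> d / (- tau.2) = 1 -> B = A]]).
Proof.
split=> ne; first exact (left_equivalence phi_holo model tau1 tau2 K_gt0 ne).
have ts := torus_sphere tau1 tau2.
have ne' : ~ (forall l, bidisc l -> (phi \o swap) l = l.1).
  by move=> h; apply: ne => l /bidisc_swap /h; rewrite /comp swapK.
rewrite -(B_point_swap phi tau) -(nt_limit_swap phi ts) (dirderN_swap phi ts).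
exact (left_equivalence (tau := swap tau) (holo_into_disc_swap phi_holo)
  (is_model_swap model) tau2 tau1 K_gt0 ne').
Qed.
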